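(* Let $G_1,G_2\subset G$ be a matched pair of locally compact groups and let $A$ be a Polish $G$-module. The cochain transformation $T:(C^n(A))_{n\ge0}\to(E^n(A))_{n\ge0}$ from the Kac cochain complex to the pentagonal cochain complex is a cohomology isomorphism between Kac cohomology $H(\mathrm{m.p.},A)$ and pentagonal cohomology $H(\mathrm{pent},A)$; that is, it induces an isomorphism in cohomology in every degree $n\ge0$.
   Context: All locally compact groups are second countable. A matched pair is a locally compact group $G$ with closed subgroups $G_1,G_2$ such that $G_1\cap G_2=\{e\}$ and $G\setminus G_1G_2$ has Haar measure zero. A Polish $G$-module is a Polish abelian group with a continuous action of $G$ by automorphisms. $\mathrm{L}(X,A)$ is the group of Borel maps $X\to A$ modulo equality almost everywhere. Spaces: for $p,q\ge0$, $\Gamma_{pq}$ is the space of families $X=(g_{ij},s_{ij})$ with $g_{ij}\in G_1$ ($1\le i\le p$, $0\le j\le q$) and $s_{ij}\in G_2$ ($0\le i\le p$, $1\le j\le q$) satisfying $s_{i-1,j}\,g_{ij}=g_{i,j-1}\,s_{ij}$ (a grid of $p$ rows and $q$ columns of squares, with horizontal edges $s_{ij}$ and vertical edges $g_{ij}$); $\Gamma_{00}$ is a point. Picking out one row and one column of edges gives an injective map $\Gamma_{pq}\to G_1^p\times G_2^q$ with conull image, which defines (independently of the choice) the measure class on $\Gamma_{pq}$. Equivalently $X$ is a matrix $(y_{ij})_{0\le i\le p,0\le j\le q}$ in $G$, up to left multiplication by $G$, with $g_{ij}=y_{i-1,j}^{-1}y_{ij}$, $s_{ij}=y_{i,j-1}^{-1}y_{ij}$.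 Faces: $\partial^{\rm h}_i:\Gamma_{pq}\to\Gamma_{p,q-1}$ removes the $i$-th column of the matrix, $\partial^{\rm v}_j:\Gamma_{pq}\to\Gamma_{p-1,q}$ removes the $j$-th row. Operators: $\mathrm{d}^{\rm h}_i:\mathrm{L}(\Gamma_{pq},A)\to\mathrm{L}(\Gamma_{p,q+1},A)$, $(\mathrm{d}^{\rm h}_0F)(X)=s_{01}\cdot F(\partial^{\rm h}_0X)$, $(\mathrm{d}^{\rm h}_iF)(X)=F(\partial^{\rm h}_iX)$ for $1\le i\le q+1$; $\mathrm{d}^{\rm v}_j:\mathrm{L}(\Gamma_{pq},A)\to\mathrm{L}(\Gamma_{p+1,q},A)$, $(\mathrm{d}^{\rm v}_0F)(X)=g_{10}\cdot F(\partial^{\rm v}_0X)$, $(\mathrm{d}^{\rm v}_jF)(X)=F(\partial^{\rm v}_jX)$ for $1\le j\le p+1$. Put $\mathrm{d}^{\rm h}=\sum_{i=0}^{q+1}(-1)^i\mathrm{d}^{\rm h}_i$, $\mathrm{d}^{\rm v}=\sum_{j=0}^{p+1}(-1)^j\mathrm{d}^{\rm v}_j$, and by convention $\mathrm{d}^{\rm h}_{q+2}=\mathrm{d}^{\rm h}_{q+1}$, $\mathrm{d}^{\rm v}_{-1}=\mathrm{d}^{\rm v}_0$ on $\mathrm{L}(\Gamma_{pq},A)$. Kac complex (it computes the Kac cohomology $H(\mathrm{m.p.},A)$): $C^n(A)=\bigoplus_{p+q=n+1,\;p,q\ge1}\mathrm{L}(\Gamma_{pq},A)$ for $n\ge1$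 with $\mathrm{d}=\mathrm{d}^{\rm h}+(-1)^q\mathrm{d}^{\rm v}$ on $\mathrm{L}(\Gamma_{pq},A)$; $C^0(A)=A$ with $\mathrm{d}:C^0(A)\to C^1(A)=\mathrm{L}(\Gamma_{11},A)$, $(\mathrm{d}a)(X)=x\cdot a-s\cdot a-h\cdot a+a$ where $X\in\Gamma_{11}$ has top edge $s=s_{01}$, right edge $g=g_{11}$, left edge $h=g_{10}$, bottom edge $t=s_{11}$ and $x=sg=ht$. Pentagonal complex: $E^n(A)=\mathrm{L}(\Gamma_{nn},A)$ for $n\ge1$ with $\mathrm{d}_{\rm pent}=\sum_{i=0}^{n+2}(-1)^i\,\mathrm{d}^{\rm h}_i\mathrm{d}^{\rm v}_{i-1}:E^n(A)\to E^{n+1}(A)$; $E^0(A)=A\oplus A$ with $\mathrm{d}_{\rm pent}(a,b)=\mathrm{d}(a)+\mathrm{d}^{\rm h}_0\mathrm{d}^{\rm v}_1(b)$, where $\mathrm{d}(a)$ is as in the Kac complex and $b\in A=\mathrm{L}(\Gamma_{00},A)$. Its cohomology is $H(\mathrm{pent},A)$. For $A=\mathbb T$ with trivial action, $H^2(\mathrm{pent},\mathbb T)$ is the $2$-cohomology group associated with the pentagonal transformation of the matched pair. The map $T$: $T(a)=a\oplus0$ for $n=0$. For $n\ge1$ and $F=(F_i)_{1\le i\le n}\in C^n(A)$ with $F_i\in\mathrm{L}(\Gamma_{n+1-i,i},A)$, for $X\in\Gamma_{nn}$, $$(TF)(X)=\sum_{i=1}^n(g_{10}g_{20}\cdots g_{i-1,0})\cdot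 F_i(Q_iX),$$ where $Q_iX\in\Gamma_{n+1-i,i}$ is the lower left corner of $X$ consisting of the last $n+1-i$ rows and the first $i$ columns of squares (the product is $e$ for $i=1$). Equivalently, $T$ is the map with $\mathrm{d}^{\rm h}_{n+1}\mathrm{d}^{\rm v}_0\,T=I'$ on $C^n(A)$, where $I'(F)(X)=\sum_i(g_{10}\cdots g_{i0})\cdot F_i(P_iX)$ for $X\in\Gamma_{n+1,n+1}$ and $P_iX$ is the lower left corner formed by the last $n+1-i$ rows and first $i$ columns. *)

(* Defs.v *)
From HB Require Import structures.
From mathcomp Require Import all_boot all_order all_algebra.
From mathcomp Require Import all_classical all_reals all_analysis.

Set Implicit Arguments.
Unset Strict Implicit.
Unset Printing Implicit Defensive.
Import Order.TTheory GRing.Theory Num.Theory.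
Local Open Scope classical_set_scope.
Local Open Scope quotient_scope.
Local Open Scope ring_scope.

(* Pointedness carries no information here: it is only required because the
   measurable types of the library are pointed. *)
HB.structure Definition PreTopologicalGroup :=
  {G of PointedTopological G & Group G}.

HB.mixin Record PreTopologicalGroup_isTopologicalGroup G
    & PreTopologicalGroup G := {
  mulg_continuous : continuous (fun z : G * G => (z.1 * z.2)%g);
  invg_continuous : continuous (fun x : G => (x^-1)%g)
}.

#[short(type="topologicalGroupType")]
HB.structure Definition TopologicalGroup :=
  {G of PreTopologicalGroup G & PreTopologicalGroup_isTopologicalGroup G}.

HB.mixin Record TopologicalGroup_isLcscGroup G & TopologicalGroup G := {
  lcsc_hausdorff : hausdorff_space G;
  lcsc_locally_compact : locally_compact [set: G];
  lcsc_second_countable : @second_countable G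
}.

#[short(type="lcscGroupType")]
HB.structure Definition LcscGroup :=
  {G of TopologicalGroup G & TopologicalGroup_isLcscGroup G}.

Record closed_subgroup (G : topologicalGroupType) := ClosedSubgroup {
  csg_set :> set G;
  csg_closed : closed csg_set;
  csg_one : csg_set 1%g;
  csg_mul : forall x y, csg_set x -> csg_set y -> csg_set (x * y)%g;
  csg_inv : forall x, csg_set x -> csg_set (x^-1)%g
}.

Definition borel (T : ptopologicalType) := g_sigma_algebraType (@open T).

(* A left Haar measure of the closed subgroup H, seen as a Borel measure on G
   concentrated on H (its image under the inclusion of H in G); H = setT gives
   the Haar measures of G. Compact subsets of H are the compact K `&` H.
   Sigma-finiteness is automatic, as G is second countable. *)
Record is_haar (R : realType) (G : topologicalGroupType) (H : set G)
    (mu : {sigma_finite_measure set (borel G) -> \bar R}) : Prop := IsHaar {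
  haar_support : mu (~` H) = 0%E;
  haar_neq0 : mu [set: borel G] <> 0%E;
  haar_compact : forall K : set G, compact K -> (mu K < +oo)%E;
  haar_left : forall (h : G) (B : set (borel G)), H h -> measurable B ->
    mu ((fun x : G => (h * x)%g) @^-1` B) = mu B
}.

Record is_matched_pair (R : realType) (G : topologicalGroupType)
    (mu : {sigma_finite_measure set (borel G) -> \bar R})
    (G1 G2 : closed_subgroup G) : Prop := IsMatchedPair {
  mp_meet : (G1 : set G) `&` G2 = [set 1%g];
  mp_conull : mu.-negligible (~` [set (x * y)%g | x in G1 & y in G2])
}.

Definition polish (R : realType) (T : topologicalType) : Prop :=
  @second_countable T /\
  exists (M : metricType R) (f : T -> M) (g : M -> T),
    [/\ cancel f g, cancel g f, continuous f & continuous g] /\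
    (forall F : set_system M, ProperFilter F -> cauchy F -> exists l : M, F --> l).

Record polish_module (R : realType) (G : topologicalGroupType) :=
  PolishModule {
  pm_carrier :> topologicalZmodType;
  pm_polish : polish R pm_carrier;
  pm_act : G -> pm_carrier -> pm_carrier;
  pm_act_continuous : continuous (fun z : G * pm_carrier => pm_act z.1 z.2);
  pm_act1 : forall a, pm_act 1%g a = a;
  pm_actM : forall x y a, pm_act (x * y)%g a = pm_act x (pm_act y a);
  pm_actD : forall x a b, pm_act x (a + b) = pm_act x a + pm_act x b
}.

Section PowerMeasure.
Context d (T : measurableType d) (R : realType).
Variable mu : {sigma_finite_measure set T -> \bar R}.

Definition tuple_cons n (z : T * n.-tuple T) : n.+1.-tuple T :=
  [tuple of z.1 :: z.2].

Lemma measurable_tuple_cons n : measurable_fun [set: T * n.-tuple T] (@tuple_cons n).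
Proof. exact: measurable_cons measurable_fst measurable_snd. Qed.

Section Step.
Variables (n : nat) (m : {sigma_finite_measure set (n.-tuple T) -> \bar R}).

Definition cons_measure : set (n.+1.-tuple T) -> \bar R :=
  pushforward (mu \x m)%E (@tuple_cons n).

Let cons_measureE A : measurable A ->
  measurable (@tuple_cons n @^-1` A).
Proof. by move=> mA; rewrite -[X in measurable X]setTI; exact: measurable_tuple_cons. Qed.

Let cons_measure0 : cons_measure set0 = 0%E.
Proof. by rewrite /cons_measure /pushforward preimage_set0 measure0. Qed.

Let cons_measure_ge0 A : (0 <= cons_measure A)%E.
Proof. by rewrite /cons_measure /pushforward; apply: measure_ge0. Qed.

Let cons_measure_sigma_additive : semi_sigma_additive cons_measure.
Proof.
move=> F mF tF mUF; rewrite /cons_measure /pushforward preimage_bigcup.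
apply: measure_semi_sigma_additive.
- by move=> k; exact: cons_measureE.
- apply/trivIsetP => /= i j _ _ ij; rewrite -preimage_setI.
  by move/trivIsetP : tF => /(_ _ _ _ _ ij) ->//; rewrite preimage_set0.
- by rewrite -preimage_bigcup; exact: cons_measureE.
Qed.

HB.instance Definition _ := isMeasure.Build _ _ _
  cons_measure cons_measure0 cons_measure_ge0 cons_measure_sigma_additive.

Lemma cons_measure_sigma_finite : sigma_finite [set: n.+1.-tuple T] cons_measure.
Proof.
have /sigma_finiteP[E [TE ndE Eoo]] := sigma_finiteT mu.
have /sigma_finiteP[H [TH ndH Hoo]] := sigma_finiteT m.
pose F k := E k `*` H k.
have FT : setT = \bigcup_k F k.
  rewrite -setXTT TE TH predeqE => -[x y]; split.
    move=> [/= [i _ Eix] [j _ Hjy]]; exists (maxn i j) => //; split.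
    - by move: x Eix; exact/subsetPset/ndE/leq_maxl.
    - by move: y Hjy; exact/subsetPset/ndH/leq_maxr.
  by move=> [i _ []/= ? ?]; split; exists i.
have Fm k : measurable (F k) /\ ((mu \x m)%E (F k) < +oo)%E.
  have [? ?] := Eoo k; have [? ?] := Hoo k.
  split; first exact: measurableX.
  by rewrite product_measure1E// lte_mul_pinfty// ge0_fin_numE.
pose u := fun t : n.+1.-tuple T => (thead t, [tuple of behead t] : n.-tuple T).
have cu : cancel (@tuple_cons n) u.
  by case=> x t; rewrite /u /tuple_cons; congr pair; exact: val_inj.
have mu_ : measurable_fun setT u.
  apply/measurable_fun_pairP; split; last exact: measurable_behead.
  exact: measurable_tnth.
exists (fun i => u @^-1` F i).
  by rewrite -preimage_bigcup -FT preimage_setT.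
move=> i; have [mF Ffin] := Fm i; split.
  by rewrite -[X in measurable X]setTI; exact: mu_.
rewrite /cons_measure /pushforward -comp_preimage.
by rewrite (_ : u \o _ = id) //; apply/funext => z /=; rewrite cu.
Qed.

HB.instance Definition _ :=
  @Measure_isSigmaFinite.Build _ _ _ cons_measure cons_measure_sigma_finite.

End Step.

Fixpoint power_measure n : {sigma_finite_measure set (n.-tuple T) -> \bar R} :=
  match n with
  | 0 => \d_([tuple] : 0.-tuple T)
  | n'.+1 => cons_measure (power_measure n')
  end.

End PowerMeasure.

Definition borel_fun (X Y : topologicalType) (f : X -> Y) : Prop :=
  forall U : set Y, open U -> <<s @open X >> (f @^-1` U).

Lemma borel_fun_continuous (X Y : topologicalType) (f : X -> Y) :
  continuous f -> borel_fun f.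
Proof. by move=> /continuousP cf U oU; apply: sub_gen_smallest; exact: cf. Qed.

Lemma borel_fun_preimage (X Y : topologicalType) (f : X -> Y) (B : set Y) :
  borel_fun f -> <<s @open Y >> B -> <<s @open X >> (f @^-1` B).
Proof.
move=> bf; move: B.
apply: (@smallest_sub _ _ (@open Y) [set B | <<s @open X >> (f @^-1` B)]) => //.
split.
- by rewrite /= preimage_set0; exact: sigma_algebra0.
- by move=> A /= hA; rewrite setTD preimage_setC -setTD; exact: sigma_algebraCD.
- by move=> F hF /=; rewrite preimage_bigcup; exact: sigma_algebra_bigcup.
Qed.

Lemma sigma_algebra_countable_bigcup (X : Type) (C : set (set X))
    (T : Type) (I : set T) (F : T -> set X) :
  countable I -> (forall i, I i -> <<s C >> (F i)) ->
  <<s C >> (\bigcup_(i in I) F i).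
Proof.
move=> /pcard_leP/injfunPex[phi _ phi_inj] CF.
have -> : \bigcup_(i in I) F i =
    \bigcup_n \bigcup_(i in [set i | I i /\ phi i = n]) F i.
  apply/seteqP; split=> [x [i Ii Fx]|x [n _ [i [Ii _] Fx]]]; last by exists i.
  by exists (phi i) => //; exists i.
apply: sigma_algebra_bigcup => n.
have [[i [Ii phii]]|noi] := pselect (exists i, I i /\ phi i = n).
  rewrite (_ : \bigcup_(_ in _) _ = F i); first exact: CF.
  apply/seteqP; split=> [x [j [Ij phij]]|x Fx]; last by exists i.
  by rewrite (phi_inj j i) ?inE// phij.
rewrite bigcup0; first exact: sigma_algebra0.
by move=> i Ii; case: noi; exists i.
Qed.

Lemma borel_fun_comp (X Y Z : topologicalType) (f : X -> Y) (g : Y -> Z) :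
  borel_fun f -> borel_fun g -> borel_fun (g \o f).
Proof. by move=> bf bg U /bg; exact: borel_fun_preimage. Qed.

Lemma borel_fun_pair (X Y Z : topologicalType) (f : X -> Y) (g : X -> Z) :
  @second_countable Y -> @second_countable Z ->
  borel_fun f -> borel_fun g -> borel_fun (fun x => (f x, g x)).
Proof.
move=> [B cB [oB hB]] [C cC [oC hC]] bf bg U oU.
pose I := [set bc : set Y * set Z | [/\ B bc.1, C bc.2 & bc.1 `*` bc.2 `<=` U]].
have -> : (fun x => (f x, g x)) @^-1` U =
    \bigcup_(bc in I) (f @^-1` bc.1 `&` g @^-1` bc.2).
  apply/seteqP; split=> [x /= Ux|x [[b c] [/= _ _ bcU] [/= fb gc]]]; last first.
    exact: (bcU (f x, g x)).
  have : nbhs (f x, g x) U by exact: open_nbhs_nbhs.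
  case=> -[/= P Q] [/hB [b [Bb bx] bP] /hC [c [Cc cx] cQ]] PQU.
  exists (b, c) => //; split => //= -[y z] [/= by_ cz].
  by apply: PQU; split; [exact: bP|exact: cQ].
have cI : countable I.
  apply: (@sub_countable _ _ _ (B `*` C)); last exact: countableX.
  by apply: subset_card_le => -[b c] [].
apply: sigma_algebra_countable_bigcup => // -[b c] [/= Bb Cc _].
rewrite -[_ `&` _]setCK setCI -bigcup2E -setTD; apply: sigma_algebraCD.
apply: sigma_algebra_bigcup => -[|[|i]] /=; last exact: sigma_algebra0.
  by rewrite -setTD; apply: sigma_algebraCD; apply: bf; exact: oB.
by rewrite -setTD; apply: sigma_algebraCD; apply: bg; exact: oC.
Qed.

Record null_ideal (X : Type) := NullIdeal {
  is_null :> set (set X);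
  null_set0 : is_null set0;
  null_subset : forall B C, B `<=` C -> is_null C -> is_null B;
  null_setU : forall B C, is_null B -> is_null C -> is_null (B `|` C)
}.

Section BorelMap.
Context (R : realType) (G : topologicalGroupType) (A : polish_module R G).
Variable X : topologicalType.

Definition borel_pred : {pred X -> A} := fun f => `[< borel_fun f >].

Lemma borel_pred_zmod_closed : zmod_closed borel_pred.
Proof.
split=> [|f g /asboolP bf /asboolP bg]; apply/asboolP.
  by apply: borel_fun_continuous => x; exact: cvg_cst.
apply: (@borel_fun_comp _ (A * A)%type _ (fun x => (f x, g x)) (fun z => z.1 - z.2)).
  by apply: borel_fun_pair => //; exact: (pm_polish A).1.
by apply: borel_fun_continuous; exact: sub_continuous.
Qed.

HB.instance Definition _ :=
  GRing.isZmodClosed.Build (X -> A) borel_pred borel_pred_zmod_closed.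

Record borel_map := BorelMap {
  borel_map_fun :> X -> A;
  borel_map_subproof : borel_map_fun \in borel_pred
}.

HB.instance Definition _ := [isSub for borel_map_fun].
HB.instance Definition _ := [Choice of borel_map by <:].
HB.instance Definition _ := [SubChoice_isSubZmodule of borel_map by <:].

Lemma borel_mapP (f : borel_map) : borel_fun f.
Proof. exact/asboolP/borel_map_subproof. Qed.

Definition mk_borel_map (f : X -> A) (bf : borel_fun f) : borel_map :=
  BorelMap (asboolT bf).

Variable N : null_ideal X.

Definition ae_zero : {pred borel_map} :=
  fun f => `[< is_null N [set x | f x <> 0] >].

Lemma ae_zero_zmod_closed : zmod_closed ae_zero.
Proof.
split=> [|f g /asboolP Nf /asboolP Ng]; apply/asboolP.
  by apply: null_subset (null_set0 N) => x; exact.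
apply: null_subset (null_setU Nf Ng) => x /=.
have [fx h|] := pselect (f x = 0); last by left.
by right=> gx; apply: h; rewrite -[LHS]/(f x - g x) fx gx subr0.
Qed.

HB.instance Definition _ :=
  GRing.isZmodClosed.Build borel_map ae_zero ae_zero_zmod_closed.

Definition Lclass : zmodType := Quotient.quot ae_zero.

End BorelMap.

(* The i-th edge (i < n) joins the consecutive vertices i and i+1. *)
Definition edge_src n (i : 'I_n) : 'I_n.+1 := widen_ord (leqnSn n) i.
Definition edge_dst n (i : 'I_n) : 'I_n.+1 := lift ord0 i.

Section Gamma.
Context (G : topologicalGroupType) (G1 G2 : closed_subgroup G).
Local Open Scope group_scope.

(* X.1 holds the vertical edges g, X.2 the horizontal edges s. Edges are
   numbered from 0 and vertices from 0, so that the usual g_{ij}, s_{ij}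
   (edges numbered from 1) are X.1 (i-1) j and X.2 i (j-1); the equation is
   s_{i-1,j} g_{ij} = g_{i,j-1} s_{ij}. *)
Definition gamma_set p q : set ('M[G]_(p, q.+1) * 'M[G]_(p.+1, q)) :=
  [set X : 'M[G]_(p, q.+1) * 'M[G]_(p.+1, q) |
           [/\ forall i j, csg_set G1 (X.1 i j),
               forall i j, csg_set G2 (X.2 i j) &
               forall i j, X.2 (edge_src i) j * X.1 i (edge_dst j)
                         = X.1 i (edge_src j) * X.2 (edge_dst i) j] ].

Definition Gamma p q := set_type (@gamma_set p q).

Lemma quot_chain (a b c : G) : a^-1 * b * (b^-1 * c) = a^-1 * c.
Proof. by rewrite mulgA mulgK. Qed.

Definition vedge p q (X : Gamma p q) (i : 'I_p) (j : 'I_q.+1) : G :=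
  (set_val X).1 i j.
Definition hedge p q (X : Gamma p q) (i : 'I_p.+1) (j : 'I_q) : G :=
  (set_val X).2 i j.

(* The matrix y representing X, normalized by y_{00} = 1. *)
Definition vertex p q (X : Gamma p q) (i : 'I_p.+1) (j : 'I_q.+1) : G :=
  (\prod_(k < p | (k < i)%N) vedge X k ord0) *
  (\prod_(l < q | (l < j)%N) hedge X i l).

Lemma prod_ord_step n (F : 'I_n -> G) (j : 'I_n) :
  \prod_(k < n | (k < j.+1)%N) F k = (\prod_(k < n | (k < j)%N) F k) * F j.
Proof.
rewrite (big_ord_narrow (ltn_ord j)) big_ord_recr /=.
rewrite (big_ord_narrow (ltnW (ltn_ord j))); congr (_ * _).
  by apply: eq_bigr => k _; congr F; exact: val_inj.
by congr F; exact: val_inj.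
Qed.

Lemma prod_ord_closed (H : closed_subgroup G) n (F : 'I_n -> G) (P : pred 'I_n) :
  (forall i, csg_set H (F i)) -> csg_set H (\prod_(k < n | P k) F k).
Proof.
move=> HF; elim/big_ind: _ => //; [exact: csg_one | exact: csg_mul].
Qed.

Section Theory.
Context p q (X : Gamma p q).

Let gammaX : gamma_set (set_val X).
Proof. exact: set_valP. Qed.

Lemma vedgeP i j : csg_set G1 (vedge X i j).
Proof. by have [h _ _] := gammaX; exact: h. Qed.

Lemma hedgeP i j : csg_set G2 (hedge X i j).
Proof. by have [_ h _] := gammaX; exact: h. Qed.

Lemma squareP i j :
  hedge X (edge_src i) j * vedge X i (edge_dst j) =
  vedge X i (edge_src j) * hedge X (edge_dst i) j.
Proof. by have [_ _ h] := gammaX; exact: h. Qed.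

Lemma vertex_dst_r i j : vertex X i (edge_dst j) = vertex X i (edge_src j) * hedge X i j.
Proof. by rewrite /vertex lift0 prod_ord_step mulgA. Qed.

Lemma vertex_dst_l i j : vertex X (edge_dst i) j = vertex X (edge_src i) j * vedge X i j.
Proof.
case: j => j; elim: j => [|j IH] lt_jq.
  have -> : Ordinal lt_jq = ord0 by exact: val_inj.
  by rewrite /vertex lift0 prod_ord_step !big_pred0_eq // !mulg1.
have -> : Ordinal lt_jq = edge_dst (Ordinal (lt_jq : (j < q)%N)) by exact: val_inj.
set j' := Ordinal _.
rewrite !vertex_dst_r.
have -> : edge_src j' = Ordinal (ltnW lt_jq) by exact: val_inj.
rewrite IH -!mulgA; congr (_ * _).
rewrite squareP; congr (_ * (vedge X i _ * _)); exact: val_inj.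
Qed.

Lemma vertex_row i j k : csg_set G2 ((vertex X i j)^-1 * vertex X i k).
Proof.
rewrite /vertex invgM mulgA mulgVK.
by apply: csg_mul; [apply: csg_inv|]; apply: prod_ord_closed => l; exact: hedgeP.
Qed.

Lemma vertex_col i k j : csg_set G1 ((vertex X i j)^-1 * vertex X k j).
Proof.
have H0 m : csg_set G1 ((vertex X ord0 j)^-1 * vertex X m j).
  case: m => m; elim: m => [|m IH] lt_mp.
    rewrite (_ : Ordinal _ = ord0); last exact: val_inj.
    by rewrite mulVg; exact: csg_one.
  have -> : Ordinal lt_mp = edge_dst (Ordinal (lt_mp : (m < p)%N)) by exact: val_inj.
  rewrite vertex_dst_l mulgA; apply: csg_mul; last exact: vedgeP.
  rewrite (_ : edge_src _ = Ordinal (ltnW lt_mp)); [exact: IH | exact: val_inj].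
have := csg_mul (csg_inv (H0 i)) (H0 k).
by rewrite invgM invgK quot_chain.
Qed.

End Theory.

(* The family of edges of the matrix (y_{r i, c j})_{ij}, which does not depend
   on the representative y of X: removing a row or a column of y and restricting
   to a corner are instances. *)
Definition reindex_fun p q p' q' (r : 'I_p'.+1 -> 'I_p.+1) (c : 'I_q'.+1 -> 'I_q.+1)
    (X : Gamma p q) : 'M[G]_(p', q'.+1) * 'M[G]_(p'.+1, q') :=
  let y i j := vertex X (r i) (c j) in
  (\matrix_(i, j) ((y (edge_src i) j)^-1 * y (edge_dst i) j),
   \matrix_(i, j) ((y i (edge_src j))^-1 * y i (edge_dst j))).

Lemma reindex_subproof p q p' q' (r : 'I_p'.+1 -> 'I_p.+1) (c : 'I_q'.+1 -> 'I_q.+1)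
    (X : Gamma p q) : reindex_fun r c X \in @gamma_set p' q'.
Proof.
rewrite inE; split=> /= i j; rewrite !mxE.
- exact: vertex_col.
- exact: vertex_row.
- by rewrite !quot_chain.
Qed.

Definition reindex p q p' q' (r : 'I_p'.+1 -> 'I_p.+1) (c : 'I_q'.+1 -> 'I_q.+1)
    (X : Gamma p q) : Gamma p' q' :=
  exist _ (reindex_fun r c X) (reindex_subproof r c X).

Definition hface p q (i : 'I_q.+2) : Gamma p q.+1 -> Gamma p q :=
  reindex id (lift i).
Definition vface p q (j : 'I_p.+2) : Gamma p.+1 q -> Gamma p q :=
  reindex (lift j) id.
(* Vertices of the last p rows and first q columns of squares (for p, q <= m). *)
Definition corner m p q : Gamma m m -> Gamma p q :=
  reindex (fun i : 'I_p.+1 => inord (m - p + i)) (fun j : 'I_q.+1 => inord j).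

Lemma continuous_mulg (T : topologicalType) (f g : T -> G) :
  continuous f -> continuous g -> continuous (fun x => f x * g x).
Proof.
move=> cf cg x; apply: (@continuous_comp _ _ _ (fun x => (f x, g x)) (fun z => z.1 * z.2)).
  by apply: cvg_pair; [exact: cf|exact: cg].
exact: mulg_continuous.
Qed.

Lemma continuous_invg (T : topologicalType) (f : T -> G) :
  continuous f -> continuous (fun x => (f x)^-1).
Proof. by move=> cf x; apply: continuous_comp; [exact: cf|exact: invg_continuous]. Qed.

Lemma continuous_prodg (T : topologicalType) n (F : 'I_n -> T -> G) (P : pred 'I_n) :
  (forall i, continuous (F i)) -> continuous (fun x => \prod_(i < n | P i) F i x).
Proof.
move=> cF; rewrite /index_enum; elim: (Finite.enum _) => [|i s IH].
  rewrite (_ : (fun _ => _) = fun=> 1); first by move=> x; exact: cvg_cst.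
  by apply/funext => x; rewrite big_nil.
rewrite (_ : (fun _ => _) = fun x => if P i then F i x * \prod_(i <- s | P i) F i x
   else \prod_(i <- s | P i) F i x); last by apply/funext => x; rewrite big_cons.
by case: (P i) => //; exact: continuous_mulg.
Qed.

Lemma continuous_mx (T : topologicalType) m n (F : T -> 'M[G]_(m, n)) :
  (forall i j, continuous (fun x => F x i j)) -> continuous F.
Proof.
move=> cF x A [P PF sPA].
have : \forall y \near x, forall i j, P i j (F y i j).
  apply: filter_forall => i; apply: filter_forall => j.
  exact: cF (PF i j).
by apply: filterS => y Py; exact: sPA.
Qed.

Lemma continuous_mx_entry m n (i : 'I_m) (j : 'I_n) :
  continuous (fun M : 'M[G]_(m, n) => M i j).
Proof.
move=> M A MA.
exists (fun i' j' => [set x | (i', j') = (i, j) -> A x]) => [i' j'|N NP].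
  have [[-> ->]|ne] := eqVneq (i', j') (i, j).
    by apply: filterS MA => x Ax _.
  by apply: filterS filterT => x _ /eqP; rewrite (negPf ne).
exact: NP.
Qed.

Lemma continuous_vedge p q i j : continuous (fun X : Gamma p q => vedge X i j).
Proof.
move=> X; apply: (@continuous_comp _ _ _ (fun X : Gamma p q => (set_val X).1) (fun M => M i j)).
  apply: (@continuous_comp _ _ _ (fun X : Gamma p q => set_val X) fst).
    exact: initial_continuous.
  exact: cvg_fst.
exact: continuous_mx_entry.
Qed.

Lemma continuous_hedge p q i j : continuous (fun X : Gamma p q => hedge X i j).
Proof.
move=> X; apply: (@continuous_comp _ _ _ (fun X : Gamma p q => (set_val X).2) (fun M => M i j)).
  apply: (@continuous_comp _ _ _ (fun X : Gamma p q => set_val X) snd).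
    exact: initial_continuous.
  exact: cvg_snd.
exact: continuous_mx_entry.
Qed.

Lemma continuous_vertex p q i j : continuous (fun X : Gamma p q => vertex X i j).
Proof.
apply: continuous_mulg; apply: continuous_prodg => k.
  exact: continuous_vedge.
exact: continuous_hedge.
Qed.

Lemma continuous_reindex p q p' q' (r : 'I_p'.+1 -> 'I_p.+1) (c : 'I_q'.+1 -> 'I_q.+1) :
  continuous (reindex r c).
Proof.
have c1 : continuous (fun X : Gamma p q => (reindex_fun r c X).1).
  apply: continuous_mx => i j.
  rewrite (_ : (fun _ => _) = fun X => (vertex X (r (edge_src i)) (c j))^-1
      * vertex X (r (edge_dst i)) (c j)); last by apply/funext => Y; rewrite mxE.
  apply: continuous_mulg; last exact: continuous_vertex.
  by apply: continuous_invg; exact: continuous_vertex.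
have c2 : continuous (fun X : Gamma p q => (reindex_fun r c X).2).
  apply: continuous_mx => i j.
  rewrite (_ : (fun _ => _) = fun X => (vertex X (r i) (c (edge_src j)))^-1
      * vertex X (r i) (c (edge_dst j))); last by apply/funext => Y; rewrite mxE.
  apply: continuous_mulg; last exact: continuous_vertex.
  by apply: continuous_invg; exact: continuous_vertex.
have cf : continuous (reindex_fun r c).
  move=> X A nA; apply: (cvg_pair (c1 X) (c2 X)). exact: nA.
apply/continuousP => _ [B oB <-].
by have /continuousP/(_ _ oB) := cf.
Qed.

Lemma continuous_hface p q (i : 'I_q.+2) : continuous (@hface p q i).
Proof. exact: continuous_reindex. Qed.

Lemma continuous_vface p q (j : 'I_p.+2) : continuous (@vface p q j).
Proof. exact: continuous_reindex. Qed.

Lemma continuous_corner m p q : continuous (@corner m p q).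
Proof. exact: continuous_reindex. Qed.

Lemma continuous_left_path p q (P : pred 'I_p) :
  continuous (fun X : Gamma p q => \prod_(k < p | P k) vedge X k ord0).
Proof. by apply: continuous_prodg => k; exact: continuous_vedge. Qed.

End Gamma.

Section GammaNull.
Context (R : realType) (G : topologicalGroupType) (G1 G2 : closed_subgroup G).
Variables mu1 mu2 : {sigma_finite_measure set (borel G) -> \bar R}.

(* The measure class of Gamma p q is read in the coordinates given by the left
   column of vertical edges and the top row of horizontal edges; cross is
   injective, so a set is null when its image is negligible for the product
   measure on G1^p * G2^q. *)
Definition cross p q (X : Gamma G1 G2 p q) : p.-tuple (borel G) * q.-tuple (borel G) :=
  ([tuple vedge X i ord0 | i < p], [tuple hedge X ord0 j | j < q]).

Definition gamma_measure p q :
    {measure set (p.-tuple (borel G) * q.-tuple (borel G)) -> \bar R} :=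
  (power_measure mu1 p \x power_measure mu2 q)%E.

Lemma gamma_null0 p q : (gamma_measure p q).-negligible (@cross p q @` set0).
Proof. by rewrite image_set0; exact: negligible_set0. Qed.

Lemma gamma_nullS p q (B C : set (Gamma G1 G2 p q)) : B `<=` C ->
  (gamma_measure p q).-negligible (@cross p q @` C) ->
  (gamma_measure p q).-negligible (@cross p q @` B).
Proof. by move=> BC; apply: negligibleS; exact: image_subset. Qed.

Lemma gamma_nullU p q (B C : set (Gamma G1 G2 p q)) :
  (gamma_measure p q).-negligible (@cross p q @` B) ->
  (gamma_measure p q).-negligible (@cross p q @` C) ->
  (gamma_measure p q).-negligible (@cross p q @` (B `|` C)).
Proof. by move=> nB nC; rewrite image_setU; exact: negligibleU. Qed.

Definition gamma_null p q : null_ideal (Gamma G1 G2 p q) :=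
  NullIdeal (@gamma_null0 p q) (@gamma_nullS p q) (@gamma_nullU p q).

End GammaNull.

Section BorelOps.
Context (R : realType) (G : lcscGroupType) (A : polish_module R G).

Lemma borel_cst_subproof (X : topologicalType) (a : A) : borel_fun (fun _ : X => a).
Proof. by apply: borel_fun_continuous => x; exact: cvg_cst. Qed.

Definition borel_cst (X : topologicalType) (a : A) : borel_map A X :=
  mk_borel_map (borel_cst_subproof a).

Lemma borel_pull_subproof (X Y : topologicalType) (phi : X -> Y) (F : borel_map A Y) :
  continuous phi -> borel_fun (fun x => F (phi x)).
Proof.
by move=> cphi; apply: borel_fun_comp (borel_mapP F); exact: borel_fun_continuous.
Qed.

Definition borel_pull (X Y : topologicalType) (phi : X -> Y)
    (cphi : continuous phi) (F : borel_map A Y) : borel_map A X :=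
  mk_borel_map (@borel_pull_subproof X Y phi F cphi).

Lemma borel_act_subproof (X : topologicalType) (c : X -> G) (F : borel_map A X) :
  continuous c -> borel_fun (fun x => pm_act (c x) (F x)).
Proof.
move=> cc.
apply: (@borel_fun_comp _ (G * A)%type _ (fun x => (c x, F x)) (fun z => pm_act z.1 z.2)).
  apply: borel_fun_pair.
  - exact: lcsc_second_countable.
  - exact: (pm_polish A).1.
  - exact: borel_fun_continuous.
  - exact: borel_mapP.
by apply: borel_fun_continuous; exact: pm_act_continuous.
Qed.

Definition borel_act (X : topologicalType) (c : X -> G)
    (cc : continuous c) (F : borel_map A X) : borel_map A X :=
  mk_borel_map (@borel_act_subproof X c F cc).

(* The map L(X,A) -> L(Y,A) induced by Phi, computed on a representative; the
   result is independent of the representative as soon as the additive map Phi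
   preserves almost everywhere vanishing (Lmap_pi), which for the face maps of
   Gamma amounts to their preimages of null sets being null. *)
Definition Lmap (X Y : topologicalType) (M : null_ideal X) (N : null_ideal Y)
    (Phi : borel_map A X -> borel_map A Y) (x : Lclass A M) : Lclass A N :=
  \pi_(Lclass A N) (Phi (repr x)).

Lemma Lmap_pi (X Y : topologicalType) (M : null_ideal X) (N : null_ideal Y)
    (Phi : borel_map A X -> borel_map A Y) (F : borel_map A X) :
  zmod_morphism Phi ->
  (forall H, H \in ae_zero M -> Phi H \in ae_zero N) ->
  Lmap (M := M) N Phi (\pi_(Lclass A M) F) = \pi_(Lclass A N) (Phi F).
Proof.
move=> PhiB PhiN; apply/eqP; rewrite -Quotient.idealrBE -PhiB; apply: PhiN.
by rewrite Quotient.idealrBE reprK.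
Qed.
End BorelOps.
Arguments Lmap {R G A X Y M N} Phi x.

Section AntidiagonalSum.
Variables (m : nat) (V : nat -> nat -> zmodType).

Definition antidiag_sum : Type := forall p q : nat, (p + q)%N = m -> V p q.

HB.instance Definition _ := gen_eqMixin antidiag_sum.
HB.instance Definition _ := gen_choiceMixin antidiag_sum.

Definition antidiag_zero : antidiag_sum := fun p q e => 0.
Definition antidiag_opp (F : antidiag_sum) : antidiag_sum := fun p q e => - F p q e.
Definition antidiag_add (F H : antidiag_sum) : antidiag_sum :=
  fun p q e => F p q e + H p q e.

Lemma antidiag_addA : associative antidiag_add.
Proof. by move=> F H K; do 3!apply: functional_extensionality_dep => ?; exact: addrA. Qed.
Lemma antidiag_addC : commutative antidiag_add.
Proof. by move=> F H; do 3!apply: functional_extensionality_dep => ?; exact: addrC. Qed.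
Lemma antidiag_add0 : left_id antidiag_zero antidiag_add.
Proof. by move=> F; do 3!apply: functional_extensionality_dep => ?; exact: add0r. Qed.
Lemma antidiag_addN : left_inverse antidiag_zero antidiag_opp antidiag_add.
Proof. by move=> F; do 3!apply: functional_extensionality_dep => ?; exact: addNr. Qed.

HB.instance Definition _ := GRing.isZmodule.Build antidiag_sum
  antidiag_addA antidiag_addC antidiag_add0 antidiag_addN.

End AntidiagonalSum.

Section Complexes.
Context (R : realType) (G : lcscGroupType) (G1 G2 : closed_subgroup G).
Variables mu1 mu2 : {sigma_finite_measure set (borel G) -> \bar R}.
Variable A : polish_module R G.

Local Notation Gam := (Gamma G1 G2).
Definition Lgamma p q : zmodType := Lclass A (gamma_null G1 G2 mu1 mu2 p q).
Local Notation L := Lgamma.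

Definition altsgn (V : zmodType) (k : nat) (x : V) : V := x *~ (-1) ^+ k.

Definition dh_map p q (i : 'I_q.+2) (F : borel_map A (Gam p q)) :
    borel_map A (Gam p q.+1) :=
  let F' := borel_pull (@continuous_hface G G1 G2 p q i) F in
  if i == ord0 then borel_act (@continuous_hedge G G1 G2 p q.+1 ord0 ord0) F' else F'.

Definition dv_map p q (j : 'I_p.+2) (F : borel_map A (Gam p q)) :
    borel_map A (Gam p.+1 q) :=
  let F' := borel_pull (@continuous_vface G G1 G2 p q j) F in
  if j == ord0 then borel_act (@continuous_vedge G G1 G2 p.+1 q ord0 ord0) F' else F'.

Definition dh_ p q (i : 'I_q.+2) : L p q -> L p q.+1 := Lmap (@dh_map p q i).
Definition dv_ p q (j : 'I_p.+2) : L p q -> L p.+1 q := Lmap (@dv_map p q j).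

Definition dh p q (x : L p q) : L p q.+1 := \sum_(i < q.+2) altsgn i (dh_ i x).
Definition dv p q (x : L p q) : L p.+1 q := \sum_(j < p.+2) altsgn j (dv_ j x).

Definition Lcst p q (a : A) : L p q := \pi_(L p q) (borel_cst (Gam p q) a).

Definition kac_d0_map (a : A) : borel_map A (Gam 1 1) :=
  let cs := @continuous_hedge G G1 G2 1 1 ord0 ord0 in
  let cg := @continuous_vedge G G1 G2 1 1 ord0 ord_max in
  let ch := @continuous_vedge G G1 G2 1 1 ord0 ord0 in
  let ka := borel_cst (Gam 1 1) a in
  borel_act (continuous_mulg cs cg) ka - borel_act cs ka - borel_act ch ka + ka.

Definition kac_d0 (a : A) : L 1 1 := \pi_(L 1 1) (kac_d0_map a).

(* In degree n = m+1 the component (p, q), p + q = m, is L(Gamma_{p+1,q+1}). *)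
Definition kac_obj (n : nat) : zmodType :=
  if n is m.+1 then antidiag_sum m (fun p q => L p.+1 q.+1) else A.

Definition kac_d (n : nat) : kac_obj n -> kac_obj n.+1 :=
  match n return kac_obj n -> kac_obj n.+1 with
  | 0 => fun a p q =>
      match p, q return (p + q = 0)%N -> L p.+1 q.+1 with
      | 0, 0 => fun=> kac_d0 a
      | _, _ => fun=> 0
      end
  | m.+1 => fun F p q e =>
      match q return (p + q = m.+1)%N -> L p.+1 q.+1 with
      | 0 => fun=> 0
      | q'.+1 => fun e' => dh (F p q' (succn_inj (etrans (esym (addnS p q')) e')))
      end e
      + match p return (p + q = m.+1)%N -> L p.+1 q.+1 with
        | 0 => fun=> 0
        | p'.+1 => fun e' => altsgn q.+1 (dv (F p' q (succn_inj e')))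
        end e
  end.

Definition pent_obj (n : nat) : zmodType :=
  if n is m.+1 then L m.+1 m.+1 else (A * A)%type.

(* minn i n.+1 and i.-1 (with 0.-1 = 0) implement the conventions
   d^h_{n+2} = d^h_{n+1} and d^v_{-1} = d^v_0; A is identified with L(Gamma_00)
   through Lcst. *)
Definition pent_d (n : nat) : pent_obj n -> pent_obj n.+1 :=
  match n return pent_obj n -> pent_obj n.+1 with
  | 0 => fun ab => kac_d0 ab.1 + dh_ ord0 (dv_ ord_max (Lcst 0 0 ab.2))
  | m.+1 => fun x => \sum_(i < m.+4)
      altsgn i (dh_ (inord (minn i m.+2)) (dv_ (inord i.-1) x))
  end.

(* For n = m and q = i, X |-> (g_{10} ... g_{i-1,0}) . F (Q_i X). *)
Definition corner_map m p q (F : borel_map A (Gam p q)) :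
    borel_map A (Gam m m) :=
  borel_act
    (c := fun X : Gam m m => (\prod_(k < m | (k < q.-1)%N) vedge X k ord0)%g)
    (@continuous_left_path G G1 G2 m m (fun k => (k < q.-1)%N))
    (borel_pull (@continuous_corner G G1 G2 m p q) F).

Definition T_map (n : nat) : kac_obj n -> pent_obj n :=
  match n return kac_obj n -> pent_obj n with
  | 0 => fun a => (a, 0)
  | m.+1 => fun F => \sum_(i < m.+1)
      Lmap (@corner_map m.+1 (m - i).+1 i.+1) (F (m - i)%N i (subnK (leq_ord i)))
  end.
End Complexes.

Arguments kac_d {R G} G1 G2 mu1 mu2 A n x.
Arguments pent_d {R G} G1 G2 mu1 mu2 A n x.
Arguments T_map {R G} G1 G2 mu1 mu2 A n x.

Record is_complex (C : nat -> zmodType) (d : forall n, C n -> C n.+1) : Prop :=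
  IsComplex {
  diff_additive : forall n, zmod_morphism (d n);
  diff_diff : forall n x, d n.+1 (d n x) = 0
}.

Record cochain_complex := CochainComplex {
  cobj :> nat -> zmodType;
  cdiff : forall n, cobj n -> cobj n.+1;
  cdiffP : is_complex cdiff
}.

Record is_cochain_map (C D : cochain_complex) (f : forall n, C n -> D n) : Prop :=
  IsCochainMap {
  cochain_map_additive : forall n, zmod_morphism (f n);
  cochain_map_diff : forall n x, cdiff (f n x) = f n.+1 (cdiff x)
}.

Record cochain_map (C D : cochain_complex) := CochainMap {
  cmap :> forall n, C n -> D n;
  cmapP : is_cochain_map cmap
}.

HB.instance Definition _ (C : cochain_complex) n :=
  GRing.isZmodMorphism.Build (C n) (C n.+1) (@cdiff C n) (@diff_additive _ _ (cdiffP C) n).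

HB.instance Definition _ (C D : cochain_complex) (f : cochain_map C D) n :=
  GRing.isZmodMorphism.Build (C n) (D n) (@cmap C D f n) (@cochain_map_additive _ _ _ (cmapP f) n).

Section Cohomology.
Variables (C : cochain_complex) (n : nat).

Definition cocycle_pred : {pred C n} := fun x => cdiff x == 0.

Lemma cocycle_pred_zmod_closed : zmod_closed cocycle_pred.
Proof.
split=> [|x y /eqP x0 /eqP y0]; apply/eqP; first exact: raddf0.
by rewrite raddfB /= x0 y0 subr0.
Qed.

HB.instance Definition _ :=
  GRing.isZmodClosed.Build (C n) cocycle_pred cocycle_pred_zmod_closed.

Record cocycle := Cocycle {
  cocycle_val : C n;
  cocycleP : cocycle_val \in cocycle_pred
}.

HB.instance Definition _ := [isSub for cocycle_val].
HB.instance Definition _ := [Choice of cocycle by <:].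
HB.instance Definition _ := [SubChoice_isSubZmodule of cocycle by <:].
End Cohomology.

Definition is_coboundary (C : cochain_complex) n : C n -> Prop :=
  match n return C n -> Prop with
  | 0 => fun x => x = 0
  | m.+1 => fun x => exists y : C m, x = cdiff y
  end.

Section CohomologyGroup.
Variables (C : cochain_complex) (n : nat).

Definition coboundary_pred : {pred cocycle C n} :=
  fun z => `[< is_coboundary (cocycle_val z) >].

Lemma coboundary_pred_zmod_closed : zmod_closed coboundary_pred.
Proof.
rewrite /coboundary_pred; case: n => [|m].
  split=> [|z w /asboolP /= z0 /asboolP /= w0]; apply/asboolP => //=.
  by rewrite z0 w0 subr0.
split=> [|z w /asboolP /= [x zx] /asboolP /= [y wy]]; apply/asboolP => /=.
  by exists 0; rewrite raddf0.
by exists (x - y); rewrite !raddfB /= zx wy.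
Qed.

HB.instance Definition _ :=
  GRing.isZmodClosed.Build (cocycle C n) coboundary_pred coboundary_pred_zmod_closed.

Definition cohomology : zmodType := Quotient.quot coboundary_pred.
End CohomologyGroup.

Section CohomologyMap.
Variables (C D : cochain_complex) (f : cochain_map C D) (n : nat).

Lemma cocycle_map_subproof (z : cocycle C n) :
  cmap f (cocycle_val z) \in @cocycle_pred D n.
Proof.
apply/eqP; rewrite (cochain_map_diff (cmapP f)).
by have /eqP -> := cocycleP z; rewrite raddf0.
Qed.

Definition cocycle_map (z : cocycle C n) : cocycle D n :=
  Cocycle (cocycle_map_subproof z).

Definition cohomology_map (x : cohomology C n) : cohomology D n :=
  \pi_(cohomology D n) (cocycle_map (repr x)).

Lemma coboundary_map (z : C n) : is_coboundary z -> is_coboundary (cmap f z).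
Proof.
case: n z => [z -> /=|m z [y ->]] /=; first exact: raddf0.
by exists (cmap f y); rewrite (cochain_map_diff (cmapP f)).
Qed.

Lemma cohomology_mapE (z : cocycle C n) :
  cohomology_map (\pi_(cohomology C n) z) = \pi_(cohomology D n) (cocycle_map z).
Proof.
apply/eqP; rewrite -Quotient.idealrBE; apply/asboolP.
have : repr (\pi_(cohomology C n) z) - z \in @coboundary_pred C n.
  by rewrite Quotient.idealrBE reprK.
by move=> /asboolP/coboundary_map; rewrite /= raddfB.
Qed.

Lemma cohomology_map_additive : zmod_morphism cohomology_map.
Proof.
move=> x y; rewrite -[x]reprK -[y]reprK -raddfB !cohomology_mapE -raddfB.
by congr (\pi _); apply: val_inj; rewrite /= !raddfB.
Qed.

HB.instance Definition _ := GRing.isZmodMorphism.Build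
  (cohomology C n) (cohomology D n) cohomology_map cohomology_map_additive.
End CohomologyMap.

(* Main.v *)
(* Up to a null set, a point of Gamma_pq is a family of cosets u_0, .., u_q in G/G_1
   and v_0, .., v_p in G/G_2, up to left translation, y_ij being the point of
   u_j `&` v_i. A class in L(Gamma_pq, A) thus becomes a G-equivariant function of
   points x_j in u_j and w_i in v_i, which by Fubini vanishes almost everywhere on
   G^(p+q+2) exactly when the class is zero. All the operators of both complexes are
   restrictions to subfamilies of cosets, and the last coset may moreover be
   specialized to y_kl g G_1 or y_kl g G_2, for almost every g in G.
   Let the cochains also depend on m inert pairs (u, v) of cosets, which the
   differentials do not remove. For m >= 1 the specializations are contracting
   homotopies, and both complexes are exact in positive degrees; T is an isomorphism
   on H^0 for all m; and omitting the inert pairs, with alternating signs, gives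
   differentials that are exact in m. Hence, by a staircase argument, the mapping
   cone of T is exact for m = 0. *)
Require Import Defs.
From HB Require Import structures.
From mathcomp Require Import all_boot all_order all_algebra.
From mathcomp Require Import all_classical all_reals all_analysis.
From mathcomp Require Import measurable_realfun zify.

Set Implicit Arguments.
Unset Strict Implicit.
Unset Printing Implicit Defensive.
Import Order.TTheory GRing.Theory Num.Theory.
Local Open Scope classical_set_scope.
Local Open Scope quotient_scope.
Local Open Scope ring_scope.

(** * Alternating sums and index maps *)

(** A specialization must respect left translations, so it cannot set a coset to $gG_1$ with $g$
    fixed; it needs a base point $y_{kl}$ of the matrix. To be a contraction it must also commute
    with the faces, so the row and the column of the base point must survive all of them. Both
    original differentials omit each row and each column in turn, and no base point is left. This is
    why inert cosets are adjoined, and in pairs: the crossing of one pair is such a point. In the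
    other direction $y_{00}$ survives every omission of inert pairs, hence exactness in $m$ holds
    from $m=0$ on. The choice $g=e$ is excluded: it makes two cosets coincide, which happens on a
    null set, where a class has no value. A generic $g$ is allowed, but the exceptional set depends
    on the class. So there is no homotopy operator on classes; each exactness proof picks one $g$
    outside the exceptional sets of the finitely many identities that it uses. The algebra is done
    for abstract groups [V p q] subject to [specialization_axioms], which are symmetric in rows and
    columns; measure theory enters only to verify these axioms and to identify the complexes. *)

Section AlternatingSums.
Variable V : zmodType.

Lemma altsgn0 (x : V) : altsgn 0 x = x.
Proof. by rewrite /altsgn expr0 mulr1z. Qed.

Lemma altsgnS k (x : V) : altsgn k.+1 x = - altsgn k x.
Proof. by rewrite /altsgn exprS mulN1r mulrNz. Qed.

Lemma altsgnB k (x y : V) : altsgn k (x - y) = altsgn k x - altsgn k y.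
Proof. by rewrite /altsgn mulrzBl. Qed.

Lemma altsgn_zmod k : zmod_morphism (@altsgn V k).
Proof. by move=> x y; rewrite altsgnB. Qed.

HB.instance Definition _ k :=
  GRing.isZmodMorphism.Build V V (@altsgn V k) (@altsgn_zmod k).

Lemma altsgnD j k (x : V) : altsgn (j + k) x = altsgn j (altsgn k x).
Proof. by elim: j => [|j IH]; rewrite ?altsgn0// addSn !altsgnS IH. Qed.

Lemma altsgnK k : involutive (@altsgn V k).
Proof.
by elim: k => [|k IH] x; rewrite ?altsgn0// !altsgnS raddfN /= opprK IH.
Qed.

Definition asum n (f : nat -> V) : V := \sum_(i < n) altsgn i (f i).

Lemma asum0 f : asum 0 f = 0. Proof. by rewrite /asum big_ord0. Qed.

Lemma eq_asum n f g : (forall i, (i < n)%N -> f i = g i) -> asum n f = asum n g.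
Proof. by move=> fg; apply: eq_bigr => i _; rewrite fg. Qed.

Lemma asum_recr n f : asum n.+1 f = asum n f + altsgn n (f n).
Proof. by rewrite /asum big_ord_recr. Qed.

Lemma asum_recl n f : asum n.+1 f = f 0%N - asum n (fun i => f i.+1).
Proof.
rewrite /asum big_ord_recl altsgn0; congr (_ + _); rewrite -sumrN.
by apply: eq_bigr => i _; rewrite lift0 altsgnS.
Qed.

Lemma asumB n f g : asum n (fun i => f i - g i) = asum n f - asum n g.
Proof. by rewrite /asum -sumrB; apply: eq_bigr => i _; rewrite altsgnB. Qed.

Lemma asumN n f : asum n (fun i => - f i) = - asum n f.
Proof. by rewrite /asum -sumrN; apply: eq_bigr => i _; rewrite raddfN. Qed.

Lemma asum_altsgn n k f : asum n (fun i => altsgn k (f i)) = altsgn k (asum n f).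
Proof.
rewrite /asum raddf_sum; apply: eq_bigr => i _.
by rewrite /= -!altsgnD addnC.
Qed.

Lemma asum_exch n m f :
  asum n (fun i => asum m (fun j => f i j)) = asum m (fun j => asum n (fun i => f i j)).
Proof.
rewrite /asum; under eq_bigr do rewrite raddf_sum /=.
rewrite exchange_big /=; apply: eq_bigr => j _; rewrite raddf_sum /=.
by apply: eq_bigr => i _; rewrite -!altsgnD addnC.
Qed.

Lemma asum_split m n f :
  asum (m + n) f = asum m f + altsgn m (asum n (fun i => f (m + i)%N)).
Proof.
rewrite /asum big_split_ord raddf_sum /=; congr (_ + _).
by apply: eq_bigr => i _; rewrite altsgnD.
Qed.

Lemma asum_interior n f : f 0%N = f 1%N -> f n.+2 = f n.+3 ->
  asum n.+4 f = asum n (fun i => f i.+2).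
Proof.
move=> f01 fn; rewrite asum_recr asum_recr -fn (altsgnS n.+2) addrK.
by rewrite !asum_recl -f01 opprB addrC subrK.
Qed.

(** The terms $(j,i)$ with $i<j$ and $(i,j-1)$ carry opposite signs, as in every simplicial proof of
    $d\circ d=0$. The induction cancels row 0 against column 0. Horizontal, pentagonal and inert
    differentials all square to zero through it. *)
Lemma asum_asum n f :
  (forall i j, (i < j)%N -> (j <= n)%N -> f j i = f i j.-1) ->
  asum n.+1 (fun j => asum n (fun i => f j i)) = 0.
Proof.
elim: n f => [|n IH] f H; first by rewrite asum_recr !asum0 add0r raddf0.
rewrite asum_recl.
have -> : asum n.+1 (fun j => asum n.+1 (fun i => f j.+1 i)) =
    asum n.+1 (fun j => f 0%N j)
    - asum n.+1 (fun j => asum n (fun i => f j.+1 i.+1)).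
  rewrite -asumB; apply: eq_asum => j jn.
  by rewrite asum_recl (H 0%N j.+1).
rewrite (IH (fun j i => f j.+1 i.+1)) ?subr0 ?subrr// => i j ij jn.
by rewrite H//; congr f; lia.
Qed.
End AlternatingSums.

Lemma raddf_asum (V W : zmodType) (f : V -> W) n (x : nat -> V) :
  zmod_morphism f -> f (asum n x) = asum n (fun i => f (x i)).
Proof.
move=> fB; have f0 : f 0 = 0 by rewrite -[0 in LHS](subrr 0) fB subrr.
have fN y : f (- y) = - f y by rewrite -[- y]sub0r fB f0 sub0r.
elim: n x => [|n IH] x; first by rewrite !asum0.
by rewrite !asum_recl fB IH.
Qed.

(* Maps {0..m} -> {0..n} are functions on nat whose values above m are irrelevant. *)
Definition emb m n (c : nat -> nat) : Prop :=
  (forall k, (k <= m)%N -> (c k <= n)%N) /\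
  (forall k l, (k <= m)%N -> (l <= m)%N -> c k = c l -> k = l).

(** Moves position [e] to the last place [Q] and shifts the later ones down. Index maps have to be
    injective, because a repeated index would restrict a class to a null set, but they may permute.
    Thus it is enough to know how to specialize the last column or row. *)
Definition cyc e Q k := if (k < e)%N then k else if k == e then Q else k.-1.

Ltac nat_if := repeat (match goal with |- context [if ?b then _ else _] =>
  case: (boolP b) => ? end).
Ltac nat_tac := rewrite /bump /=; nat_if; lia.
Ltac emb_tac := by split=> [?|? ?]; nat_tac.

Lemma emb_cyc e n : (e <= n)%N -> emb n n (cyc e n).
Proof. move=> en; rewrite /cyc; emb_tac. Qed.

Lemma emb_comp l m n c c' : emb m n c -> emb l m c' -> emb l n (c \o c').
Proof.
move=> [cn ci] [cn' ci']; split=> [k kl|k k' kl kl' /= /ci e].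
  by apply: cn; exact: cn'.
by apply: ci' => //; apply: e; exact: cn'.
Qed.

Lemma emb_id m n : (m <= n)%N -> emb m n id.
Proof. move=> mn; emb_tac. Qed.

Lemma emb_bump i m n : (m < n)%N -> emb m n (bump i).
Proof. move=> mn; emb_tac. Qed.

(** * Specialization of a coset *)

(* V p q models L(Gamma_pq). [R r c] is the pullback along the choice of the rows r
   and the columns c of the matrix y representing X; [Su] and [Sv] set the coset of
   the last column, resp. row, to y_{br,bc} g G_1, resp. y_{br,bc} g G_2, for a
   generic g. *)
Record specialization_axioms (V : nat -> nat -> zmodType)
  (Om : Type) (ae : set_system Om)
  (R : forall p q p' q', (nat -> nat) -> (nat -> nat) -> V p' q' -> V p q)
  (Su : forall p q q', nat -> nat -> Om -> V p q' -> V p q)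
  (Sv : forall p q p', nat -> nat -> Om -> V p' q -> V p q) : Prop :=
  SpecializationAxioms {
  R_ext : forall p q p' q' r r' c c' (x : V p' q'),
    (forall k, (k <= p')%N -> r k = r' k) -> (forall k, (k <= q')%N -> c k = c' k) ->
    R p q _ _ r c x = R p q _ _ r' c' x;
  R_B : forall p q p' q' r c, emb p' p r -> emb q' q c ->
    zmod_morphism (R p q p' q' r c);
  R_comp : forall p q p' q' p'' q'' r c r' c' (x : V p'' q''),
    emb p' p r -> emb q' q c -> emb p'' p' r' -> emb q'' q' c' ->
    R p q _ _ r c (R p' q' _ _ r' c' x) = R p q _ _ (r \o r') (c \o c') x;
  R_id : forall p q (x : V p q), R p q _ _ id id x = x;
  Su_B : forall p q br bc (x y : V p q.+1), (br <= p)%N -> (bc <= q)%N ->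
    \forall g \near ae, Su p q _ br bc g (x - y) = Su p q _ br bc g x - Su p q _ br bc g y;
  Su_R : forall p q p' q' r c br bc br' bc' (x : V p' q'.+1),
    emb p' p r -> emb q'.+1 q.+1 c -> c q'.+1 = q.+1 ->
    (br' <= p')%N -> (bc' <= q')%N -> r br' = br -> c bc' = bc ->
    \forall g \near ae, Su p q _ br bc g (R p q.+1 _ _ r c x) =
                        R p q _ _ r c (Su p' q' _ br' bc' g x);
  Su_skip : forall p q p' q' r c br bc (x : V p' q'),
    emb p' p r -> emb q' q c -> (br <= p)%N -> (bc <= q)%N ->
    \forall g \near ae, Su p q _ br bc g (R p q.+1 _ _ r c x) = R p q _ _ r c x;
  Sv_B : forall p q br bc (x y : V p.+1 q), (br <= p)%N -> (bc <= q)%N ->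
    \forall g \near ae, Sv p q _ br bc g (x - y) = Sv p q _ br bc g x - Sv p q _ br bc g y;
  Sv_R : forall p q p' q' r c br bc br' bc' (x : V p'.+1 q'),
    emb p'.+1 p.+1 r -> emb q' q c -> r p'.+1 = p.+1 ->
    (br' <= p')%N -> (bc' <= q')%N -> r br' = br -> c bc' = bc ->
    \forall g \near ae, Sv p q _ br bc g (R p.+1 q _ _ r c x) =
                        R p q _ _ r c (Sv p' q' _ br' bc' g x);
  Sv_skip : forall p q p' q' r c br bc (x : V p' q'),
    emb p' p r -> emb q' q c -> (br <= p)%N -> (bc <= q)%N ->
    \forall g \near ae, Sv p q _ br bc g (R p.+1 q _ _ r c x) = R p q _ _ r c x
}.

Section Specialization.
Context (V : nat -> nat -> zmodType) (Om : Type) (ae : set_system Om) {aeF : ProperFilter ae}.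
Variable R : forall (p q : nat) {p' q' : nat}, (nat -> nat) -> (nat -> nat) -> V p' q' -> V p q.
Variable Su : forall (p q : nat) {q' : nat}, nat -> nat -> Om -> V p q' -> V p q.
Variable Sv : forall (p q : nat) {p' : nat}, nat -> nat -> Om -> V p' q -> V p q.
Arguments R p q {p' q'} _ _ _.
Arguments Su p q {q'} _ _ _ _.
Arguments Sv p q {p'} _ _ _ _.
Hypothesis ax : specialization_axioms ae (@R) (@Su) (@Sv).

Lemma R_asum p q p' q' r c n (x : nat -> V p' q') : emb p' p r -> emb q' q c ->
  R p q r c (asum n x) = asum n (fun i => R p q r c (x i)).
Proof. by move=> er ec; apply: raddf_asum; exact: (R_B ax). Qed.

Lemma R0 p q p' q' r c : emb p' p r -> emb q' q c -> R p q r c (0 : V p' q') = 0.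
Proof. by move=> er ec; rewrite -[0 in LHS](subrr 0) (R_B ax)// subrr. Qed.

Lemma RN p q p' q' r c (x : V p' q') : emb p' p r -> emb q' q c ->
  R p q r c (- x) = - R p q r c x.
Proof. by move=> er ec; rewrite -[- x]sub0r (R_B ax)// R0// sub0r. Qed.

Lemma RD p q p' q' r c (x y : V p' q') : emb p' p r -> emb q' q c ->
  R p q r c (x + y) = R p q r c x + R p q r c y.
Proof. by move=> er ec; rewrite -[y in LHS]opprK (R_B ax)// RN// opprK. Qed.

Lemma R_altsgn p q p' q' r c k (x : V p' q') : emb p' p r -> emb q' q c ->
  R p q r c (altsgn k x) = altsgn k (R p q r c x).
Proof.
by move=> er ec; elim: k => [|k IH]; rewrite ?altsgn0// !altsgnS RN// IH.
Qed.

(* Insertion at position e: the last variable is specialized after a cyclic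
   permutation. *)
Definition insu (p q q' e br bc : nat) (g : Om) (x : V p q') : V p q :=
  Su p q br bc g (R p q' id (cyc e q') x).

Lemma bump_cover e k Q : (k <= Q.+1)%N -> (e <= Q.+1)%N -> k != e ->
  exists2 l, (l <= Q)%N & k = bump e l.
Proof. by move=> *; exists (unbump e k); rewrite /bump /unbump; lia. Qed.

Lemma cyc_bump e Q k : (k < Q)%N -> cyc e Q (bump e k) = k.
Proof. by rewrite /cyc; nat_tac. Qed.

Lemma insuB p q q' e br bc (x y : V p q') : q' = q.+1 ->
  (br <= p)%N -> (bc <= q)%N -> (e <= q')%N ->
  \forall g \near ae, insu q e br bc g (x - y) = insu q e br bc g x - insu q e br bc g y.
Proof.
move=> q'E; subst q' => brp bcq eq.
apply: filterS (Su_B ax (R p q.+1 id (cyc e q.+1) x) (R p q.+1 id (cyc e q.+1) y) brp bcq).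
move=> g; rewrite /insu (R_B ax)//; exact: emb_cyc.
Qed.

Lemma near_asum p q p' q' (f : Om -> V p' q' -> V p q) n (x : nat -> V p' q') :
  (forall x y, \forall g \near ae, f g (x - y) = f g x - f g y) ->
  \forall g \near ae, f g (asum n x) = asum n (fun i => f g (x i)).
Proof.
move=> fB; elim: n x => [|n IH] x.
  by apply: filterS (fB 0 0) => g; rewrite !asum0 !subrr.
by apply: filterS2 (fB (x 0%N) (asum n (x \o succn))) (IH (x \o succn)) => g;
  rewrite !asum_recl => -> ->.
Qed.

Lemma insu_asum p q q' e br bc n (x : nat -> V p q') : q' = q.+1 ->
  (br <= p)%N -> (bc <= q)%N -> (e <= q')%N ->
  \forall g \near ae, insu q e br bc g (asum n x) = asum n (fun i => insu q e br bc g (x i)).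
Proof. by move=> *; apply: (near_asum (f := @insu p q q' e br bc)) => *; exact: insuB. Qed.

Lemma insu0 p q q' e br bc : q' = q.+1 ->
  (br <= p)%N -> (bc <= q)%N -> (e <= q')%N ->
  \forall g \near ae, insu q e br bc g (0 : V p q') = 0.
Proof.
move=> q'E brp bcq eq; apply: filterS (insuB (0 : V p q') 0 q'E brp bcq eq) => g.
by rewrite !subrr.
Qed.

(** Since [c] factors through [bump e], the class does not see the coset being set. This plays the
    role of $s\,d_0=1$ in a contracting homotopy, and [insu_R] that of $s\,d_{i+1}=d_i\,s$. *)
Lemma insu_skip p q q1 p' q' r c c' e br bc (x : V p' q') : q1 = q.+1 ->
  emb p' p r -> emb q' q c' -> (br <= p)%N -> (bc <= q)%N -> (e <= q1)%N ->
  (forall k, (k <= q')%N -> c k = bump e (c' k)) ->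
  \forall g \near ae, insu q e br bc g (R p q1 r c x) = R p q r c' x.
Proof.
move=> q1E; subst q1 => er ec brp bcq eq cE.
apply: filterS (Su_skip ax x er ec brp bcq) => g <-; rewrite /insu; congr Su.
have ec1 : emb q' q.+1 c.
  have [h1 h2] := ec; split=> [k kq|k l kq lq]; rewrite !cE//.
    by have := h1 _ kq; nat_tac.
  by move=> /(can_inj (bumpK _)); exact: h2.
rewrite (R_comp ax)//; last exact: emb_cyc.
apply: (R_ext ax) => // k kq /=; rewrite cE// cyc_bump// ltnS.
exact: ec.1.
Qed.

Lemma insu_R p q q1 p' q' q1' r c c' e e' br bc br' bc' (x : V p' q1') :
  q1 = q.+1 -> q1' = q'.+1 ->
  emb p' p r -> emb q' q c' -> (br' <= p')%N -> (bc' <= q')%N ->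
  (e <= q1)%N -> (e' <= q1')%N -> r br' = br -> c' bc' = bc ->
  c e' = e -> (forall k, (k <= q')%N -> c (bump e' k) = bump e (c' k)) ->
  \forall g \near ae, insu q e br bc g (R p q1 r c x) = R p q r c' (insu q' e' br' bc' g x).
Proof.
move=> q1E q1'E; subst q1 q1' => er ec brp bcq eq eq' rE c'E ce cE.
(* Once [e] and [e'] are moved to the end, [c] becomes [c'] extended by sending last to last, which
   is the form covered by [Su_R]. *)
pose cc k := if (k <= q')%N then c' k else q.+1.
have ecc : emb q'.+1 q.+1 cc.
  have [h1 h2] := ec; split=> [k kq|k l kq lq]; rewrite /cc.
    by case: ifP => // /h1; lia.
  case: ifP => h; case: ifP => h'.
  - exact: h2.
  - by have := h1 _ h; lia.
  - by have := h1 _ h'; lia.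
  - lia.
have ec1 : emb q'.+1 q.+1 c.
  have [h1 h2] := ec.
  split=> [k kq|k l kq lq].
    have [->|/(bump_cover kq eq') [l lq ->]] := eqVneq k e'; first by rewrite ce.
    by rewrite cE//; have := h1 _ lq; nat_tac.
  have [->|/(bump_cover kq eq') [k' kq' ->]] := eqVneq k e'.
    have [->//|/(bump_cover lq eq') [l' lq' ->]] := eqVneq l e'.
    by rewrite ce cE// => /eqP; rewrite (negPf (neq_bump _ _)).
  have [->|/(bump_cover lq eq') [l' lq' ->]] := eqVneq l e'.
    by rewrite ce cE// => /esym/eqP; rewrite (negPf (neq_bump _ _)).
  by rewrite !cE// => /(can_inj (bumpK _))/h2 ->.
have ccE : cc bc' = bc by rewrite /cc bcq.
have ccq : cc q'.+1 = q.+1 by rewrite /cc ltnn.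
apply: filterS (Su_R ax (R p' q'.+1 id (cyc e' q'.+1) x) er ecc ccq brp bcq rE ccE).
move=> g; rewrite /insu.
rewrite (R_comp ax)//; last exact: emb_cyc.
rewrite (R_comp ax)//; last exact: emb_cyc.
have -> : R p q.+1 (id \o r) (cyc e q.+1 \o c) x =
    R p q.+1 (r \o id) (cc \o cyc e' q'.+1) x.
  apply: (R_ext ax) => // k kq /=; have [->|ke] := eqVneq k e'.
    by rewrite ce /cyc !ltnn !eqxx /cc ltnn.
  have [l lq ->] := bump_cover kq eq' ke.
  by rewrite cyc_bump// cE// cyc_bump ?ltnS ?(ec.1)// /cc lq.
move=> ->; apply: (R_ext ax) => // k kq.
by rewrite /cc kq.
Qed.

End Specialization.

(** * Exchange of rows and columns *)

Section Transposition.
Context (V : nat -> nat -> zmodType) (Om : Type) (ae : set_system Om) {aeF : ProperFilter ae}.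
Variable R : forall (p q : nat) {p' q' : nat}, (nat -> nat) -> (nat -> nat) -> V p' q' -> V p q.
Variable Su : forall (p q : nat) {q' : nat}, nat -> nat -> Om -> V p q' -> V p q.
Variable Sv : forall (p q : nat) {p' : nat}, nat -> nat -> Om -> V p' q -> V p q.
Arguments R p q {p' q'} _ _ _.
Arguments Su p q {q'} _ _ _ _.
Arguments Sv p q {p'} _ _ _ _.
Hypothesis ax : specialization_axioms ae (@R) (@Su) (@Sv).

Definition transR (p q p' q' : nat) r c (x : V q' p') : V q p := R q p c r x.
Definition transSu (p q p' : nat) br bc g (x : V p' p) : V q p := Sv q p bc br g x.
Definition transSv (p q p' : nat) br bc g (x : V q p') : V q p := Su q p bc br g x.

(** Exchanging the two indices permutes the axioms, so each statement about columns yields its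
    counterpart for rows. *)
Lemma specialization_transpose :
  specialization_axioms (V := fun p q => V q p) ae transR transSu transSv.
Proof.
split; rewrite /transR /transSu /transSv.
- by move=> *; exact: (R_ext ax).
- by move=> *; exact: (R_B ax).
- by move=> *; exact: (R_comp ax).
- by move=> *; exact: (R_id ax).
- by move=> *; exact: (Sv_B ax).
- by move=> *; exact: (Sv_R ax).
- by move=> *; exact: (Sv_skip ax).
- by move=> *; exact: (Su_B ax).
- by move=> *; exact: (Su_R ax).
- by move=> *; exact: (Su_skip ax).
Qed.

Definition insv (p q p' e br bc : nat) (g : Om) (x : V p' q) : V p q :=
  Sv p q br bc g (R p' q (cyc e p') id x).

Lemma insv_asum p q p' e br bc n (x : nat -> V p' q) : p' = p.+1 ->
  (br <= p)%N -> (bc <= q)%N -> (e <= p')%N ->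
  \forall g \near ae, insv p e br bc g (asum n x) = asum n (fun i => insv p e br bc g (x i)).
Proof. by move=> *; exact: (insu_asum specialization_transpose). Qed.

Lemma insv0 p q p' e br bc : p' = p.+1 ->
  (br <= p)%N -> (bc <= q)%N -> (e <= p')%N ->
  \forall g \near ae, insv p e br bc g (0 : V p' q) = 0.
Proof. by move=> *; exact: (insu0 specialization_transpose). Qed.

Lemma insv_skip p q p1 p' q' r c r' e br bc (x : V p' q') : p1 = p.+1 ->
  emb p' p r' -> emb q' q c -> (br <= p)%N -> (bc <= q)%N -> (e <= p1)%N ->
  (forall k, (k <= p')%N -> r k = bump e (r' k)) ->
  \forall g \near ae, insv p e br bc g (R p1 q r c x) = R p q r' c x.
Proof. by move=> *; exact: (insu_skip specialization_transpose). Qed.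

Lemma insv_R p q p1 p' q' p1' r c r' e e' br bc br' bc' (x : V p1' q') :
  p1 = p.+1 -> p1' = p'.+1 ->
  emb p' p r' -> emb q' q c -> (br' <= p')%N -> (bc' <= q')%N ->
  (e <= p1)%N -> (e' <= p1')%N -> r' br' = br -> c bc' = bc ->
  r e' = e -> (forall k, (k <= p')%N -> r (bump e' k) = bump e (r' k)) ->
  \forall g \near ae, insv p e br bc g (R p1 q r c x) = R p q r' c (insv p' e' br' bc' g x).
Proof. by move=> *; exact: (insu_R specialization_transpose). Qed.

End Transposition.

(** * Exactness of the Kac complex with inert cosets *)

Section Faces.
Context (V : nat -> nat -> zmodType) (Om : Type) (ae : set_system Om) {aeF : ProperFilter ae}.
Variable R : forall (p q : nat) {p' q' : nat}, (nat -> nat) -> (nat -> nat) -> V p' q' -> V p q.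
Variable Su : forall (p q : nat) {q' : nat}, nat -> nat -> Om -> V p q' -> V p q.
Variable Sv : forall (p q : nat) {p' : nat}, nat -> nat -> Om -> V p' q -> V p q.
Arguments R p q {p' q'} _ _ _.
Arguments Su p q {q'} _ _ _ _.
Arguments Sv p q {p'} _ _ _ _.
Hypothesis ax : specialization_axioms ae (@R) (@Su) (@Sv).

Definition hsum k p q q' (x : V p q) : V p q' := asum k (fun i => R p q' id (bump i) x).
Arguments hsum k {p q} q' x.

Lemma hsumB k p q q' (x y : V p q) : (q < q')%N ->
  hsum k q' (x - y) = hsum k q' x - hsum k q' y.
Proof.
move=> qq'; rewrite /hsum -asumB; apply: eq_asum => i _.
by rewrite (R_B ax)//; emb_tac.
Qed.

Lemma hsum1 p q q' (x : V p q) : hsum 1 q' x = R p q' id (bump 0) x.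
Proof. by rewrite /hsum asum_recl asum0 subr0. Qed.

Lemma hsum_hsum k p q q1 q2 (x : V p q) : (q < q1)%N -> (q1 < q2)%N ->
  hsum k.+1 q2 (hsum k q1 x) = 0.
Proof.
move=> qq1 q12; pose f j i := R p q2 id (bump j \o bump i) x.
transitivity (asum k.+1 (fun j => asum k (fun i => f j i))).
  apply: eq_asum => j _; rewrite (R_asum ax); [|emb_tac..].
  by apply: eq_asum => i _; rewrite (R_comp ax)//; emb_tac.
apply: asum_asum => i j ij jk; apply: (R_ext ax) => // l _ /=; nat_tac.
Qed.

(** Setting the omitted column to a generic value is a left inverse of its omission. *)
Lemma R_hface_inj p q q' i (x : V p q) : q' = q.+1 -> (i <= q')%N ->
  R p q' id (bump i) x = 0 -> x = 0.
Proof.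
move=> q'E iq x0; near ae => g.
have U0 : insu (@R) (@Su) q i 0 0 g (0 : V p q') = 0.
  by near: g; exact: (insu0 ax).
rewrite -U0 -x0 -[LHS](R_id ax); apply/esym; near: g.
exact: (insu_skip ax).
Unshelve. all: by end_near. Qed.

(** Column 0 is set to a coset based at a point of the last column. The faces omit columns
    $0,\dots,k+1$ among $0,\dots,q+2$, and $k\le q$ keeps the last one. Face 0 then returns [x], and
    the others become the faces of the specialization of [x], which is the primitive. *)
Lemma hsum_exact p q q1 q2 k (x : V p q1) : q1 = q.+1 -> q2 = q1.+1 -> (k <= q)%N ->
  hsum k.+2 q2 x = 0 -> exists y : V p q, x = hsum k.+1 q1 y.
Proof.
move=> q1E q2E kq x0; near ae => g.
pose U q q' := @insu V Om (@R) (@Su) p q q' 0 0.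
exists (U q q1 q g x).
have U0 : U q1 q2 q1 g 0 = 0 by near: g; exact: (insu0 ax).
have UD : U q1 q2 q1 g (hsum k.+2 q2 x) =
    asum k.+2 (fun i => U q1 q2 q1 g (R p q2 id (bump i) x)).
  by near: g; apply: (insu_asum ax).
have Ux : U q1 q2 q1 g (R p q2 id (bump 0) x) = R p q1 id id x.
  by near: g; apply: (insu_skip ax).
move: UD; rewrite x0 U0 asum_recl Ux (R_id ax) => /esym/eqP.
rewrite subr_eq0 => /eqP xE; rewrite [LHS]xE; apply: eq_asum => i ik.
have H (j : 'I_k.+1) : U q1 q2 q1 g (R p q2 id (bump j.+1) x) = R p q1 id (bump j) (U q q1 q g x).
  move: j; near: g; apply: filter_forall => j.
  apply: (insu_R ax) => //; have := ltn_ord j.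
  - by move=> ?; apply: emb_bump; lia.
  - nat_tac.
  - nat_tac.
exact: (H (Ordinal ik)).
Unshelve. all: by end_near. Qed.

Definition vsum k p q p' (x : V p q) : V p' q := asum k (fun i => R p' q (bump i) id x).
Arguments vsum k {p q} p' x.

Lemma hsum_vsum k l p q p' q' (x : V p q) : (p < p')%N -> (q < q')%N ->
  hsum k q' (vsum l p' x) = vsum l p' (hsum k q' x).
Proof.
move=> pp' qq'; rewrite /hsum /vsum.
transitivity (asum k (fun i => asum l (fun j => R p' q' (bump j) (bump i) x))).
  apply: eq_asum => i _; rewrite (R_asum ax); [|emb_tac..].
  by apply: eq_asum => j _; rewrite (R_comp ax)//; emb_tac.
rewrite asum_exch; apply: eq_asum => j _; rewrite (R_asum ax); [|emb_tac..].
by apply: eq_asum => i _; rewrite (R_comp ax)//; emb_tac.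
Qed.

End Faces.
Arguments hsum {V} R k {p q} q' x.
Arguments vsum {V} R k {p q} p' x.

Section KacExactness.
Context (V : nat -> nat -> zmodType) (Om : Type) (ae : set_system Om) {aeF : ProperFilter ae}.
Variable R : forall (p q : nat) {p' q' : nat}, (nat -> nat) -> (nat -> nat) -> V p' q' -> V p q.
Variable Su : forall (p q : nat) {q' : nat}, nat -> nat -> Om -> V p q' -> V p q.
Variable Sv : forall (p q : nat) {p' : nat}, nat -> nat -> Om -> V p' q -> V p q.
Arguments R p q {p' q'} _ _ _.
Hypothesis ax : specialization_axioms ae (@R) (@Su) (@Sv).
Local Notation hsum := (hsum (@R)).
Local Notation vsum := (vsum (@R)).
Let tax := specialization_transpose ax.

Lemma vsumB k p q p' (x y : V p q) : (p < p')%N ->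
  vsum k p' (x - y) = vsum k p' x - vsum k p' y.
Proof. exact: (hsumB tax). Qed.

Lemma vsum_vsum k p q p1 p2 (x : V p q) : (p < p1)%N -> (p1 < p2)%N ->
  vsum k.+1 p2 (vsum k p1 x) = 0.
Proof. exact: (hsum_hsum tax). Qed.

Lemma R_vface_inj p q p' i (x : V p q) : p' = p.+1 -> (i <= p')%N ->
  R p' q (bump i) id x = 0 -> x = 0.
Proof. exact: (R_hface_inj tax). Qed.

Lemma vsum_exact p q p1 p2 k (x : V p1 q) : p1 = p.+1 -> p2 = p1.+1 -> (k <= p)%N ->
  vsum k.+2 p2 x = 0 -> exists y : V p q, x = vsum k.+1 p1 y.
Proof. exact: (hsum_exact tax). Qed.

Lemma hsum0 k p q q' : (q < q')%N -> hsum k q' (0 : V p q) = 0.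
Proof. by move=> qq'; rewrite -(subrr 0) (hsumB ax)// subrr. Qed.

Lemma vsum0 k p q p' : (p < p')%N -> vsum k p' (0 : V p q) = 0.
Proof. by move=> qq'; rewrite -(subrr 0) vsumB// subrr. Qed.

Lemma hsum_altsgn k l p q q' (x : V p q) : (q < q')%N ->
  hsum k q' (altsgn l x) = altsgn l (hsum k q' x).
Proof.
move=> qq'; rewrite /hsum -asum_altsgn; apply: eq_asum => i _.
by rewrite (R_altsgn ax)//; emb_tac.
Qed.

Lemma vsum_altsgn k l p q p' (x : V p q) : (p < p')%N ->
  vsum k p' (altsgn l x) = altsgn l (vsum k p' x).
Proof.
move=> pp'; rewrite /vsum -asum_altsgn; apply: eq_asum => i _.
by rewrite (R_altsgn ax)//; emb_tac.
Qed.

(** The double complex is continued to the left, beyond the Kac complex, by classes with one and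
    with no removable column. The zigzag [f], [g], [w], [w'], [a] runs through this continuation and
    stops because its first differential [hsum 1] is a single face, hence injective. *)
Lemma kac_corner_exact n P P1 P2 P3 Q0 Q Q1 Q2 (f : V P1 Q1) :
  P1 = P.+1 -> P2 = P1.+1 -> P3 = P2.+1 -> Q = Q0.+1 -> Q1 = Q.+1 -> Q2 = Q1.+1 ->
  (n < P)%N -> hsum 3 Q2 f = 0 -> vsum n.+3 P2 f = 0 ->
  exists a : V P Q, f = hsum 2 Q1 (vsum n.+2 P1 a).
Proof.
move=> P1E P2E P3E QE Q1E Q2E nP hf vf.
have [|g fE] := hsum_exact ax Q1E Q2E _ hf; first lia.
have : hsum 2 Q1 (vsum n.+3 P2 g) = 0.
  by rewrite (hsum_vsum ax) -?fE//; lia.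
move=> /(hsum_exact ax QE Q1E (leq0n _)) [w gw].
have : hsum 1 Q (vsum n.+4 P3 w) = 0.
  by rewrite (hsum_vsum ax) -?gw ?vsum_vsum//; lia.
rewrite hsum1 => /(R_hface_inj ax QE (leq0n _)) vw.
have [|w' wE] := vsum_exact P2E P3E _ vw; first lia.
have : vsum n.+3 P2 (g - hsum 1 Q w') = 0.
  by rewrite vsumB -?(hsum_vsum ax) -?wE ?gw ?subrr//; lia.
move=> /(vsum_exact P1E P2E nP) [a aE]; exists a.
by rewrite -aE (hsumB ax) -?fE ?(hsum_hsum ax) ?subr0//; lia.
Qed.

Section Level.
Variable m : nat.
(* The last m rows and the last m columns are inert: the differential does not
   remove them. *)
Definition kfam := forall p q, V (m + p.+1) (m + q.+1).
Implicit Types f : kfam.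

Definition kdh f p q : V (m + p.+1) (m + q.+1) :=
  if q is q'.+1 return V (m + p.+1) (m + q.+1) then hsum q'.+3 _ (f p q') else 0.
Definition kdv f p q : V (m + p.+1) (m + q.+1) :=
  if p is p'.+1 return V (m + p.+1) (m + q.+1)
  then altsgn q.+1 (vsum p'.+3 _ (f p' q)) else 0.
Definition kd f : kfam := fun p q => kdh f p q + kdv f p q.

Lemma kdB f f' p q : kd (fun p q => f p q - f' p q) p q = kd f p q - kd f' p q.
Proof.
rewrite /kd opprD addrACA; congr (_ + _).
  by case: q => [|q] /=; rewrite ?subr0// (hsumB ax)//; lia.
by case: p => [|p] /=; rewrite ?subr0// vsumB ?raddfB//; lia.
Qed.

Lemma kdD f f' p q : kd (fun p q => f p q + f' p q) p q = kd f p q + kd f' p q.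
Proof.
have k0 : kd (fun _ _ => 0) p q = 0.
  have := kdB f f p q; rewrite subrr => <-; apply: (congr1 (fun h : kfam => kd h p q)).
  by do 2!apply: functional_extensionality_dep => ?; rewrite subrr.
have -> : kd f' p q = - kd (fun p q => 0 - f' p q) p q by rewrite kdB k0 sub0r opprK.
rewrite -kdB; apply: (congr1 (fun h : kfam => kd h p q)).
by do 2!apply: functional_extensionality_dep => ?; rewrite sub0r opprK.
Qed.

Lemma kdd f p q : kd (kd f) p q = 0.
Proof.
have hh : kdh (kdh f) p q = 0.
  case: q => [|[|q]] //=; first by rewrite hsum0//; lia.
  by rewrite (hsum_hsum ax)//; lia.
have vv : kdv (kdv f) p q = 0.
  case: p hh => [|[|p]] //= _; first by rewrite vsum0 ?raddf0//; lia.
  by rewrite vsum_altsgn ?vsum_vsum ?raddf0//; lia.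
have hv : kdh (kdv f) p q + kdv (kdh f) p q = 0.
  case: p q {hh vv} => [|p] [|q] /=.
  - by rewrite addr0.
  - by rewrite addr0 hsum0//; lia.
  - by rewrite add0r vsum0 ?raddf0//; lia.
  rewrite hsum_altsgn; last lia.
  by rewrite (hsum_vsum ax) ?(altsgnS q.+1) ?addrN//; lia.
rewrite /kd.
have -> : kdh (fun p q => kdh f p q + kdv f p q) p q = kdh (kdh f) p q + kdh (kdv f) p q.
  case: q {hh vv hv} => [|q] /=; first by rewrite addr0.
  rewrite -[in LHS](opprK (kdv f p q)) (hsumB ax); last lia.
  by rewrite -[- kdv f p q]sub0r (hsumB ax) ?hsum0 ?sub0r ?opprK//; lia.
have -> : kdv (fun p q => kdh f p q + kdv f p q) p q = kdv (kdh f) p q + kdv (kdv f) p q.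
  case: p {hh vv hv} => [|p] /=; first by rewrite addr0.
  rewrite -[in LHS](opprK (kdv f p q)) vsumB; last lia.
  by rewrite -[- kdv f p q]sub0r vsumB ?vsum0 ?sub0r ?opprK ?raddfD//; lia.
by rewrite hh vv add0r addr0.
Qed.

(** The pullback along [id] serves as a cast: the indices are compared by booleans, and [R_id] makes
    it the identity where they agree. *)
Definition single p0 q0 (x : V (m + p0.+1) (m + q0.+1)) : kfam :=
  fun p q => if (p == p0) && (q == q0) then R _ _ id id x else 0.

Lemma single_self p0 q0 (x : V (m + p0.+1) (m + q0.+1)) : single x p0 q0 = x.
Proof. by rewrite /single !eqxx (R_id ax). Qed.

Lemma kd_single_h p0 q0 (x : V (m + p0.+1) (m + q0.+1)) :
  kd (single x) p0 q0.+1 = hsum q0.+3 _ x.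
Proof.
rewrite /kd /= single_self; case: p0 x => [|p] x /=; first by rewrite addr0.
by rewrite /single andbC eqn_leq ltnn vsum0 ?raddf0 ?addr0//; lia.
Qed.

Lemma kd_single_v p0 q0 (x : V (m + p0.+1) (m + q0.+1)) :
  kd (single x) p0.+1 q0 = altsgn q0.+1 (vsum p0.+3 _ x).
Proof.
rewrite /kd /= single_self; case: q0 x => [|q] x /=; first by rewrite add0r.
by rewrite /single eqn_leq ltnn hsum0 ?raddf0 ?add0r//; lia.
Qed.

Lemma kd_single_0 p0 q0 (x : V (m + p0.+1) (m + q0.+1)) p q :
  (p != p0) || (q != q0.+1) -> (p != p0.+1) || (q != q0) -> kd (single x) p q = 0.
Proof.
move=> h1 h2; rewrite /kd.
have -> : kdh (single x) p q = 0.
  case: q h1 {h2} => [|q] //=; rewrite /single eqSS.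
  by case: ifP => [|_ _]; [lia|rewrite hsum0//; lia].
have -> : kdv (single x) p q = 0.
  case: p h2 {h1} => [|q'] //=; rewrite /single eqSS.
  by case: ifP => [|_ _]; [lia|rewrite vsum0 ?raddf0//; lia].
by rewrite addr0.
Qed.

(** Induction on a bound [j] for the column index of the non-zero components. The component of
    largest column index is horizontally closed, hence a horizontal coboundary, and subtracting the
    corresponding coboundary of [kd] lowers the bound. A cocycle concentrated in column index 0 is
    closed in both directions and falls under [kac_corner_exact]. *)
Lemma kac_exact k f : (0 < m)%N -> (forall p q, (p + q = k.+1)%N -> kd f p q = 0) ->
  if k is k'.+1 then exists h, forall p q, (p + q = k)%N -> f p q = kd h p q
  else exists a : V m m, f 0%N 0%N = hsum 2 _ (vsum 2 _ a).
Proof.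
move=> m0; have [j jf] : exists j, forall p q, (p + q = k)%N -> (j < q)%N -> f p q = 0.
  by exists k => p q; lia.
elim: j f jf => [|j IH] f jf fc.
  have hf : hsum 3 (m + 2) (f k 0%N) = 0.
    have := fc k 1%N (addn1 _); rewrite /kd /=; case: (k) jf fc => [|k'] jf fc /=.
      by rewrite addr0.
    by rewrite (jf k')// ?vsum0 ?raddf0 ?addr0//; lia.
  have vf : vsum k.+3 (m + k.+2) (f k 0%N) = 0.
    have := fc k.+1 0%N (addn0 _); rewrite /kd /= add0r => h.
    by rewrite -[LHS](altsgnK 1) h raddf0.
  case: k jf fc hf vf => [|k] jf fc hf vf.
    apply: (kac_corner_exact (n := 0) (P := m) (P2 := (m + 2)%N) (P3 := (m + 3)%N)
      (Q0 := m.-1) (Q2 := (m + 2)%N)) => //; lia.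
  have [|||||||a aE] := kac_corner_exact (n := k.+1) (P := (m + k.+1)%N)
    (P1 := (m + k.+2)%N) (P2 := (m + k.+3)%N) (P3 := (m + k.+4)%N)
      (Q0 := m.-1) (Q := m) (Q1 := (m + 1)%N) (Q2 := (m + 2)%N) _ _ _ _ _ _ _ hf vf; try lia.
  (* The sign undoes that of [kdv] at column index 0. The horizontal part of the coboundary
     vanishes, being [hsum 3] of [hsum 2]. *)
  pose y : V (m + k.+1) (m + 1) := altsgn 1 (hsum 2 (m + 1) a).
  exists (single y) => p q pq.
  have [q0|q0] := eqVneq q 0%N.
    have pk : p = k.+1 by lia.
    subst p q; rewrite kd_single_v aE /y vsum_altsgn; last lia.
    by rewrite altsgnK (hsum_vsum ax)//; lia.
  have [q1|q1] := eqVneq q 1%N.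
    have pk : p = k by lia.
    subst p q; rewrite kd_single_h jf//.
    by rewrite /y hsum_altsgn ?(hsum_hsum ax) ?raddf0//; lia.
  by rewrite kd_single_0 ?jf//; lia.
have [kj|jk] := ltnP k j.+1.
  by apply: IH => // p q pq jq; apply: jf => //; lia.
pose p0 := (k - j.+1)%N.
have hf : hsum j.+4 (m + j.+3) (f p0 j.+1) = 0.
  have := fc p0 j.+2; rewrite /kd /= => /(_ _) <-; last by rewrite /p0; lia.
  rewrite /p0; case e : (k - j.+1)%N => [|p] /=; first by rewrite addr0.
  by rewrite (jf p) ?vsum0 ?raddf0 ?addr0//; lia.
have [|||y yE] := hsum_exact ax (q := (m + j.+1)%N) _ _ _ hf; try lia.
pose f' : kfam := fun p q => f p q - kd (single y) p q.
have jf' p q : (p + q = k)%N -> (j < q)%N -> f' p q = 0.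
  move=> pq jq; rewrite /f'.
  have [qj|qj] := eqVneq q j.+1.
    have pp0 : p = p0 by rewrite /p0; lia.
    by subst p q; rewrite kd_single_h -yE subrr.
  by rewrite kd_single_0 ?jf ?subrr//; rewrite /p0; lia.
have f'c p q : (p + q = k.+1)%N -> kd f' p q = 0.
  by move=> pq; rewrite kdB kdd fc// subrr.
have := IH f' jf' f'c; case: (k) jk => [|k'] // _ [h hE].
exists (fun p q => h p q + single y p q) => p q pq.
by rewrite kdD -hE// /f' subrK.
Qed.

End Level.
End KacExactness.

(** * Exactness of the pentagonal complex with inert cosets *)

Ltac face_tac ax :=
  rewrite !(R_comp ax); [by apply: (R_ext ax) => ? _ /=; nat_tac | emb_tac ..].

Section PentagonalExactness.
Context (V : nat -> nat -> zmodType) (Om : Type) (ae : set_system Om) {aeF : ProperFilter ae}.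
Variable R : forall (p q : nat) {p' q' : nat}, (nat -> nat) -> (nat -> nat) -> V p' q' -> V p q.
Variable Su : forall (p q : nat) {q' : nat}, nat -> nat -> Om -> V p q' -> V p q.
Variable Sv : forall (p q : nat) {p' : nat}, nat -> nat -> Om -> V p' q -> V p q.
Arguments R p q {p' q'} _ _ _.
Hypothesis ax : specialization_axioms ae (@R) (@Su) (@Sv).
Local Notation insu := (insu (@R) (@Su)).
Local Notation insv := (insv (@R) (@Sv)).

Definition psum n p q p' (x : V p q) : V p' p' :=
  asum n.+3 (fun k => R p' p' (bump k.-1) (bump (minn k n.+1)) x).
Arguments psum n {p q} p' x.

Lemma psumB n p p' (x y : V p p) : (p < p')%N -> psum n p' (x - y) = psum n p' x - psum n p' y.
Proof.
move=> pp'; rewrite /psum -asumB; apply: eq_asum => k _.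
by rewrite (R_B ax)//; emb_tac.
Qed.

Lemma psum0 n p p' : (p < p')%N -> psum n p' (0 : V p p) = 0.
Proof. by move=> pp'; rewrite -(subrr 0) psumB// subrr. Qed.

Lemma psumD n p p' (x y : V p p) : (p < p')%N -> psum n p' (x + y) = psum n p' x + psum n p' y.
Proof.
by move=> pp'; rewrite -[y in LHS]opprK psumB// -[- y]sub0r psumB// psum0// sub0r opprK.
Qed.

(** The faces with predecessor and minimum still satisfy the simplicial identities, also at the two
    ends where a face is repeated. *)
Lemma psum_psum n p p1 p2 (x : V p p) : (p < p1)%N -> (p1 < p2)%N ->
  psum n.+1 p2 (psum n p1 x) = 0.
Proof.
move=> pp1 p12; pose f j i := R p2 p2 (bump j.-1 \o bump i.-1)
  (bump (minn j n.+2) \o bump (minn i n.+1)) x.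
transitivity (asum n.+4 (fun j => asum n.+3 (fun i => f j i))).
  apply: eq_asum => j _; rewrite (R_asum ax); [|emb_tac..].
  by apply: eq_asum => i _; rewrite (R_comp ax)//; emb_tac.
by apply: asum_asum => i j ij jk; apply: (R_ext ax) => // l _ /=; nat_tac.
Qed.

(* The first two terms cancel, and so do the last two: the pentagonal differential
   repeats a face there. *)
Lemma psum_interior n p p1 p2 (x : V p p) : (p < p1)%N -> (p1 < p2)%N ->
  psum n.+1 p2 (R p1 p1 (bump n.+1) (bump 0) x) =
  R p2 p2 (bump n.+2) (bump 0) (asum n (fun i => R p1 p1 (bump i.+1) (bump i.+1) x)).
Proof.
move=> pp1 p12; rewrite (R_asum ax); [|emb_tac..].
rewrite /psum asum_interior.
- apply: eq_asum => i ik; face_tac ax.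
- face_tac ax.
- face_tac ax.
Qed.

(* Modulo coboundaries a cocycle is made independent first of column 0, then of row
   n+1; what remains is contracted in the interior rows and columns. *)
Lemma psum_strip_left n p p0 p1 (x : V p p) : p = p0.+1 -> p1 = p.+1 -> (n < p0)%N ->
  psum n.+1 p1 x = 0 -> exists (y : V p0 p0) (g : V p p0),
  x = psum n p y + R p p id (bump 0) g.
Proof.
(* Row 0 comes first because the terms $k=0$ and $k=1$ both omit it. The base point lies in the last
   row and the last column, which no term omits since $n<p_0$. *)
move=> pE p1E np0 x0; near ae => g; pose y : V p0 p := insv p0 0 p0 p g x.
have v0 : insv p 0 p p1 g (0 : V p1 p1) = 0 by near: g; exact: (insv0 ax).
have vs : insv p 0 p p1 g (psum n.+1 p1 x) = asum n.+4
    (fun k => insv p 0 p p1 g (R p1 p1 (bump k.-1) (bump (minn k n.+2)) x)).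
  by near: g; apply: (insv_asum ax).
have v1 : insv p 0 p p1 g (R p1 p1 (bump 0) (bump 0) x) = R p p1 id (bump 0) x.
  by near: g; apply: (insv_skip ax) => //; emb_tac.
have v2 : insv p 0 p p1 g (R p1 p1 (bump 0) (bump 1) x) = R p p1 id (bump 1) x.
  by near: g; apply: (insv_skip ax) => //; emb_tac.
have v3 (i : 'I_n.+2) : insv p 0 p p1 g (R p1 p1 (bump i.+1) (bump (minn i.+2 n.+2)) x) =
    R p p1 (bump i) (bump (minn i.+2 n.+2)) y.
  rewrite /y; move: i; near: g; apply: filter_forall => i; have := ltn_ord i => i2.
  by apply: (insv_R ax) => //; try emb_tac; nat_tac.
rewrite x0 v0 in vs.
near ae => h.
pose z : V p0 p0 := insu p0 0 p0 p0 h y; pose w : V p p0 := insu p0 0 p p0 h x.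
have u0 : insu p 0 p p h (0 : V p p1) = 0 by near: h; exact: (insu0 ax).
have us : insu p 0 p p h (asum n.+4 (fun k => insv p 0 p p1 g
      (R p1 p1 (bump k.-1) (bump (minn k n.+2)) x))) = asum n.+4
    (fun k => insu p 0 p p h (insv p 0 p p1 g (R p1 p1 (bump k.-1) (bump (minn k n.+2)) x))).
  by near: h; apply: (insu_asum ax).
have u1 : insu p 0 p p h (R p p1 id (bump 0) x) = x.
  by rewrite -[RHS](R_id ax); near: h; apply: (insu_skip ax).
have u2 : insu p 0 p p h (R p p1 id (bump 1) x) = R p p id (bump 0) w.
  by rewrite /w; near: h; apply: (insu_R ax) => //; try emb_tac; nat_tac.
have u3 (i : 'I_n.+2) : insu p 0 p p h (R p p1 (bump i) (bump (minn i.+2 n.+2)) y) =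
    R p p (bump i) (bump (minn i.+1 n.+1)) z.
  rewrite /z; move: i; near: h; apply: filter_forall => i; have := ltn_ord i => i2.
  by apply: (insu_R ax) => //; try emb_tac; nat_tac.
(* The sum of the terms in [z] is, up to sign, [psum n p z] without its term $k=0$. That term omits
   column 0, as does the term in [w], and the two together form [g]. *)
exists z, (w - R p p0 (bump 0) id z).
move: us; rewrite -vs u0 2!asum_recl /= v1 v2 u1 u2.
rewrite (eq_asum (g := fun i => R p p (bump i) (bump (minn i.+1 n.+1)) z)); last first.
  by move=> i i2; rewrite (v3 (Ordinal i2)) (u3 (Ordinal i2)).
move=> /esym/eqP; rewrite subr_eq0 => /eqP ->.
rewrite (R_B ax) ?(R_comp ax)//; [|emb_tac..].
rewrite -[R p p (id \o _) _ _]/(R p p (bump 0) (bump 0) z) /psum [asum n.+3 _]asum_recl /=.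
by rewrite [RHS]addrC addrA subrK.
Unshelve. all: by end_near. Qed.

Lemma psum_strip_right n p p0 pm p1 (x : V p p) (g0 : V p p0) :
  p0 = pm.+1 -> p = p0.+1 -> p1 = p.+1 -> (n < p0)%N ->
  x = R p p id (bump 0) g0 -> psum n.+1 p1 x = 0 ->
  exists y f : V p0 p0, x = psum n p y + R p p (bump n.+1) (bump 0) f.
Proof.
move=> p0E pE p1E np0 xE x0; near ae => g.
pose w0 : V p0 p0 := insv p0 n.+1 p0 p0 g g0.
pose w : V p0 p := insv p0 n.+1 p0 p g x.
(* Setting a row commutes with omitting column 0, so independence of column 0 passes from [x] to
   [w], and below to [z]. *)
have wE : w = R p0 p id (bump 0) w0.
  rewrite /w /w0 xE; near: g; apply: (insv_R ax) => //; try emb_tac; nat_tac.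
have v0 : insv p n.+2 p p1 g (0 : V p1 p1) = 0 by near: g; apply: (insv0 ax) => //; lia.
have vs : insv p n.+2 p p1 g (psum n.+1 p1 x) = asum n.+4
    (fun k => insv p n.+2 p p1 g (R p1 p1 (bump k.-1) (bump (minn k n.+2)) x)).
  by near: g; apply: (insv_asum ax) => //; lia.
have v1 : insv p n.+2 p p1 g (R p1 p1 (bump n.+2) (bump n.+2) x) = R p p1 id (bump n.+2) x.
  by near: g; apply: (insv_skip ax) => //; try emb_tac; lia.
have v2 : insv p n.+2 p p1 g (R p1 p1 (bump n.+1) (bump n.+2) x) =
    R p p1 (bump n.+1) (bump n.+2) w.
  by rewrite /w; near: g; apply: (insv_R ax) => //; try emb_tac; nat_tac.
have v3 (i : 'I_n.+2) : insv p n.+2 p p1 g (R p1 p1 (bump i.-1) (bump (minn i n.+2)) x) =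
    R p p1 (bump i.-1) (bump i) w.
  rewrite /w; move: i; near: g; apply: filter_forall => i; have := ltn_ord i => i2.
  rewrite (_ : minn i n.+2 = i); last lia.
  by apply: (insv_R ax) => //; try emb_tac; nat_tac.
rewrite x0 v0 in vs.
near ae => h.
pose z0 : V p0 pm := insu pm n p0 pm h w0.
pose z : V p0 p0 := insu p0 n.+1 p0 p0 h w.
have zE : z = R p0 p0 id (bump 0) z0.
  rewrite /z /z0 wE; near: h; apply: (insu_R ax) => //; try emb_tac; nat_tac.
have u0 : insu p n.+2 p p h (0 : V p p1) = 0 by near: h; apply: (insu0 ax) => //; lia.
have us : insu p n.+2 p p h (asum n.+4 (fun k => insv p n.+2 p p1 g
      (R p1 p1 (bump k.-1) (bump (minn k n.+2)) x))) = asum n.+4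
    (fun k => insu p n.+2 p p h (insv p n.+2 p p1 g
      (R p1 p1 (bump k.-1) (bump (minn k n.+2)) x))).
  by near: h; apply: (insu_asum ax) => //; lia.
have u1 : insu p n.+2 p p h (R p p1 id (bump n.+2) x) = x.
  by rewrite -[RHS](R_id ax); near: h; apply: (insu_skip ax) => //; try emb_tac; lia.
have u2 : insu p n.+2 p p h (R p p1 (bump n.+1) (bump n.+2) w) = R p p (bump n.+1) id w.
  by near: h; apply: (insu_skip ax) => //; try emb_tac; lia.
have u3 (i : 'I_n.+2) : insu p n.+2 p p h (R p p1 (bump i.-1) (bump i) w) =
    R p p (bump i.-1) (bump i) z.
  rewrite /z; move: i; near: h; apply: filter_forall => i; have := ltn_ord i => i2.
  by apply: (insu_R ax) => //; try emb_tac; nat_tac.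
(* Here the sum of the terms in [z] is [psum n p z] without its last term. That term and the one in
   [w] both omit row $n+1$ and are independent of column 0, so they combine into [f]. The face
   [bump n] on [z0] is the face $n+1$ on [z], renumbered after column 0 is dropped. *)
exists (- altsgn n.+1 z), (w0 - R p0 p0 id (bump n) z0).
move: us; rewrite -vs u0 2!asum_recr.
rewrite (_ : minn n.+2 n.+2 = n.+2); last lia.
rewrite (_ : minn n.+3 n.+2 = n.+2); last lia.
rewrite v1 v2 u1 u2 (eq_asum (g := fun i => R p p (bump i.-1) (bump (minn i n.+1)) z)); last first.
  move=> i i2; rewrite (v3 (Ordinal i2)) (u3 (Ordinal i2)).
  by rewrite (_ : minn i n.+1 = i)//; lia.
have -> : psum n p (- altsgn n.+1 z) = - altsgn n.+1 (psum n p z).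
  rewrite /psum -asum_altsgn -asumN; apply: eq_asum => i _.
  by rewrite (RN ax) ?(R_altsgn ax)//; emb_tac.
rewrite {1}/psum [X in _ = - altsgn _ X + _]asum_recr.
rewrite (_ : minn n.+2 n.+1 = n.+1); last lia.
have -> : R p p (bump n.+1) (bump 0) (w0 - R p0 p0 id (bump n) z0) =
    R p p (bump n.+1) id w - R p p (bump n.+1) (bump n.+1) z.
  rewrite wE zE (R_B ax); [|emb_tac..].
  by congr (_ - _); face_tac ax.
rewrite !(altsgnS n.+2) !(altsgnS n.+1) opprK.
set S := asum _ _; set P := R p p _ id w; set B := R p p _ _ z => E.
have -> : x = P - altsgn n.+1 S.
  apply: (inv_inj (altsgnK n.+1)); rewrite altsgnB altsgnK.
  by apply/eqP; rewrite eq_sym subr_eq eq_sym addrC -subr_eq0 addrAC -E.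
by rewrite altsgnB altsgnK opprB [RHS]addrC addrA subrK.
Unshelve. all: by end_near. Qed.

(** By [psum_interior] the pentagonal differential reduces here to an ordinary alternating sum in
    which row and column $i+1$ are omitted together. Setting row 1 and column 1 contracts it, with
    base point $y_{00}$, which the interior faces keep. *)
Lemma psum_strip_interior n p pm p1 p2 (f : V p p) :
  p = pm.+1 -> p1 = p.+1 -> p2 = p1.+1 -> (n < p)%N ->
  psum n.+2 p2 (R p1 p1 (bump n.+2) (bump 0) f) = 0 ->
  exists y : V p p, R p1 p1 (bump n.+2) (bump 0) f = psum n.+1 p1 y.
Proof.
move=> pE p1E p2E np; rewrite psum_interior; [|lia..].
set a := asum _ _ => a0.
have {}a0 : a = 0.
  apply: (R_vface_inj ax p2E (i := n.+3)); first by rewrite p2E p1E; lia.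
  apply: (R_hface_inj ax p2E (leq0n _)); rewrite -[RHS]a0.
  face_tac ax.
near ae => g; pose x1 : V pm p := insv pm 1 0 0 g f.
have v0 : insv p 1 0 0 g (0 : V p1 p1) = 0 by near: g; apply: (insv0 ax) => //; lia.
have vs : insv p 1 0 0 g a = asum n.+1
    (fun i => insv p 1 0 0 g (R p1 p1 (bump i.+1) (bump i.+1) f)).
  by near: g; apply: (insv_asum ax) => //; lia.
have v1 : insv p 1 0 0 g (R p1 p1 (bump 1) (bump 1) f) = R p p1 id (bump 1) f.
  by near: g; apply: (insv_skip ax) => //; try emb_tac; lia.
have v2 (i : 'I_n) : insv p 1 0 0 g (R p1 p1 (bump i.+2) (bump i.+2) f) =
    R p p1 (bump i.+1) (bump i.+2) x1.
  rewrite /x1; move: i; near: g; apply: filter_forall => i.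
  by apply: (insv_R ax) => //; try emb_tac; nat_tac.
rewrite a0 v0 in vs.
near ae => h; pose y : V pm pm := insu pm 1 0 0 h x1.
have u0 : insu p 1 0 0 h (0 : V p p1) = 0 by near: h; apply: (insu0 ax) => //; lia.
have us : insu p 1 0 0 h (asum n.+1 (fun i => insv p 1 0 0 g
      (R p1 p1 (bump i.+1) (bump i.+1) f))) = asum n.+1
    (fun i => insu p 1 0 0 h (insv p 1 0 0 g (R p1 p1 (bump i.+1) (bump i.+1) f))).
  by near: h; apply: (insu_asum ax) => //; lia.
have u1 : insu p 1 0 0 h (R p p1 id (bump 1) f) = f.
  by rewrite -[RHS](R_id ax); near: h; apply: (insu_skip ax) => //; lia.
have u2 (i : 'I_n) : insu p 1 0 0 h (R p p1 (bump i.+1) (bump i.+2) x1) =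
    R p p (bump i.+1) (bump i.+1) y.
  rewrite /y; move: i; near: h; apply: filter_forall => i.
  by apply: (insu_R ax) => //; try emb_tac; nat_tac.
exists (R p p (bump n.+1) (bump 0) y); rewrite psum_interior; [|lia..].
congr R; move: us; rewrite -vs u0 asum_recl v1 u1 => /esym/eqP.
rewrite subr_eq0 => /eqP ->; apply: eq_asum => i ik.
by rewrite (v2 (Ordinal ik)) (u2 (Ordinal ik)).
Unshelve. all: by end_near. Qed.

(** For [n = 0] the remainder [c] is not contracted. It is the source of the second summand of
    $E^0$, on which the pentagonal differential is $d^h_0d^v_1$. For positive [n] the remainder is a
    cocycle and is contracted in the interior. *)
Lemma psum_exact m n (x : V (m + n.+1) (m + n.+1)) : (0 < m)%N ->
  psum n.+1 (m + n.+2) x = 0 ->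
  if n is n'.+1 then exists y : V (m + n) (m + n), x = psum n _ y
  else exists a c : V m m, x = psum 0 _ a + R _ _ (bump 1) (bump 0) c.
Proof.
move=> m0 x0.
have red p0 : p0 = (m + n)%N -> exists y f : V p0 p0,
    x = psum n _ y + R _ _ (bump n.+1) (bump 0) f.
  move=> p0E; have [|||y [g xE]] := psum_strip_left (p0 := p0) _ _ _ x0; try lia.
  pose x' := x - psum n _ y.
  have x'0 : psum n.+1 (m + n.+2) x' = 0.
    by rewrite /x' psumB ?x0 ?psum_psum ?subrr//; lia.
  have x'E : x' = R _ _ id (bump 0) g by rewrite /x' xE addrC addKr.
  have [||||y' [f fE]] := psum_strip_right (pm := p0.-1) _ _ _ _ x'E x'0; try lia.
  exists (y + y'), f; rewrite psumD -?addrA -?fE /x'; last lia.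
  by rewrite addrC subrK.
case: n x x0 red => [|n] x x0 red; first by apply: red; lia.
have [y [f xE]] := red _ erefl.
have f0 : psum n.+2 (m + n.+3) (R (m + n.+2) (m + n.+2) (bump n.+2) (bump 0) f) = 0.
  have -> : R _ _ (bump n.+2) (bump 0) f = x - psum n.+1 _ y by rewrite xE addrC addKr.
  by rewrite psumB ?x0 ?psum_psum ?subrr//; lia.
have [||||y' fE] := psum_strip_interior (pm := (m + n)%N) _ _ _ _ f0; try lia.
by exists (y + y'); rewrite xE fE psumD//; lia.
Qed.

End PentagonalExactness.

(** * Staircase and mapping cone *)

Section Staircase.
Variables (M : nat -> nat -> zmodType) (d : forall m n, M m n -> M m n.+1)
  (del : forall m n, M m n -> M m.+1 n).
Hypothesis dB : forall m n, zmod_morphism (@d m n).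
Hypothesis delB : forall m n, zmod_morphism (@del m n).
Hypothesis dd : forall m n (x : M m n), d (d x) = 0.
Hypothesis deldel : forall m n (x : M m n), del (del x) = 0.
Hypothesis ddel : forall m n (x : M m n), d (del x) = del (d x).
Hypothesis row_exact : forall m n (x : M m.+1 n.+1), d x = 0 -> exists y, x = d y.
Hypothesis row_inj : forall m (x : M m.+1 0), d x = 0 -> x = 0.
Hypothesis col_inj : forall n (x : M 0 n), del x = 0 -> x = 0.
Hypothesis col_exact : forall m n (x : M m.+1 n), del x = 0 -> exists y, x = del y.

(** A primitive [y] of [x] along the row need not be killed by [del], but [del y] is closed in both
    senses and one degree lower. By induction it is [d w] with [del w = 0], so [w = del w'], and
    [y - d w'] is the corrected primitive. The descent ends in degree 0, where [d] is injective. *)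
Lemma staircase_step n m (x : M m.+1 n.+1) : del x = 0 -> d x = 0 ->
  exists y, del y = 0 /\ x = d y.
Proof.
elim: n m x => [|n IH] m x delx dx; have [y xE] := row_exact dx.
  by exists y; split=> //; apply: row_inj; rewrite ddel -xE.
have [||w [delw yE]] := IH m.+1 (del y); rewrite ?deldel ?ddel -?xE//.
have [w' wE] := col_exact delw.
exists (y - d w'); split; first by rewrite delB -ddel -wE yE subrr.
by rewrite dB dd subr0.
Qed.

(** Row 0 is the one about which nothing is known beforehand: [x] is pushed to row 1 by [del],
    solved there with a [del]-closed primitive, and brought back by exactness of the columns. *)
Lemma staircase n (x : M 0 n.+1) : d x = 0 -> exists y, x = d y.
Proof.
move=> dx; have [||y [dely xE]] := staircase_step (x := del x).
- exact: deldel.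
- by rewrite ddel dx -(subrr 0) delB subrr.
have [y' yE] := col_exact dely.
exists y'; apply/eqP; rewrite -subr_eq0; apply/eqP/col_inj.
by rewrite delB -ddel -yE xE subrr.
Qed.
End Staircase.

Section Cone.
Variables (C E : nat -> nat -> zmodType).
Variables (cd : forall m n, C m n -> C m n.+1) (ed : forall m n, E m n -> E m n.+1).
Variable T : forall m n, C m n -> E m n.
Variables (cdel : forall m n, C m n -> C m.+1 n) (edel : forall m n, E m n -> E m.+1 n).
Hypothesis cdB : forall m n, zmod_morphism (@cd m n).
Hypothesis edB : forall m n, zmod_morphism (@ed m n).
Hypothesis TB : forall m n, zmod_morphism (@T m n).
Hypothesis cdelB : forall m n, zmod_morphism (@cdel m n).
Hypothesis edelB : forall m n, zmod_morphism (@edel m n).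
Hypothesis cdcd : forall m n (x : C m n), cd (cd x) = 0.
Hypothesis eded : forall m n (x : E m n), ed (ed x) = 0.
Hypothesis edT : forall m n (x : C m n), ed (T x) = T (cd x).
Hypothesis cdeldel : forall m n (x : C m n), cdel (cdel x) = 0.
Hypothesis edeldel : forall m n (x : E m n), edel (edel x) = 0.
Hypothesis cdcdel : forall m n (x : C m n), cd (cdel x) = cdel (cd x).
Hypothesis ededel : forall m n (x : E m n), ed (edel x) = edel (ed x).
Hypothesis Tdel : forall m n (x : C m n), T (cdel x) = edel (T x).
Hypothesis C_exact : forall m n (x : C m.+1 n.+1), cd x = 0 -> exists y, x = cd y.
Hypothesis E_exact : forall m n (x : E m.+1 n.+1), ed x = 0 -> exists y, x = ed y.
Hypothesis T0_inj : forall m (x : C m 0), T x = 0 -> x = 0.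
Hypothesis T0_surj : forall m (x : E m 0), ed x = 0 -> exists2 y, cd y = 0 & x = T y.
Hypothesis C_col_inj : forall n (x : C 0 n), cdel x = 0 -> x = 0.
Hypothesis E_col_inj : forall n (x : E 0 n), edel x = 0 -> x = 0.
Hypothesis C_col_exact : forall m n (x : C m.+1 n), cdel x = 0 -> exists y, x = cdel y.
Hypothesis E_col_exact : forall m n (x : E m.+1 n), edel x = 0 -> exists y, x = edel y.

Let f0 (X Y : zmodType) (f : X -> Y) : zmod_morphism f -> f 0 = 0.
Proof. by move=> fB; rewrite -(subrr 0) fB subrr. Qed.

(** The second factor is shifted by one degree. A pair $(c,e)$ is closed when $dc=0$ and $Tc=de$, so
    exactness gives injectivity of $T$ on classes; applied to $(0,e)$ it gives surjectivity. *)
Definition cone m n : zmodType := if n is n'.+1 then (C m n * E m n')%type else C m 0.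

Definition cone_d m n : cone m n -> cone m n.+1 :=
  match n return cone m n -> cone m n.+1 with
  | 0 => fun c => (cd c, T c)
  | n'.+1 => fun ce => (cd ce.1, T ce.1 - ed ce.2)
  end.

Definition cone_del m n : cone m n -> cone m.+1 n :=
  match n return cone m n -> cone m.+1 n with
  | 0 => fun c => cdel c
  | n'.+1 => fun ce => (cdel ce.1, edel ce.2)
  end.

Lemma cone_dB m n : zmod_morphism (@cone_d m n).
Proof.
case: n => [|n] x y; rewrite /cone_d; congr (_, _); rewrite /= ?cdB ?TB ?edB//.
by rewrite !opprD !opprK addrACA.
Qed.

Lemma cone_delB m n : zmod_morphism (@cone_del m n).
Proof.
by case: n => [|n] x y; rewrite /cone_del; [rewrite cdelB|congr (_, _); rewrite ?cdelB ?edelB].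
Qed.

Lemma cone_dd m n (x : cone m n) : cone_d (cone_d x) = 0.
Proof.
case: n x => [|n] x; congr (_, _); rewrite /= ?cdcd ?edT ?subrr//.
by rewrite edB eded subr0 edT subrr.
Qed.

Lemma cone_deldel m n (x : cone m n) : cone_del (cone_del x) = 0.
Proof. by case: n x => [|n] x; [exact: cdeldel|congr (_, _); rewrite ?cdeldel ?edeldel]. Qed.

Lemma cone_ddel m n (x : cone m n) : cone_d (cone_del x) = cone_del (cone_d x).
Proof.
by case: n x => [|n] x; congr (_, _); rewrite /= ?cdcdel ?Tdel ?ededel ?edelB.
Qed.

Lemma cone_row_inj m (x : cone m 0) : cone_d x = 0 -> x = 0.
Proof. by case=> _ /T0_inj. Qed.

Lemma cone_row_exact m n (x : cone m.+1 n.+1) : cone_d x = 0 -> exists y, x = cone_d y.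
Proof.
case: x => c e [/C_exact [c' cE] /eqP]; rewrite /= subr_eq0 => /eqP Tc.
(* In degree 0 this closed element is [T a] with [a] closed, and [c'] is replaced by $c'+a$; in
   positive degree it is a coboundary and supplies the second component. *)
have : ed (e - T c') = 0 by rewrite edB -Tc edT -cE subrr.
case: n c e c' cE {Tc} => [|n] c e c' cE.
  move=> /T0_surj [a a0 eE]; exists (c' - (- a) : C m.+1 0); congr (_, _) => /=.
    by rewrite cdB -[- a]sub0r cdB f0// a0 !subr0.
  by rewrite TB -[- a]sub0r TB f0// -eE sub0r opprK addrC subrK.
move=> /E_exact [e' eE]; exists (c', - e'); congr (_, _) => //=.
by rewrite -[- e']sub0r edB f0// -eE sub0r opprK addrC subrK.
Qed.

Lemma cone_col_inj n (x : cone 0 n) : cone_del x = 0 -> x = 0.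
Proof.
case: n x => [|n] /= x; first exact: C_col_inj.
by case: x => c e [/C_col_inj -> /E_col_inj ->].
Qed.

Lemma cone_col_exact m n (x : cone m.+1 n) : cone_del x = 0 -> exists y, x = cone_del y.
Proof.
case: n x => [|n] /= x; first exact: C_col_exact.
case: x => c e [/C_col_exact [c' ->] /E_col_exact [e' ->]].
by exists (c', e').
Qed.

Lemma cone_exact n (x : cone 0 n.+1) : cone_d x = 0 -> exists y, x = cone_d y.
Proof.
apply: (staircase cone_dB cone_delB cone_dd cone_deldel cone_ddel cone_row_exact
  (fun m => @cone_row_inj m.+1) cone_col_inj cone_col_exact).
Qed.

Lemma cone_surj n (e : E 0 n.+1) : ed e = 0 ->
  exists (c : C 0 n.+1) (e' : E 0 n), cd c = 0 /\ e = T c + ed e'.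
Proof.
move=> e0; have [|[c e'] [c0 eE]] := @cone_exact n.+1 (0, e).
  by congr (_, _); rewrite /= f0// e0 subrr.
exists c, (- e'); split; first by rewrite -c0.
by rewrite eE -[- e']sub0r edB f0// sub0r.
Qed.

Lemma cone_inj n (c : C 0 n.+1) (e : E 0 n) : cd c = 0 -> T c = ed e ->
  exists c', c = cd c'.
Proof.
move=> c0 Tc; have [|y] := @cone_exact n (c, e).
  by congr (_, _); rewrite /= ?c0// Tc subrr.
by case: n c e c0 Tc y => [|n] c e c0 Tc y [-> _]; [exists y|exists y.1].
Qed.

End Cone.

(** * Comparison of the two complexes *)

Section Comparison.
Context (V : nat -> nat -> zmodType) (Om : Type) (ae : set_system Om) {aeF : ProperFilter ae}.
Variable R : forall (p q : nat) {p' q' : nat}, (nat -> nat) -> (nat -> nat) -> V p' q' -> V p q.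
Variable Su : forall (p q : nat) {q' : nat}, nat -> nat -> Om -> V p q' -> V p q.
Variable Sv : forall (p q : nat) {p' : nat}, nat -> nat -> Om -> V p' q -> V p q.
Arguments R p q {p' q'} _ _ _.
Hypothesis ax : specialization_axioms ae (@R) (@Su) (@Sv).
Local Notation insu := (insu (@R) (@Su)).
Local Notation insv := (insv (@R) (@Sv)).
Local Notation hsum := (hsum (@R)).
Local Notation vsum := (vsum (@R)).
Local Notation psum := (psum (@R)).
Let tax := specialization_transpose ax.

(** The numbers [a] and [b] are the indices of the first inert row and column. Omitting them in
    pairs lets the single number [m] count both. *)
Definition dsum m a b p q p' q' (x : V p q) : V p' q' :=
  asum m (fun j => R p' q' (bump (a + j)) (bump (b + j)) x).
Arguments dsum m a b {p q} p' q' x.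

Lemma dsumB m a b p q p' q' (x y : V p q) : (p < p')%N -> (q < q')%N ->
  dsum m a b p' q' (x - y) = dsum m a b p' q' x - dsum m a b p' q' y.
Proof.
move=> pp' qq'; rewrite /dsum -asumB; apply: eq_asum => i _.
by rewrite (R_B ax)//; emb_tac.
Qed.

Lemma dsum_zero m a b p q p' q' : (p < p')%N -> (q < q')%N ->
  dsum m a b p' q' (0 : V p q) = 0.
Proof. by move=> pp' qq'; rewrite -(subrr 0) dsumB// subrr. Qed.

Lemma dsumD m a b p q p' q' (x y : V p q) : (p < p')%N -> (q < q')%N ->
  dsum m a b p' q' (x + y) = dsum m a b p' q' x + dsum m a b p' q' y.
Proof.
move=> pp' qq'; rewrite -[y in LHS]opprK dsumB// -[- y]sub0r dsumB// dsum_zero//.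
by rewrite sub0r opprK.
Qed.

Lemma hsumD k p q q' (x y : V p q) : (q < q')%N ->
  hsum k q' (x + y) = hsum k q' x + hsum k q' y.
Proof.
move=> qq'; rewrite -[y in LHS]opprK (hsumB ax)// -[- y]sub0r (hsumB ax)//.
by rewrite (hsum0 ax)// sub0r opprK.
Qed.

Lemma dsum_dsum m a b p q p1 q1 p2 q2 (x : V p q) :
  (p < p1)%N -> (p1 < p2)%N -> (q < q1)%N -> (q1 < q2)%N ->
  dsum m.+1 a b p2 q2 (dsum m a b p1 q1 x) = 0.
Proof.
move=> pp1 p12 qq1 q12; pose f j i := R p2 q2 (bump (a + j) \o bump (a + i))
  (bump (b + j) \o bump (b + i)) x.
transitivity (asum m.+1 (fun j => asum m (fun i => f j i))).
  apply: eq_asum => j _; rewrite (R_asum ax); [|emb_tac..].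
  by apply: eq_asum => i _; rewrite (R_comp ax)//; emb_tac.
by apply: asum_asum => i j ij jk; apply: (R_ext ax) => // l _ /=; nat_tac.
Qed.

Lemma dsum_inj a b p q p1 q1 (x : V p q) : p1 = p.+1 -> q1 = q.+1 ->
  (a <= p1)%N -> (b <= q1)%N -> dsum 1 a b p1 q1 x = 0 -> x = 0.
Proof.
move=> p1E q1E ap bq; rewrite /dsum asum_recl asum0 subr0 !addn0 => x0.
apply: (R_vface_inj ax p1E ap); apply: (R_hface_inj ax q1E bq).
rewrite -[RHS]x0; face_tac ax.
Qed.

(** The roles are exchanged: the rows and columns of the cochain itself now stay fixed. As $a,b>0$,
    row 0 and column 0 are among them, and the first inert pair is specialized with base point
    $y_{00}$. *)
Lemma dsum_exact m a b p q p1 q1 p2 q2 (x : V p1 q1) :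
  p1 = p.+1 -> q1 = q.+1 -> p2 = p1.+1 -> q2 = q1.+1 ->
  (0 < a)%N -> (0 < b)%N -> (a <= p1)%N -> (b <= q1)%N ->
  dsum m.+2 a b p2 q2 x = 0 -> exists y : V p q, x = dsum m.+1 a b p1 q1 y.
Proof.
move=> p1E q1E p2E q2E a0 b0 ap bq x0.
near ae => g; pose x1 : V p q1 := insv p a 0 0 g x.
have v0 : insv p1 a 0 0 g (0 : V p2 q2) = 0 by near: g; apply: (insv0 ax) => //; lia.
have vs : insv p1 a 0 0 g (dsum m.+2 a b p2 q2 x) = asum m.+2
    (fun i => insv p1 a 0 0 g (R p2 q2 (bump (a + i)) (bump (b + i)) x)).
  by near: g; apply: (insv_asum ax) => //; lia.
have v1 : insv p1 a 0 0 g (R p2 q2 (bump (a + 0)) (bump (b + 0)) x) = R p1 q2 id (bump b) x.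
  by rewrite !addn0; near: g; apply: (insv_skip ax) => //; try emb_tac; lia.
have v2 (i : 'I_m.+1) : insv p1 a 0 0 g (R p2 q2 (bump (a + i.+1)) (bump (b + i.+1)) x) =
    R p1 q2 (bump (a + i)) (bump (b + i.+1)) x1.
  rewrite /x1; move: i; near: g; apply: filter_forall => i.
  by apply: (insv_R ax) => //; try emb_tac; nat_tac.
rewrite x0 v0 in vs.
near ae => h; pose y : V p q := insu q b 0 0 h x1.
have u0 : insu q1 b 0 0 h (0 : V p1 q2) = 0 by near: h; apply: (insu0 ax) => //; lia.
have us : insu q1 b 0 0 h (asum m.+2 (fun i => insv p1 a 0 0 g
      (R p2 q2 (bump (a + i)) (bump (b + i)) x))) = asum m.+2
    (fun i => insu q1 b 0 0 h (insv p1 a 0 0 g (R p2 q2 (bump (a + i)) (bump (b + i)) x))).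
  by near: h; apply: (insu_asum ax) => //; lia.
have u1 : insu q1 b 0 0 h (R p1 q2 id (bump b) x) = x.
  by rewrite -[RHS](R_id ax); near: h; apply: (insu_skip ax) => //; lia.
have u2 (i : 'I_m.+1) : insu q1 b 0 0 h (R p1 q2 (bump (a + i)) (bump (b + i.+1)) x1) =
    R p1 q1 (bump (a + i)) (bump (b + i)) y.
  rewrite /y; move: i; near: h; apply: filter_forall => i.
  by apply: (insu_R ax) => //; try emb_tac; nat_tac.
exists y; move: us; rewrite -vs u0 asum_recl v1 u1 => /esym/eqP.
rewrite subr_eq0 => /eqP xE; rewrite [LHS]xE; apply: eq_asum => i ik.
by rewrite (v2 (Ordinal ik)) (u2 (Ordinal ik)).
Unshelve. all: by end_near. Qed.

Lemma hsum_dsum k m a b p q p1 q1 q2 q3 (x : V p q) : (p < p1)%N -> (q < q1)%N ->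
  (q1 < q2)%N -> (q < q3)%N -> (q3 < q2)%N -> (k <= b.+1)%N ->
  hsum k q2 (dsum m a b p1 q1 x) = dsum m a b.+1 p1 q2 (hsum k q3 x).
Proof.
move=> pp1 qq1 q12 qq3 q32 kb; rewrite /hsum /dsum.
transitivity (asum k (fun i => asum m (fun j =>
  R p1 q2 (bump (a + j)) (bump i \o bump (b + j)) x))).
  apply: eq_asum => i _; rewrite (R_asum ax); [|emb_tac..].
  by apply: eq_asum => j _; rewrite (R_comp ax)//; emb_tac.
rewrite asum_exch; apply: eq_asum => j _; rewrite (R_asum ax); [|emb_tac..].
apply: eq_asum => i ik; rewrite (R_comp ax)//; [|emb_tac..].
by apply: (R_ext ax) => //= l _; nat_tac.
Qed.

Lemma vsum_dsum k m a b p q p1 q1 p2 p3 (x : V p q) : (p < p1)%N -> (q < q1)%N ->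
  (p1 < p2)%N -> (p < p3)%N -> (p3 < p2)%N -> (k <= a.+1)%N ->
  vsum k p2 (dsum m a b p1 q1 x) = dsum m a.+1 b p2 q1 (vsum k p3 x).
Proof.
move=> pp1 qq1 p12 pp3 p32 kb; rewrite /vsum /dsum.
transitivity (asum k (fun i => asum m (fun j =>
  R p2 q1 (bump i \o bump (a + j)) (bump (b + j)) x))).
  apply: eq_asum => i _; rewrite (R_asum ax); [|emb_tac..].
  by apply: eq_asum => j _; rewrite (R_comp ax)//; emb_tac.
rewrite asum_exch; apply: eq_asum => j _; rewrite (R_asum ax); [|emb_tac..].
apply: eq_asum => i ik; rewrite (R_comp ax)//; [|emb_tac..].
by apply: (R_ext ax) => //= l _; nat_tac.
Qed.

Lemma psum_dsum n m p p1 p2 p3 (x : V p p) : (p < p1)%N -> (p1 < p2)%N ->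
  (p < p3)%N -> (p3 < p2)%N ->
  psum n p2 (dsum m n.+1 n.+1 p1 p1 x) = dsum m n.+2 n.+2 p2 p2 (psum n p3 x).
Proof.
move=> pp1 p12 pp3 p32; rewrite /psum /dsum.
transitivity (asum n.+3 (fun i => asum m (fun j =>
  R p2 p2 (bump i.-1 \o bump (n.+1 + j)) (bump (minn i n.+1) \o bump (n.+1 + j)) x))).
  apply: eq_asum => i _; rewrite (R_asum ax); [|emb_tac..].
  by apply: eq_asum => j _; rewrite (R_comp ax)//; emb_tac.
rewrite asum_exch; apply: eq_asum => j _; rewrite (R_asum ax); [|emb_tac..].
by apply: eq_asum => i ik; face_tac ax.
Qed.

Lemma dsum_altsgn k m a b p q p1 q1 (x : V p q) : (p < p1)%N -> (q < q1)%N ->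
  dsum m a b p1 q1 (altsgn k x) = altsgn k (dsum m a b p1 q1 x).
Proof.
move=> pp' qq'; rewrite /dsum -asum_altsgn; apply: eq_asum => i _.
by rewrite (R_altsgn ax)//; emb_tac.
Qed.

(* The component of T on L(Gamma_{k+1-q,q+1}); columns with index above q+1 are
   inert. *)
Definition corner_col k q x := if (x < q.+2)%N then x else (x + (k - q))%N.
Definition tcorner k q p' (p0 q0 : nat) (x : V p0 q0) : V p' p' :=
  R p' p' (addn q) (corner_col k q) x.
Arguments tcorner k q p' {p0 q0} x.

(** Apart from the inert part, [tcorner k q] reads rows from $q$ on and columns up to $q+1$. In the
    pentagonal sum the terms $l\le q+1$ omit a row that is not read and act as horizontal faces $l$;
    the terms $l\ge q+2$ omit a column that is not read and act as vertical faces $l-q-1\ge1$. The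
    missing horizontal face $q+2$ and vertical face 0 become equal after [tcorner] and have opposite
    signs, so both may be added. *)
Lemma psum_tcorner m p q k p0 q0 (x : V p0 q0) : k = (p + q)%N ->
  p0 = (m + p.+1)%N -> q0 = (m + q.+1)%N ->
  psum k.+1 (m + k.+2) (tcorner k q (m + k.+1) x) =
  tcorner k.+1 q.+1 (m + k.+2) (hsum q.+3 (m + q.+2) x) +
  tcorner k.+1 q (m + k.+2) (altsgn q.+1 (vsum p.+3 (m + p.+2) x)).
Proof.
move=> kE p0E q0E; subst p0 q0.
have embR r s t : (s + r <= t)%N -> emb r t (addn s).
  by move=> h; split=> [?|? ?]; lia.
have embC r s t : (s <= r)%N -> t = (m + r.+1)%N -> emb (m + s.+1) t (corner_col r s).
  by move=> sr ->; rewrite /corner_col; emb_tac.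
rewrite /psum /tcorner (_ : k.+4 = (q.+2 + p.+2)%N); last lia.
rewrite asum_split.
have -> : asum q.+2 (fun l => R (m + k.+2) (m + k.+2) (bump l.-1) (bump (minn l k.+2))
      (R (m + k.+1) (m + k.+1) (addn q) (corner_col k q) x)) =
    R (m + k.+2) (m + k.+2) (addn q.+1) (corner_col k.+1 q.+1) (hsum q.+2 (m + q.+2) x).
  rewrite [RHS](R_asum ax); [|by apply: embR; lia|by apply: embC; lia].
  apply: eq_asum => l lq; rewrite !(R_comp ax); first last.
  all: try by [emb_tac | apply: embR; lia | apply: embC; lia].
  by apply: (R_ext ax) => j _; rewrite /= /corner_col; nat_tac.
have -> : asum p.+2 (fun i => R (m + k.+2) (m + k.+2) (bump (q.+2 + i).-1)
      (bump (minn (q.+2 + i) k.+2))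
      (R (m + k.+1) (m + k.+1) (addn q) (corner_col k q) x)) =
    R (m + k.+2) (m + k.+2) (addn q) (corner_col k.+1 q)
      (R (m + p.+2) (m + q.+1) (bump 0) id x - vsum p.+3 (m + p.+2) x).
  rewrite /vsum [asum p.+3 _]asum_recl opprB addrC subrK.
  rewrite [RHS](R_asum ax); [|by apply: embR; lia|by apply: embC; lia].
  apply: eq_asum => l lq; rewrite !(R_comp ax); first last.
  all: try by [emb_tac | apply: embR; lia | apply: embC; lia].
  by apply: (R_ext ax) => j jm; rewrite /= /corner_col; nat_tac.
rewrite (R_B ax); [|by apply: embR; lia|by apply: embC; lia].
rewrite /hsum [asum q.+3 _]asum_recr (RD ax); [|by apply: embR; lia|by apply: embC; lia].
rewrite altsgnB !(R_altsgn ax); try by [apply: embR; lia|apply: embC; lia].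
rewrite -addrA; congr (_ + _); rewrite !(altsgnS q.+1) !(altsgnS q) opprK.
rewrite addrC [RHS]addrC; congr (_ + _).
  rewrite opprK; congr altsgn; rewrite !(R_comp ax); first last.
  all: try by [emb_tac | apply: embR; lia | apply: embC; lia].
  by apply: (R_ext ax) => j jm; rewrite /= /corner_col; nat_tac.
by rewrite opprK.
Qed.

Definition kac_cochains m n : zmodType :=
  if n is k.+1 then antidiag_sum k (fun p q => V (m + p.+1) (m + q.+1)) else V m m.

Definition pent_cochains m n : zmodType :=
  if n is k.+1 then V (m + k.+1) (m + k.+1) else (V m m * V m m)%type.

(** Cochains take a proof of $p+q=k$ as an argument. Extension by zero turns them into a [kfam] and
    avoids transports along such proofs. *)
Definition extend0 m k (F : kac_cochains m k.+1) :
    kfam V m :=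
  fun p q => match @eqP _ (p + q)%N k with
             | ReflectT e => F p q e
             | ReflectF _ => 0
             end.

Lemma extend0E m k (F : kac_cochains m k.+1) p q
  (e : (p + q)%N = k) : extend0 F p q = F p q e.
Proof. by rewrite /extend0; case: eqP => // e'; congr F; exact: eq_irrelevance. Qed.

Lemma extend0_out m k (F : kac_cochains m k.+1) p q :
  (p + q)%N <> k -> extend0 F p q = 0.
Proof. by rewrite /extend0; case: eqP. Qed.

Lemma antidiagP m k (F H : kac_cochains m k.+1) :
  (forall p q, (p + q)%N = k -> extend0 F p q = extend0 H p q) -> F = H.
Proof.
move=> FH; apply: functional_extensionality_dep => p.
apply: functional_extensionality_dep => q; apply: functional_extensionality_dep => e.
by rewrite -!extend0E; exact: FH.
Qed.

Lemma extend0B m k (F H : kac_cochains m k.+1) p q :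
  extend0 (F - H) p q = extend0 F p q - extend0 H p q.
Proof.
have [e|ne] := eqVneq (p + q)%N k; first by rewrite !extend0E.
by rewrite !extend0_out ?subr0//; exact/eqP.
Qed.

Lemma extend0_0 m k p q :
  extend0 (0 : kac_cochains m k.+1) p q = 0.
Proof. by rewrite -(subrr 0) extend0B subrr. Qed.

Lemma kd_eq m k (f f' : kfam V m) : (forall p q, (p + q)%N = k -> f p q = f' p q) ->
  forall p q, (p + q)%N = k.+1 -> kd (@R) f p q = kd (@R) f' p q.
Proof.
move=> ff' p q pq; rewrite /kd /kdh /kdv; congr (_ + _).
  by case: q pq => // q pq; rewrite ff'//; lia.
by case: p pq => // p pq; rewrite ff'//; lia.
Qed.

Definition kac_diff m n : kac_cochains m n -> kac_cochains m n.+1 :=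
  match n return kac_cochains m n -> kac_cochains m n.+1 with
  | 0 => fun a p q _ =>
      match p, q return V (m + p.+1) (m + q.+1) with
      | 0, 0 => hsum 2 _ (vsum 2 _ a)
      | _, _ => 0
      end
  | k.+1 => fun F p q _ => kd (@R) (extend0 F) p q
  end.

Definition pent_diff m n : pent_cochains m n -> pent_cochains m n.+1 :=
  match n return pent_cochains m n -> pent_cochains m n.+1 with
  | 0 => fun ab => hsum 2 _ (vsum 2 _ ab.1) + R _ _ (bump 1) (bump 0) ab.2
  | k.+1 => fun x => psum k.+1 _ x
  end.

Definition comparison m n : kac_cochains m n -> pent_cochains m n :=
  match n return kac_cochains m n -> pent_cochains m n with
  | 0 => fun a => (a, 0)
  | k.+1 => fun F => \sum_(i < k.+1) tcorner k i _ (extend0 F (k - i)%N i)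
  end.

(* Alternating sum over the omission of one of the m+1 pairs of an inert row and an
   inert column. *)
Definition kac_inert m n : kac_cochains m n -> kac_cochains m.+1 n :=
  match n return kac_cochains m n -> kac_cochains m.+1 n with
  | 0 => fun a => dsum m.+1 1 1 _ _ a
  | k.+1 => fun F p q e => dsum m.+1 p.+2 q.+2 _ _ (F p q e)
  end.

Definition pent_inert m n : pent_cochains m n -> pent_cochains m.+1 n :=
  match n return pent_cochains m n -> pent_cochains m.+1 n with
  | 0 => fun ab => (dsum m.+1 1 1 _ _ ab.1, dsum m.+1 1 1 _ _ ab.2)
  | k.+1 => fun x => dsum m.+1 k.+2 k.+2 _ _ x
  end.

Lemma extend0_kac_diff m k (F : kac_cochains m k.+1) p q : (p + q)%N = k.+1 ->
  extend0 (kac_diff F) p q = kd (@R) (extend0 F) p q.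
Proof. by move=> e; rewrite extend0E. Qed.

Lemma extend0_kac_inert m k (F : kac_cochains m k.+1) p q : (p + q)%N = k ->
  extend0 (kac_inert F) p q = dsum m.+1 p.+2 q.+2 _ _ (extend0 F p q).
Proof. by move=> e; rewrite !extend0E. Qed.

Lemma kac_diffB m n : zmod_morphism (@kac_diff m n).
Proof.
case: n => [|k] F H; last first.
  apply: antidiagP => p q e; rewrite extend0B !extend0_kac_diff//.
  rewrite -(kdB ax); apply: (kd_eq (k := k)) => // p' q' e'.
  by rewrite extend0B.
apply: (@antidiagP m 0) => -[|p] [|q] // e; rewrite extend0B !extend0E /=.
by rewrite (vsumB ax) ?(hsumB ax)//; lia.
Qed.

Lemma pent_diffB m n : zmod_morphism (@pent_diff m n).
Proof.
case: n => [|k] x y /=; last by rewrite (psumB ax)//; lia.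
rewrite (vsumB ax) ?(hsumB ax) ?(R_B ax); try by [lia|emb_tac].
by rewrite opprD addrACA.
Qed.

Lemma tcornerB m p q k p0 q0 (x y : V p0 q0) : k = (p + q)%N ->
  p0 = (m + p.+1)%N -> q0 = (m + q.+1)%N ->
  tcorner k q (m + k.+1) (x - y) = tcorner k q (m + k.+1) x - tcorner k q (m + k.+1) y.
Proof.
move=> kE p0E q0E; subst k p0 q0; rewrite /tcorner (R_B ax)//.
  by split=> [?|? ?]; lia.
by rewrite /corner_col; emb_tac.
Qed.

Lemma tcorner0 m p q k p0 q0 : k = (p + q)%N ->
  p0 = (m + p.+1)%N -> q0 = (m + q.+1)%N -> tcorner k q (m + k.+1) (0 : V p0 q0) = 0.
Proof. by move=> kE p0E q0E; rewrite -(subrr 0) (tcornerB (p := p))// subrr. Qed.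

Lemma comparisonB m n : zmod_morphism (@comparison m n).
Proof.
case: n => [|k] F H; first by congr (_, _); rewrite subrr.
rewrite /= -sumrB; apply: eq_bigr => i _.
by rewrite extend0B (tcornerB (p := (k - i)%N))//; have := ltn_ord i; lia.
Qed.

Lemma kac_inertB m n : zmod_morphism (@kac_inert m n).
Proof.
case: n => [|k] F H; first by rewrite /= dsumB//; lia.
apply: antidiagP => p q e; rewrite extend0B !extend0_kac_inert// extend0B.
by rewrite dsumB//; lia.
Qed.

Lemma pent_inertB m n : zmod_morphism (@pent_inert m n).
Proof.
by case: n => [|k] x y; [congr (_, _)|]; rewrite /= dsumB//; lia.
Qed.

Lemma kac_diff_diff m n (x : kac_cochains m n) : kac_diff (kac_diff x) = 0.
Proof.
case: n x => [|k] x; last first.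
  apply: antidiagP => p q e; rewrite extend0_0 extend0_kac_diff//.
  rewrite (kd_eq (k := k.+1) (f' := kd (@R) (extend0 x)))// ?(kdd ax)// => *.
  by rewrite extend0_kac_diff.
apply: (@antidiagP m 1) => p q e; rewrite extend0_0 extend0_kac_diff//.
case: p q e => [|[|p]] [|[|q]] // e; rewrite /kd /= ?add0r ?addr0 extend0E//=.
  by rewrite (hsum_hsum ax)//; lia.
by rewrite (hsum_vsum ax) ?(vsum_vsum ax) ?raddf0//; lia.
Qed.

Lemma hsum_vsumE p p' (a : V p p) : (p < p')%N -> hsum 2 p' (vsum 2 p' a) =
  psum 0 p' a - R p' p' (bump 1) (bump 0) a.
Proof.
move=> pp'; rewrite /hsum /vsum /psum !asum_recl !asum0 !subr0 /=.
rewrite !(R_B ax); try by emb_tac.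
rewrite !(R_comp ax); try by emb_tac.
exact: addrAC.
Qed.

(** The four-term differential of $a$ is the three-term pentagonal sum minus the face that acts on
    $b$. In the coordinates $(a,b-a)$ the degree 0 differential thus takes the form found in
    [psum_exact]. *)
Lemma pent_diff0E m (ab : pent_cochains m 0) :
  pent_diff ab = psum 0 _ ab.1 + R _ _ (bump 1) (bump 0) (ab.2 - ab.1).
Proof.
case: ab => a b; rewrite /pent_diff [fst _]/= [snd _]/= hsum_vsumE; last by rewrite addn1.
rewrite (R_B ax); [|by emb_tac..].
by rewrite -addrA [- _ + _]addrC.
Qed.

Lemma pent_diff_diff m n (x : pent_cochains m n) : pent_diff (pent_diff x) = 0.
Proof.
case: n x => [|k] x; last by rewrite /= (psum_psum ax)//; lia.
rewrite pent_diff0E /= (psumD ax) ?(psum_psum ax) ?(psum_interior ax); try lia.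
by rewrite asum0 (R0 ax) ?addr0//; emb_tac.
Qed.

Lemma pent_diff_comparison m n (F : kac_cochains m n) :
  pent_diff (comparison F) = comparison (kac_diff F).
Proof.
case: n F => [|k] F.
  rewrite /= big_ord1 extend0E //= (R0 ax) ?addr0; try by emb_tac.
  rewrite /tcorner -[LHS](R_id ax); apply: (R_ext ax) => // j jm.
  by rewrite /corner_col; nat_tac.
pose S (f : kfam V m) := \sum_(i < k.+2) tcorner k.+1 i (m + k.+2) (f (k.+1 - i)%N i).
have tB : forall i : 'I_k.+2, zmod_morphism
  (@tcorner k.+1 i (m + k.+2) (m + (k.+1 - i).+1) (m + i.+1)).
  by move=> i x y; rewrite (tcornerB (p := (k.+1 - i)%N))//; have := ltn_ord i; lia.
have -> : comparison (kac_diff F) = S (kdh (@R) (extend0 F)) + S (kdv (@R) (extend0 F)).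
  rewrite /comparison /S -big_split; apply: eq_bigr => i _ /=.
  rewrite extend0_kac_diff ?/kd; last by have := ltn_ord i; lia.
  by rewrite /tcorner (RD ax); [|split=> [?|? ?]; have := ltn_ord i; lia|
    rewrite /corner_col; have := ltn_ord i => ?; emb_tac].
have -> : S (kdh (@R) (extend0 F)) = \sum_(i < k.+1)
    tcorner k.+1 i.+1 (m + k.+2) (hsum i.+3 (m + i.+2) (extend0 F (k - i)%N i)).
  rewrite /S big_ord_recl [X in X + _](_ : _ = 0) ?add0r//.
  by rewrite (tcorner0 (p := k.+1))// addn0.
have -> : S (kdv (@R) (extend0 F)) = \sum_(i < k.+1)
    tcorner k.+1 i (m + k.+2)
      (altsgn i.+1 (vsum (k - i).+3 (m + (k - i).+2) (extend0 F (k - i)%N i))).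
  rewrite /S big_ord_recr /= [X in _ + X](_ : _ = 0) ?addr0.
    apply: eq_bigr => i _ /=; have := ltn_ord i => ik.
    have : (k.+1 - i)%N = (k - i).+1 by lia.
    by move: (k.+1 - i)%N => p pE; subst p.
  have : (k.+1 - k.+1)%N = 0%N by lia.
  by move: (k.+1 - k.+1)%N => p pE; subst p; rewrite /= (tcorner0 (p := 0)).
have pD : {morph (fun x : V (m + k.+1) (m + k.+1) => psum k.+1 (m + k.+2) x) :
    x y / x + y >-> x + y} by move=> x y; rewrite (psumD ax)//; lia.
have p0 : psum k.+1 (m + k.+2) (0 : V (m + k.+1) (m + k.+1)) = 0.
  by rewrite (psum0 ax)//; lia.
rewrite -big_split /= [LHS](big_morph _ pD p0).
by apply: eq_bigr => i _ /=; apply: psum_tcorner => //; have := ltn_ord i; lia.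
Qed.

Lemma kac_inert_inert m n (x : kac_cochains m n) : kac_inert (kac_inert x) = 0.
Proof.
case: n x => [|k] x; first by rewrite /= dsum_dsum//; lia.
apply: antidiagP => p q e; rewrite extend0_0 !extend0_kac_inert//.
by rewrite dsum_dsum//; lia.
Qed.

Lemma pent_inert_inert m n (x : pent_cochains m n) : pent_inert (pent_inert x) = 0.
Proof.
by case: n x => [|k] x; [congr (_, _)|]; rewrite /= dsum_dsum//; lia.
Qed.

Lemma kac_diff_inert m n (x : kac_cochains m n) :
  kac_diff (kac_inert x) = kac_inert (kac_diff x).
Proof.
case: n x => [|k] x.
  apply: (@antidiagP m.+1 0) => -[|p] [|q] // e.
  rewrite (@extend0_kac_inert m 0)// !extend0E /=.
  by rewrite (vsum_dsum _ _ (p3 := (m + 1)%N)) ?(hsum_dsum _ _ (q3 := (m + 1)%N))//; lia.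
apply: antidiagP => p q e; rewrite extend0_kac_inert// !extend0_kac_diff//.
rewrite (kd_eq (k := k) (f' := fun p q => dsum m.+1 p.+2 q.+2 _ _ (extend0 x p q)))//; last first.
  by move=> *; rewrite extend0_kac_inert.
rewrite /kd dsumD; try lia.
congr (_ + _).
  case: q e => [|q] e /=; first by rewrite dsum_zero//; lia.
  by rewrite (hsum_dsum _ _ (q3 := (m + q.+2)%N))//; lia.
case: p e => [|p] e /=; first by rewrite dsum_zero//; lia.
by rewrite (vsum_dsum _ _ (p3 := (m + p.+2)%N)) ?dsum_altsgn//; lia.
Qed.

Lemma pent_diff_inert m n (x : pent_cochains m n) :
  pent_diff (pent_inert x) = pent_inert (pent_diff x).
Proof.
case: n x => [|k] x /=; last by rewrite (psum_dsum _ _ (p3 := (m + k.+2)%N))//; lia.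
rewrite (vsum_dsum _ _ (p3 := (m + 1)%N)) ?(hsum_dsum _ _ (q3 := (m + 1)%N)); try lia.
rewrite dsumD; try lia.
congr (_ + _); rewrite /dsum !(R_asum ax); try by emb_tac.
by apply: eq_asum => i _; face_tac ax.
Qed.

Lemma comparison_inert m n (x : kac_cochains m n) :
  comparison (kac_inert x) = pent_inert (comparison x).
Proof.
case: n x => [|k] x; first by congr (_, _); rewrite /= dsum_zero//; lia.
have dD : {morph (fun y : V (m + k.+1) (m + k.+1) =>
    dsum m.+1 k.+2 k.+2 (m.+1 + k.+1) (m.+1 + k.+1) y) : y z / y + z >-> y + z}.
  by move=> y z; rewrite dsumD//; lia.
have d0 : dsum m.+1 k.+2 k.+2 (m.+1 + k.+1) (m.+1 + k.+1)
    (0 : V (m + k.+1) (m + k.+1)) = 0 by rewrite dsum_zero//; lia.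
rewrite /comparison /pent_inert [RHS](big_morph _ dD d0).
apply: eq_bigr => i _ /=; have := ltn_ord i => ik.
rewrite extend0_kac_inert; last lia.
rewrite /dsum /tcorner !(R_asum ax).
  apply: eq_asum => j jm; rewrite !(R_comp ax).
    by apply: (R_ext ax) => l lm; rewrite /= /corner_col; nat_tac.
all: by [emb_tac|split=> [?|? ?]; lia|rewrite /corner_col; emb_tac].
Qed.

Lemma kac_cochains_exact m n (x : kac_cochains m.+1 n.+1) : kac_diff x = 0 ->
  exists y, x = kac_diff y.
Proof.
move=> x0; have xc p q : (p + q = n.+1)%N -> kd (@R) (extend0 x) p q = 0.
  by move=> e; rewrite -extend0_kac_diff// x0 extend0_0.
have := kac_exact ax (ltn0Sn m) xc; case: n x x0 xc => [|n] x x0 xc.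
  move=> [a aE]; exists a; apply: (@antidiagP m.+1 0) => -[|p] [|q] // e.
  by rewrite aE extend0E.
move=> [h hE]; exists (fun p q _ => h p q); apply: antidiagP => p q e.
rewrite extend0_kac_diff// hE//; apply: (kd_eq (k := n)) => // p' q' e'.
by rewrite extend0E.
Qed.

Lemma pent_cochains_exact m n (x : pent_cochains m.+1 n.+1) : pent_diff x = 0 ->
  exists y, x = pent_diff y.
Proof.
case: n x => [|n] x x0; have := psum_exact ax (ltn0Sn m) x0.
  by move=> [a [c xE]]; exists (a, c + a); rewrite pent_diff0E /= addrK.
by move=> [y ->]; exists y.
Qed.

Lemma comparison0_inj m (x : kac_cochains m 0) : comparison x = 0 -> x = 0.
Proof. by case. Qed.

Lemma comparison0_surj m (x : pent_cochains m 0) : pent_diff x = 0 ->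
  exists2 y, kac_diff y = 0 & x = comparison y.
Proof.
case: x => a b ab0; have b0 : b = 0.
  apply: (R_vface_inj ax (p' := (m + 1)%N) (i := 1)); [lia..|].
  apply: (R_hface_inj ax (q' := (m + 1)%N) (i := 0)); [lia..|].
  apply: (R_hface_inj ax (q' := (m + 2)%N) (i := 2)); [lia..|].
  (* Applying [hsum 3] kills the part in [a]. Of the three faces of the part in [b], the first two
     coincide by a simplicial identity and cancel; the third is a composite of injective faces. *)
  have := congr1 (hsum 3 (m + 2)) ab0; rewrite (hsum0 ax); last lia.
  rewrite /= hsumD ?(hsum_hsum ax) ?add0r; try lia.
  move=> <-; rewrite /hsum !asum_recl asum0 subr0 opprB addrA addrAC.
  rewrite !(R_comp ax); try by emb_tac.
  rewrite [X in _ = X - _ + _](_ : _ = R (m + 1) (m + 2) (id \o bump 1) (bump 1 \o bump 0) b).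
    rewrite subrr add0r; apply: (R_ext ax) => //= l _; nat_tac.
  by apply: (R_ext ax) => //= l _; nat_tac.
exists a; rewrite ?b0//; apply: (@antidiagP m 0) => -[|p] [|q] // e.
by rewrite extend0E// extend0_0; move: ab0; rewrite b0 /= (R0 ax) ?addr0//; emb_tac.
Qed.

Lemma kac_inert_inj n (x : kac_cochains 0 n) : kac_inert x = 0 -> x = 0.
Proof.
case: n x => [|k] x x0; first exact: (dsum_inj _ _ _ _ x0).
apply: antidiagP => p q e; rewrite extend0_0.
apply: (@dsum_inj p.+2 q.+2 _ _ (1 + p.+1) (1 + q.+1)); [lia..|].
by rewrite -(extend0_kac_inert (m := 0))// x0 extend0_0.
Qed.

Lemma pent_inert_inj n (x : pent_cochains 0 n) : pent_inert x = 0 -> x = 0.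
Proof.
case: n x => [|k] x; last by apply: dsum_inj; lia.
by case: x => a b [/dsum_inj -> // /dsum_inj ->].
Qed.

Lemma kac_inert_exact m n (x : kac_cochains m.+1 n) : kac_inert x = 0 ->
  exists y, x = kac_inert y.
Proof.
case: n x => [|k] x x0; first by apply: dsum_exact x0.
have xE p q (e : (p + q)%N = k) : exists y : V (m + p.+1) (m + q.+1),
    x p q e = dsum m.+1 p.+2 q.+2 _ _ y.
  apply: (@dsum_exact m p.+2 q.+2 _ _ _ _ (m.+2 + p.+1) (m.+2 + q.+1)); [lia..|].
  by rewrite -(extend0E x) -extend0_kac_inert// x0 extend0_0.
exists (fun p q e => sval (cid (xE p q e))).
apply: antidiagP => p q e; rewrite extend0_kac_inert// !extend0E.
by case: cid.
Qed.

Lemma pent_inert_exact m n (x : pent_cochains m.+1 n) : pent_inert x = 0 ->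
  exists y, x = pent_inert y.
Proof.
case: n x => [|k] x; last by apply: dsum_exact; lia.
case: x => a b [a0 b0].
have [|||||||| a' ->] := @dsum_exact m 1 1 m m _ _ _ _ _ _ _ _ _ _ _ _ _ a0; try by [].
have [|||||||| b' ->] := @dsum_exact m 1 1 m m _ _ _ _ _ _ _ _ _ _ _ _ _ b0; try by [].
by exists (a', b').
Qed.

Lemma comparison_surj n (x : pent_cochains 0 n.+1) : pent_diff x = 0 ->
  exists (c : kac_cochains 0 n.+1) (y : pent_cochains 0 n),
    kac_diff c = 0 /\ x = comparison c + pent_diff y.
Proof.
exact: (cone_surj kac_diffB pent_diffB comparisonB kac_inertB pent_inertB
  kac_diff_diff pent_diff_diff pent_diff_comparison kac_inert_inert pent_inert_inert
  kac_diff_inert pent_diff_inert comparison_inert kac_cochains_exact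
  pent_cochains_exact comparison0_inj comparison0_surj kac_inert_inj pent_inert_inj
  kac_inert_exact pent_inert_exact).
Qed.

Lemma comparison_inj n (c : kac_cochains 0 n.+1) (y : pent_cochains 0 n) :
  kac_diff c = 0 -> comparison c = pent_diff y -> exists c', c = kac_diff c'.
Proof.
exact: (cone_inj kac_diffB pent_diffB comparisonB kac_inertB pent_inertB
  kac_diff_diff pent_diff_diff pent_diff_comparison kac_inert_inert pent_inert_inert
  kac_diff_inert pent_diff_inert comparison_inert kac_cochains_exact
  pent_cochains_exact comparison0_inj comparison0_surj kac_inert_inj pent_inert_inj
  kac_inert_exact pent_inert_exact).
Qed.

End Comparison.

(** * Borel maps and Haar measures *)

Section AlmostEverywhereFubini.
Context d1 d2 (T1 : measurableType d1) (T2 : measurableType d2) (R : realType).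

Lemma ae_xsection (m2 : {measure set T2 -> \bar R}) (A : set (T1 * T2)) x : measurable A ->
  {ae m2, forall y, A (x, y)} <-> m2 (xsection (~` A) x) = 0%E.
Proof.
move=> mA; have E : ~` [set y | A (x, y)] = xsection (~` A) x.
  by apply/seteqP; split=> y; rewrite /xsection /= in_setE.
rewrite -(negligibleP m2 (A := xsection (~` A) x)); last first.
  by apply: measurable_xsection; exact: measurableC.
by rewrite -E.
Qed.

Lemma ae_ysection (m1 : {measure set T1 -> \bar R}) (A : set (T1 * T2)) y : measurable A ->
  {ae m1, forall x, A (x, y)} <-> m1 (ysection (~` A) y) = 0%E.
Proof.
move=> mA; have E : ~` [set x | A (x, y)] = ysection (~` A) y.
  by apply/seteqP; split=> x; rewrite /ysection /= in_setE.
rewrite -(negligibleP m1 (A := ysection (~` A) y)); last first.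
  by apply: measurable_ysection; exact: measurableC.
by rewrite -E.
Qed.

Lemma measurable_ae (m2 : {sigma_finite_measure set T2 -> \bar R}) (A : set (T1 * T2)) :
  measurable A -> measurable [set x | {ae m2, forall y, A (x, y)}].
Proof.
move=> mA; rewrite (_ : [set x | _] = (m2 \o xsection (~` A)) @^-1` [set 0%E]).
  rewrite -[X in measurable X]setTI.
  by apply: measurable_fun_xsection => //; exact: measurableC.
by apply/seteqP; split=> x /=; rewrite ae_xsection.
Qed.

Variables (m1 : {sigma_finite_measure set T1 -> \bar R})
          (m2 : {sigma_finite_measure set T2 -> \bar R}).

Lemma integral_eq0_ae d (T : measurableType d) (m : {measure set T -> \bar R})
    (f : T -> \bar R) : measurable_fun setT f -> (forall x, 0 <= f x)%E ->
  (\int[m]_x f x = 0)%E <-> {ae m, forall x, f x = 0%E}.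
Proof.
move=> mf f0; have -> : (\int[m]_x f x = \int[m]_x `|f x|)%E.
  by apply: eq_integral => x _; rewrite gee0_abs.
split=> [/ae_eq_integral_abs|h]; last apply/ae_eq_integral_abs => //.
  by move=> /(_ measurableT mf); apply: filterS => x; exact.
by apply: filterS h => x h _.
Qed.

Lemma ae_product (A : set (T1 * T2)) : measurable A ->
  (m1 \x m2)%E (~` A) = 0%E <-> {ae m1, forall x, {ae m2, forall y, A (x, y)}}.
Proof.
move=> mA; rewrite /product_measure1 integral_eq0_ae//; last first.
  by apply: measurable_fun_xsection; exact: measurableC.
by split; apply: filterS => x; rewrite /= ae_xsection.
Qed.

(** Tonelli's theorem for the indicator of the complement: both sides say that its product measure
    is zero. *)
Lemma ae_swap (A : set (T1 * T2)) : measurable A ->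
  {ae m1, forall x, {ae m2, forall y, A (x, y)}} <->
  {ae m2, forall y, {ae m1, forall x, A (x, y)}}.
Proof.
move=> mA; have mCA := measurableC mA.
rewrite -ae_product// (_ : (m1 \x m2)%E (~` A) = (m1 \x^ m2)%E (~` A)); last first.
  by apply: product_measure_unique => //= ? ? ? ?; rewrite product_measure2E.
rewrite /product_measure2 integral_eq0_ae//; last exact: measurable_fun_ysection.
by split; apply: filterS => y; rewrite /= ae_ysection.
Qed.
End AlmostEverywhereFubini.

Lemma countable_base (Y : topologicalType) : @second_countable Y ->
  exists2 b : nat -> set Y, (forall n, open (b n)) &
    forall x (U : set Y), nbhs x U -> exists2 n, b n x & b n `<=` U.
Proof.
move=> [B cB [oB hB]].
have /countable_injP[c cinj] := cB.
exists (fun n => \bigcup_(U in [set U | B U /\ c U = n]) U).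
  by move=> n; apply: bigcup_open => U [/oB].
move=> x U /hB [V [BV Vx] VU]; exists (c V); first by exists V.
move=> y [W [BW cW] Wy]; apply: VU; rewrite -(cinj W V) ?inE//.
Qed.

Section MeasurableIntoTopological.
Context d (T : measurableType d).

Definition borel_measurable (Y : topologicalType) (f : T -> Y) : Prop :=
  forall U, open U -> measurable (f @^-1` U).

Lemma borel_measurable_preimage (Y : topologicalType) (f : T -> Y) (B : set Y) :
  borel_measurable f -> <<s @open Y >> B -> measurable (f @^-1` B).
Proof.
move=> bf; move: B.
apply: (@smallest_sub _ _ (@open Y) [set B | measurable (f @^-1` B)]) => //.
split.
- by rewrite /= preimage_set0.
- by move=> A /= hA; rewrite setTD preimage_setC; exact: measurableC.
- by move=> F hF /=; rewrite preimage_bigcup; exact: bigcupT_measurable.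
Qed.

Lemma borel_measurable_comp (Y Z : topologicalType) (f : T -> Y) (g : Y -> Z) :
  borel_measurable f -> borel_fun g -> borel_measurable (g \o f).
Proof. by move=> bf bg U /bg; exact: borel_measurable_preimage. Qed.

Lemma borel_measurable_pair (Y Z : topologicalType) (f : T -> Y) (g : T -> Z) :
  @second_countable Y -> @second_countable Z ->
  borel_measurable f -> borel_measurable g -> borel_measurable (fun x => (f x, g x)).
Proof.
move=> /countable_base[b ob bP] /countable_base[c oc cP] bf bg U oU.
pose F (ij : nat * nat) := if `[< b ij.1 `*` c ij.2 `<=` U >]
  then f @^-1` b ij.1 `&` g @^-1` c ij.2 else set0.
have -> : (fun x => (f x, g x)) @^-1` U = \bigcup_ij F ij.
  apply/seteqP; split=> [x /= Ux|x [[i j] _]]; last first.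
    by rewrite /F; case: asboolP => // bcU [/= fb gc]; exact: (bcU (f x, g x)).
  have : nbhs (f x, g x) U by exact: open_nbhs_nbhs.
  case=> -[/= P Q] [/bP [i bx bP'] /cP [j cx cQ]] PQU.
  exists (i, j) => //; rewrite /F; case: asboolP => //= -[] [y z] [/= by_ cz].
  by apply: PQU; split; [exact: bP'|exact: cQ].
apply: countable_bigcupT_measurable => [|[i j]]; first exact: countableP.
by rewrite /F; case: asboolP => // _; apply: measurableI; [exact: bf|exact: bg].
Qed.

Lemma borel_measurable_mx (Y : topologicalType) m n (f : T -> 'M[Y]_(m, n)) :
  @second_countable Y ->
  (forall i j, borel_measurable (fun x => f x i j)) -> borel_measurable f.
Proof.
move=> /countable_base[b ob bP] bf U oU.
pose box (k : {ffun 'I_m * 'I_n -> nat}) : set 'M[Y]_(m, n) :=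
  [set M | forall i j, b (k (i, j)) (M i j)].
pose F k := if `[< box k `<=` U >] then f @^-1` box k else set0.
have -> : f @^-1` U = \bigcup_k F k.
  apply/seteqP; split=> [x /= Ux|x [k _]]; last first.
    by rewrite /F; case: asboolP => // bU; exact: bU.
  have [P PM PU] : nbhs (f x) U by exact: open_nbhs_nbhs.
  have kE (ij : 'I_m * 'I_n) : exists k, b k (f x ij.1 ij.2) /\ b k `<=` P ij.1 ij.2.
    by have [k] := bP _ _ (PM ij.1 ij.2); exists k.
  pose k := [ffun ij => sval (cid (kE ij))].
  have kP i j : b (k (i, j)) (f x i j) /\ b (k (i, j)) `<=` P i j.
    by rewrite ffunE; case: cid.
  exists k => //; rewrite /F; case: asboolP => [_ i j|[]]; first exact: (kP i j).1.
  by move=> M Mk; apply: PU => i j; apply: (kP i j).2.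
apply: countable_bigcupT_measurable => [|k]; first exact: countableP.
rewrite /F; case: asboolP => // _.
rewrite (_ : f @^-1` box k = ~` \bigcup_(ij : 'I_m * 'I_n)
    ~` ((fun x => f x ij.1 ij.2) @^-1` b (k ij))).
  apply/measurableC/countable_bigcupT_measurable => [|[i j]]; first exact: countableP.
  by apply: measurableC; exact: bf.
apply/seteqP; split=> [x /= bx [[i j] _ /=]|x /= h i j]; first exact.
by apply: contrapT => nb; apply: h; exists (i, j).
Qed.

End MeasurableIntoTopological.

Section GroupMeasurability.
Context (G : lcscGroupType) d (T : measurableType d).
Implicit Types f g : T -> G.

Lemma borel_measurable_continuous_comp (Y : topologicalType) (X : topologicalType)
  (f : T -> X) (g : X -> Y) : borel_measurable f -> continuous g -> borel_measurable (g \o f).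
Proof. by move=> bf cg; apply: borel_measurable_comp bf _; exact: borel_fun_continuous. Qed.

Lemma borel_measurable_mulg f g : borel_measurable f -> borel_measurable g ->
  borel_measurable (fun x => (f x * g x)%g).
Proof.
move=> bf bg; apply: (borel_measurable_continuous_comp (X := (G * G)%type)
  (f := fun x => (f x, g x)) (g := fun z => (z.1 * z.2)%g)); last exact: mulg_continuous.
by apply: borel_measurable_pair => //; exact: lcsc_second_countable.
Qed.

Lemma borel_measurable_invg f : borel_measurable f ->
  borel_measurable (fun x => (f x)^-1%g).
Proof.
move=> bf; apply: (borel_measurable_continuous_comp (g := fun x => x^-1%g) bf).
exact: invg_continuous.
Qed.

Lemma borel_measurable_cst (Y : topologicalType) (y : Y) : borel_measurable (fun _ : T => y).
Proof. by move=> U _; rewrite preimage_cst; case: ifP. Qed.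

End GroupMeasurability.

Lemma borel_measurable_id (G : lcscGroupType) : borel_measurable (fun x : borel G => x : G).
Proof. by move=> U oU; exact: sub_gen_smallest. Qed.

Lemma borel_measurable_fun (G : lcscGroupType) d1 d2 (T1 : measurableType d1)
  (T2 : measurableType d2) (Y : topologicalType) (f : T1 -> T2) (g : T2 -> Y) :
  measurable_fun setT f -> borel_measurable g -> borel_measurable (g \o f).
Proof.
move=> mf bg U oU; rewrite comp_preimage -[X in measurable X]setTI.
by apply: mf => //; exact: bg.
Qed.

Lemma borel_measurable_fst (G : lcscGroupType) d (T : measurableType d) :
  borel_measurable (fun z : borel G * T => (z.1 : G)).
Proof. exact: borel_measurable_fun measurable_fst (@borel_measurable_id G). Qed.

Lemma borel_measurable_snd (G : lcscGroupType) d (T : measurableType d) :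
  borel_measurable (fun z : T * borel G => (z.2 : G)).
Proof. exact: borel_measurable_fun measurable_snd (@borel_measurable_id G). Qed.

Definition subgroupT (G : lcscGroupType) : closed_subgroup G :=
  @ClosedSubgroup G setT closedT I (fun _ _ _ _ => I) (fun _ _ => I).

#[global] Instance ae_borel_filter (R : realType) (G : lcscGroupType)
  (nu : {sigma_finite_measure set (borel G) -> \bar R}) : Filter (almost_everywhere nu).
Proof. exact: ae_filter_ringOfSetsType. Qed.

(** * Quasi-invariance of Haar measures *)

Section Haar.
Context (R : realType) (G : lcscGroupType) (H : closed_subgroup G)
  (nu : {sigma_finite_measure set (borel G) -> \bar R}).
Hypothesis haar : is_haar (csg_set H) nu.
Implicit Types D : set (borel G).

#[local] Instance haar_proper : ProperFilter (almost_everywhere nu).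
Proof.
apply: ae_properfilter_algebraOfSetsType.
by rewrite lt0e measure_ge0 andbT; apply/eqP; exact: (haar_neq0 haar).
Qed.

Lemma ae_haar_mem : {ae nu, forall x, csg_set H x}.
Proof.
apply/negligibleP; last exact: (haar_support haar).
apply: measurableC; rewrite -[X in measurable X]setCK; apply: measurableC.
by apply: sub_gen_smallest; apply: closed_openC; exact: csg_closed.
Qed.

Lemma ae_haar_ex (P : G -> Prop) : {ae nu, forall x, P x} -> exists2 x, csg_set H x & P x.
Proof. by move=> aeP; have [x []] := filter_ex (filterI ae_haar_mem aeP); exists x. Qed.

Let shiftl h D : csg_set H h -> measurable D ->
  {ae nu, forall x, D x} -> {ae nu, forall x, D (h * x)%g}.
Proof.
move=> Hh mD /negligibleP /= D0; apply/negligibleP.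
  apply: measurableC; apply: borel_measurable_preimage mD.
  by apply: borel_measurable_mulg; [exact: borel_measurable_cst|exact: borel_measurable_id].
exact: etrans (haar_left haar Hh (measurableC mD)) (D0 (measurableC mD)).
Qed.

Lemma ae_haar_mull h D : csg_set H h -> measurable D ->
  {ae nu, forall x, D (h * x)%g} <-> {ae nu, forall x, D x}.
Proof.
move=> Hh mD; split; last exact: shiftl.
have mDh : measurable [set x : borel G | D (h * x)%g].
  apply: borel_measurable_preimage mD.
  by apply: borel_measurable_mulg; [exact: borel_measurable_cst|exact: borel_measurable_id].
move=> /(shiftl (csg_inv Hh) mDh); apply: filterS => x.
by rewrite /= mulVKg.
Qed.

(** For each $b\in H$ the condition $b^{-1}a\in D$ holds for almost every $a$, by left invariance.
    Exchanging quantifiers, for some $a\in H$ it holds for almost every $b$, and replacing $b$ by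
    $ab$ turns $b^{-1}a$ into $b^{-1}$. *)
Let inv D : measurable D -> {ae nu, forall x, D x} -> {ae nu, forall x, D (x^-1)%g}.
Proof.
move=> mD aeD.
pose A := [set z : borel G * borel G | D (z.2^-1 * z.1)%g].
have mA : measurable A.
  apply: borel_measurable_preimage mD; apply: borel_measurable_mulg.
    by apply: borel_measurable_invg; exact: borel_measurable_snd.
  exact: borel_measurable_fst.
have : {ae nu, forall x, {ae nu, forall y, A (x, y)}}.
  apply/ae_swap => //; apply: filterS ae_haar_mem => b Hb.
  exact/(ae_haar_mull (csg_inv Hb) mD).
move=> /ae_haar_ex[a Ha aeA].
have mA' : measurable [set x : borel G | D (x^-1)%g].
  apply: borel_measurable_preimage mD; apply: borel_measurable_invg.
  exact: borel_measurable_id.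
apply/(ae_haar_mull (csg_inv Ha) mA'); apply: filterS aeA => b /=.
by rewrite invgM invgK.
Qed.

Lemma ae_haar_inv D : measurable D ->
  {ae nu, forall x, D (x^-1)%g} <-> {ae nu, forall x, D x}.
Proof.
move=> mD; split; last exact: inv.
have mDi : measurable [set x : borel G | D (x^-1)%g].
  apply: borel_measurable_preimage mD; apply: borel_measurable_invg.
  exact: borel_measurable_id.
by move=> /(inv mDi); apply: filterS => x; rewrite /= invgK.
Qed.

Lemma ae_haar_mulr h D : csg_set H h -> measurable D ->
  {ae nu, forall x, D (x * h)%g} <-> {ae nu, forall x, D x}.
Proof.
move=> Hh mD.
have mDi : measurable [set x : borel G | D (x^-1)%g].
  apply: borel_measurable_preimage mD; apply: borel_measurable_invg.
  exact: borel_measurable_id.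
have mDh : measurable [set x : borel G | D (x * h)%g].
  apply: borel_measurable_preimage mD; apply: borel_measurable_mulg.
    exact: borel_measurable_id.
  exact: borel_measurable_cst.
apply: (iff_trans (iff_sym (ae_haar_inv mDh))); apply: iff_trans (ae_haar_inv mD).
apply: iff_trans (ae_haar_mull (csg_inv Hh) mDi).
by split; apply: filterS => x /=; rewrite invgM invgK.
Qed.

End Haar.

(** * The Haar class of a matched pair as a product *)

Section MatchedPair.
Context (R : realType) (G : lcscGroupType) (G1 G2 : closed_subgroup G)
  (mu mu1 mu2 : {sigma_finite_measure set (borel G) -> \bar R}).
Hypotheses (mu_haar : is_haar [set: G] mu) (mu1_haar : is_haar (csg_set G1) mu1)
  (mu2_haar : is_haar (csg_set G2) mu2) (G12 : is_matched_pair mu G1 G2).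
Implicit Types D : set (borel G).

Let muT : is_haar (csg_set (subgroupT G)) mu := mu_haar.

Lemma ae_matched : {ae mu, forall g, exists x y, [/\ csg_set G1 x, csg_set G2 y & g = (x * y)%g]}.
Proof.
apply: negligibleS (mp_conull G12) => g /= ng [x G1x [y G2y xy]].
by apply: ng; exists x, y.
Qed.

(* Integrate over (x, g, y) in G1 * G * G2 the indicator of x g y, and use the
   quasi-invariance of all the measures. *)
Lemma ae_matched_product D : measurable D ->
  {ae mu, forall g, D g} <->
  {ae mu1, forall x, {ae mu2, forall y, D (x * y)%g}}.
Proof.
move=> mD.
pose A := [set z : (borel G * borel G) * borel G | D (z.1.1 * z.1.2 * z.2)%g].
have mA : measurable A.
  apply: borel_measurable_preimage mD; apply: borel_measurable_mulg; last first.
    exact: borel_measurable_snd.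
  apply: borel_measurable_mulg.
    exact: borel_measurable_fun measurable_fst (@borel_measurable_fst _ _ _).
  exact: borel_measurable_fun measurable_fst (@borel_measurable_snd _ _ _).
have mA2 := measurable_ae mu2 mA.
pose Ax x := [set z : borel G * borel G | D (x * z.1 * z.2)%g].
have mAx x : measurable (Ax x).
  apply: borel_measurable_preimage mD; apply: borel_measurable_mulg; last first.
    exact: borel_measurable_snd.
  apply: borel_measurable_mulg; first exact: borel_measurable_cst.
  exact: borel_measurable_fst.
have mD2 x y : measurable [set g : borel G | D (x * g * y)%g].
  apply: borel_measurable_preimage mD; apply: borel_measurable_mulg.
    by apply: borel_measurable_mulg; [exact: borel_measurable_cst|exact: borel_measurable_id].
  exact: borel_measurable_cst.
have shift x y : {ae mu, forall g, D (x * g * y)%g} <-> {ae mu, forall g, D g}.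
  have mDr : measurable [set g : borel G | D (g * y)%g].
    apply: borel_measurable_preimage mD; apply: borel_measurable_mulg.
      exact: borel_measurable_id.
    exact: borel_measurable_cst.
  exact: iff_trans (ae_haar_mull muT I mDr) (ae_haar_mulr muT I mD).
(* For $g=x_0y_0$ one has $xgy=(xx_0)(y_0y)$: a right translation in $G_1$ and a left translation in
   $G_2$. *)
have E g : (exists x y, [/\ csg_set G1 x, csg_set G2 y & g = (x * y)%g]) ->
    {ae mu1, forall x, {ae mu2, forall y, D (x * g * y)%g}} <->
    {ae mu1, forall x, {ae mu2, forall y, D (x * y)%g}}.
  move=> [x0 [y0 [G1x G2y ->]]].
  pose B := [set z : borel G * borel G | D (z.1 * z.2)%g].
  have mB : measurable B.
    apply: borel_measurable_preimage mD; apply: borel_measurable_mulg.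
      exact: borel_measurable_fst.
    exact: borel_measurable_snd.
  have mB2 := measurable_ae mu2 mB.
  apply: iff_trans (ae_haar_mulr mu1_haar G1x mB2).
  have mBx x : measurable [set y : borel G | D (x * x0 * y)%g].
    apply: borel_measurable_preimage mD; apply: borel_measurable_mulg.
      exact: borel_measurable_cst.
    exact: borel_measurable_id.
  have S x := ae_haar_mull mu2_haar G2y (mBx x).
  split; apply: filterS => x h.
    by apply: (S x).1; apply: filterS h => y; rewrite /= !mulgA.
  by have := (S x).2 h; apply: filterS => y; rewrite /= !mulgA.
split=> aeD.
  have : {ae mu, forall g, {ae mu1, forall x, {ae mu2, forall y, D (x * g * y)%g}}}.
    apply/(ae_swap mu1 mu mA2); apply: filterE => x.
    by apply/(ae_swap mu mu2 (mAx x)); apply: filterE => y; apply/shift.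
  by move=> /(filterI ae_matched)/(ae_haar_ex muT)[g _ [gE aeg]]; exact: (E _ gE).1 aeg.
have : {ae mu, forall g, {ae mu1, forall x, {ae mu2, forall y, D (x * g * y)%g}}}.
  by apply: filterS ae_matched => g gE; exact: (E _ gE).2 aeD.
move=> /(ae_swap mu1 mu mA2)/(ae_haar_ex mu1_haar)[x _].
by move=> /(ae_swap mu mu2 (mAx x))/(ae_haar_ex mu2_haar)[y _ /shift].
Qed.

(** Up to a null set $G/G_2$ is $G_1$: in the factorization $g=xy$ an invariant condition reads $x$
    alone. *)
Lemma ae_matched1 D : measurable D ->
  (forall x y, csg_set G2 y -> D (x * y)%g <-> D x) ->
  {ae mu, forall g, D g} <-> {ae mu1, forall x, D x}.
Proof.
move=> mD DG2; apply: iff_trans (ae_matched_product mD) _.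
split; apply: filterS => x.
  by move=> /(ae_haar_ex mu2_haar)[y /DG2 h /h].
by move=> Dx; apply: filterS (ae_haar_mem mu2_haar) => y /DG2 ->.
Qed.

(** The factorization puts $G_1$ on the left, so inversion is applied first to turn right invariance
    under $G_1$ into left invariance. *)
Lemma ae_matched2 D : measurable D ->
  (forall x y, csg_set G1 y -> D (x * y)%g <-> D x) ->
  {ae mu, forall g, D g} <-> {ae mu2, forall x, D x}.
Proof.
move=> mD DG1; have mDi : measurable [set x : borel G | D (x^-1)%g].
  apply: borel_measurable_preimage mD; apply: borel_measurable_invg.
  exact: borel_measurable_id.
apply: iff_trans (iff_sym (ae_haar_inv muT mD)) _.
apply: iff_trans (ae_matched_product mDi) _.
apply: iff_trans (ae_haar_inv mu2_haar mD).
have h x y : csg_set G1 x -> D ((x * y)^-1)%g <-> D (y^-1)%g.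
  by move=> G1x; rewrite invgM; apply: DG1; exact: csg_inv.
split=> [/(ae_haar_ex mu1_haar)[x G1x]|aeD].
  by apply: filterS => y; exact: (h x y G1x).1.
apply: filterS (ae_haar_mem mu1_haar) => x G1x.
by apply: filterS aeD => y; exact: (h x y G1x).2.
Qed.

End MatchedPair.

(** * Intersections of cosets *)

Section SigmaCompact.
Variable G : lcscGroupType.

Lemma sigma_compact :
  exists2 K : nat -> set G, (forall n, compact (K n)) & forall x, exists n, K n x.
Proof.
have [b ob bP] := countable_base (@lcsc_second_countable G).
pose K n := xget set0 [set K | b n `<=` K /\ compact K].
exists K => [n|x].
  by rewrite /K; case: xgetP => [L _ []//|_]; exact: compact0.
have [U xU [cU _]] := @lcsc_locally_compact G x I.
have xU' : nbhs x U.
  by apply: (@filterS _ (nbhs x) _ _ _ (fun y (h : setT y -> U y) => h I)); exact: xU.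
have [n bx bU] := bP x U xU'; exists n; rewrite /K.
case: xgetP => [L _ [bL _]|/(_ U)[]]; first exact: bL.
by split.
Qed.

(** A product of closed sets may fail to be closed, but it is a countable union of products of
    compact sets. *)
Lemma measurable_mul_closed (C1 C2 : set G) : closed C1 -> closed C2 ->
  measurable ([set (x * y)%g | x in C1 & y in C2] : set (borel G)).
Proof.
move=> c1 c2; have [K cK KT] := sigma_compact.
pose F (ij : nat * nat) : set (borel G) :=
  [set (z.1 * z.2)%g | z in (K ij.1 `&` C1) `*` (K ij.2 `&` C2)].
rewrite (_ : [set _ | _ in _ & _ in _] = \bigcup_ij F ij); last first.
  apply/seteqP; split=> [_ [x C1x [y C2y <-]]|_ [[i j] _ [[x y] [[/= _ C1x] [/= _ C2y]] <-]]].
    have [i Kx] := KT x; have [j Ky] := KT y.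
    by exists (i, j) => //; exists (x, y).
  by exists x => //; exists y.
apply: countable_bigcupT_measurable => [|[i j]]; first exact: countableP.
suff : closed (F (i, j)).
  move=> cF; rewrite -[F _]setCK; apply: measurableC.
  by apply: sub_gen_smallest; exact: closed_openC.
apply: compact_closed; first exact: lcsc_hausdorff.
apply: continuous_compact; first exact/continuous_subspaceT/mulg_continuous.
by apply: compact_setX; apply: compact_closedI.
Qed.

End SigmaCompact.

Section Intersection.
Context (G : lcscGroupType) (G1 G2 : closed_subgroup G).
Hypothesis G12 : (G1 : set G) `&` G2 = [set 1%g].

Definition product_set : set G := [set (x * y)%g | x in G2 & y in G1].

Definition left_factor (d : G) : G := xget 1%g [set b | csg_set G2 b /\ csg_set G1 (b^-1 * d)%g].

Lemma left_factorP d : product_set d ->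
  csg_set G2 (left_factor d) /\ csg_set G1 ((left_factor d)^-1 * d)%g.
Proof.
move=> [b G2b [a G1a <-]]; rewrite /left_factor; case: xgetP => [c _ //|/(_ b)[]].
by split=> //; rewrite mulKg.
Qed.

Lemma left_factor_uniq b a : csg_set G2 b -> csg_set G1 a -> left_factor (b * a)%g = b.
Proof.
move=> G2b G1a; have [|G2c G1c] := @left_factorP (b * a)%g; first by exists b => //; exists a.
set c := left_factor _ in G2c G1c *.
have : ((G1 : set G) `&` G2) (c^-1 * b)%g.
  split; last by apply: csg_mul => //; exact: csg_inv.
  have := csg_mul G1c (csg_inv G1a); congr (csg_set G1 _).
  by rewrite -!mulgA mulgV mulg1.
by rewrite G12 => /mulg1_eq; rewrite invgK.
Qed.

Lemma measurable_product_set : measurable (product_set : set (borel G)).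
Proof. by apply: measurable_mul_closed; exact: csg_closed. Qed.

(** For closed $C$, the points of $G_2G_1$ whose factor in $G_2$ lies in $C$ form the product
    $(G_2\cap C)G_1$ of two closed sets. The complement of $G_2G_1$ is added exactly when $C$
    contains the default value 1. *)
Lemma borel_measurable_left_factor : borel_measurable (left_factor : borel G -> G).
Proof.
suff cl (C : set G) : closed C -> measurable ((left_factor : borel G -> G) @^-1` C).
  move=> U oU; rewrite -[U]setCK -preimage_setC.
  by apply: measurableC; apply: cl; exact: open_closedC.
move=> cC; pose P : set (borel G) := [set (x * y)%g | x in G2 `&` C & y in G1].
have mP : measurable P.
  by apply: measurable_mul_closed; [apply: closedI => //|]; exact: csg_closed.
have -> : (left_factor : borel G -> G) @^-1` C =
    P `|` (if `[< C 1%g >] then ~` product_set else set0).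
  apply/seteqP; split=> [d /= Cd|d].
    have [Dd|nDd] := pselect (product_set d).
      left; have [G2b G1a] := left_factorP Dd.
      by exists (left_factor d) => //; exists ((left_factor d)^-1 * d)%g; rewrite // mulVKg.
    right; case: asboolP => // nC; exfalso; apply: nC; move: Cd.
    rewrite /left_factor; case: xgetP => // b _ [G2b G1a] _; case: nDd.
    by exists b => //; exists (b^-1 * d)%g; rewrite // mulVKg.
  move=> [[b [G2b Cb] [a G1a <-]]|]; first by rewrite /= left_factor_uniq.
  case: asboolP => // C1 nDd /=; rewrite /left_factor; case: xgetP => // b _ [G2b G1a].
  by case: nDd; exists b => //; exists (b^-1 * d)%g; rewrite // mulVKg.
apply: measurableU => //; case: asboolP => // _.
by apply: measurableC; exact: measurable_product_set.
Qed.

(* For (x, w) in a conull set, the point of intersection of the cosets x G1 and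
   w G2. *)
Definition crossing (x w : G) : G := (w * left_factor (w^-1 * x))%g.
Definition crossing_dom (x w : G) : Prop := product_set (w^-1 * x)%g.

Lemma crossingP x w : crossing_dom x w ->
  csg_set G1 (x^-1 * crossing x w)%g /\ csg_set G2 (w^-1 * crossing x w)%g.
Proof.
move=> /left_factorP[G2b G1a]; rewrite /crossing mulKg; split=> //.
by have := csg_inv G1a; rewrite !invgM !invgK mulgA.
Qed.

Lemma crossing_uniq x w k : csg_set G1 (x^-1 * k)%g -> csg_set G2 (w^-1 * k)%g ->
  crossing_dom x w /\ crossing x w = k.
Proof.
move=> G1k G2k; have E : (w^-1 * x = (w^-1 * k) * (x^-1 * k)^-1)%g.
  by rewrite invgM invgK -!mulgA mulVKg.
split.
  by rewrite /crossing_dom E; exists (w^-1 * k)%g => //; exists (x^-1 * k)^-1%g => //; exact: csg_inv.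
by rewrite /crossing E left_factor_uniq ?mulVKg//; exact: csg_inv.
Qed.

End Intersection.

(** * Iterated almost everywhere quantifiers *)

(* Coordinates: inl j stands for the column variable x_j, inr i for the row
   variable w_i. *)
Definition axis : eqType := (nat + nat)%type.

Section Configurations.
Context (G : lcscGroupType).

(** All configurations share one space with infinitely many coordinates, and each property reads
    finitely many of them ([depends_on]). Index maps then act by [pull] without change of space. *)
Definition cylinders : set (set (axis -> G)) :=
  [set C | exists i (B : set (borel G)), measurable B /\ C = [set z | B (z i)]].
Definition conf := g_sigma_algebraType cylinders.

Lemma borel_measurable_proj i : borel_measurable (fun z : conf => z i : G).
Proof.
move=> U oU; apply: sub_gen_smallest; exists i, U; split=> //.
exact: sub_gen_smallest.
Qed.

Lemma measurable_preimage_conf d (T : measurableType d) (f : T -> axis -> G)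
    (P : set conf) : (forall i, borel_measurable (fun t => f t i)) -> measurable P ->
  measurable [set t | P (f t)].
Proof.
move=> mf; move: P.
apply: (@smallest_sub _ _ cylinders [set P | measurable [set t | P (f t)]]) => //.
split.
- by rewrite /= (_ : [set t | _] = set0).
- move=> A /= mA; rewrite (_ : [set t | _] = ~` [set t | A (f t)]); first exact: measurableC.
  by apply/seteqP; split=> t; [case|].
- move=> F mF /=; rewrite (_ : [set t | _] = \bigcup_n [set t | F n (f t)]).
    exact: bigcupT_measurable.
  by apply/seteqP; split=> t [n _ ?]; exists n.
- move=> _ [i [B [mB ->]]] /=; exact: borel_measurable_preimage (mf i) mB.
Qed.

Definition upd (z : axis -> G) (i : axis) (x : G) : axis -> G :=
  fun j => if j == i then x else z j.

Lemma updE z i x : upd z i x i = x.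
Proof. by rewrite /upd eqxx. Qed.

Lemma upd_neq z i x j : j != i -> upd z i x j = z j.
Proof. by rewrite /upd => /negPf ->. Qed.

Lemma borel_measurable_upd i d (T : measurableType d) (f : T -> axis -> G) (g : T -> G) :
  (forall j, borel_measurable (fun t => f t j)) -> borel_measurable g ->
  forall j, borel_measurable (fun t => upd (f t) i (g t) j).
Proof. by move=> mf mg j; rewrite /upd; case: (j == i). Qed.

Definition pull (th : axis -> axis) (z : axis -> G) : axis -> G := fun i => z (th i).

Definition depends_on (S : seq axis) (P : set conf) : Prop :=
  forall z z', (forall i, i \in S -> z i = z' i) -> P z -> P z'.

Lemma depends_onP S P z z' : depends_on S P -> (forall i, i \in S -> z i = z' i) ->
  P z <-> P z'.
Proof. by move=> dP zz'; split; apply: dP => i iS; rewrite zz'. Qed.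

Section Quantifiers.
Variable R : realType.
Implicit Types nu : axis -> {sigma_finite_measure set (borel G) -> \bar R}.
Implicit Types (P : set conf) (s : seq axis).

Definition ae_at nu i P : set conf := [set z | {ae nu i, forall x, P (upd z i x)}].
Definition ae_all nu s P : set conf := foldr (ae_at nu) P s.

Lemma ae_at_measurable nu i P : measurable P -> measurable (ae_at nu i P).
Proof.
move=> mP; pose A := [set t : conf * borel G | P (upd t.1 i t.2)].
have mA : measurable A.
  apply: (measurable_preimage_conf (f := fun t : conf * borel G => upd t.1 i t.2)) => // j.
  apply: borel_measurable_upd; last exact: borel_measurable_snd.
  by move=> k; apply: borel_measurable_fun measurable_fst (@borel_measurable_proj k).
exact: (measurable_ae (nu i) mA).
Qed.

Lemma ae_all_measurable nu s P : measurable P -> measurable (ae_all nu s P).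
Proof. by move=> mP; elim: s => //= i s; exact: ae_at_measurable. Qed.

Lemma ae_at_mono nu i P P' : P `<=` P' -> ae_at nu i P `<=` ae_at nu i P'.
Proof. by move=> PP' z; apply: filterS => x; exact: PP'. Qed.

Lemma ae_all_mono nu s P P' : P `<=` P' -> ae_all nu s P `<=` ae_all nu s P'.
Proof. by move=> PP'; elim: s => //= i s; exact: ae_at_mono. Qed.

Lemma ae_all_cat nu s s' P : ae_all nu (s ++ s') P = ae_all nu s (ae_all nu s' P).
Proof. by rewrite /ae_all foldr_cat. Qed.

Lemma ae_allT nu s P : P = setT -> ae_all nu s P = setT.
Proof.
move=> ->; elim: s => //= i s ->; apply/seteqP; split=> // z _.
exact: filterE.
Qed.

Lemma ae_allI nu s P P' : ae_all nu s P `&` ae_all nu s P' `<=` ae_all nu s (P `&` P').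
Proof.
elim: s => //= i s IH z [Pz P'z].
by apply: filterS2 Pz P'z => x Px P'x; apply: IH.
Qed.

Lemma ae_at_comm nu i j P : i != j -> measurable P ->
  ae_at nu i (ae_at nu j P) = ae_at nu j (ae_at nu i P).
Proof.
move=> ij mP; apply/funext => z; apply/propext.
pose A := [set t : borel G * borel G | P (upd (upd z i t.1) j t.2)].
have mA : measurable A.
  apply: (measurable_preimage_conf
    (f := fun t : borel G * borel G => upd (upd z i t.1) j t.2)) => //.
  apply: borel_measurable_upd; last exact: borel_measurable_snd.
  apply: borel_measurable_upd; last exact: borel_measurable_fst.
  by move=> k; exact: borel_measurable_cst.
apply: iff_trans (ae_swap (nu i) (nu j) mA) _.
have updC x y : upd (upd z i x) j y = upd (upd z j y) i x.
  apply/funext => k; rewrite /upd; have [->|//] := eqVneq k j.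
  by rewrite eq_sym (negPf ij).
by split; apply: filterS => y; apply: filterS => x; rewrite /A /= updC.
Qed.

Lemma ae_all_swap nu i s P : i \notin s -> measurable P ->
  ae_at nu i (ae_all nu s P) = ae_all nu s (ae_at nu i P).
Proof.
move=> + mP; elim: s => //= j s IH; rewrite inE negb_or => /andP[ij /IH <-].
by rewrite ae_at_comm//; exact: ae_all_measurable.
Qed.

Lemma ae_all_perm nu s s' P : uniq s -> perm_eq s s' -> measurable P ->
  ae_all nu s P = ae_all nu s' P.
Proof.
move=> + + mP; elim: s s' => [|i s IH] s'.
  by move=> _ /perm_size/esym/size0nil ->.
move=> /= /andP[iNs us] ss'.
have is' : i \in s' by rewrite -(perm_mem ss') mem_head.
case/splitPr: is' us ss' => s1 s2 us ss'.
have {}ss' : perm_eq s (s1 ++ s2).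
  rewrite -(perm_cons i) (perm_trans ss')//.
  by rewrite perm_sym -cat1s perm_catCA.
have iNs12 : i \notin s1 ++ s2 by rewrite -(perm_mem ss').
rewrite (IH _ us ss') !ae_all_cat /= -ae_all_swap//; last exact: ae_all_measurable.
by move: iNs12; rewrite mem_cat negb_or => /andP[].
Qed.

Lemma ae_all_depends nu s S S' P : depends_on S P ->
  (forall i, i \in S -> i \notin s -> i \in S') -> depends_on S' (ae_all nu s P).
Proof.
elim: s S' => [|i s IH] S' dP SS'.
  by move=> z z' zz'; apply: dP => i iS; apply: zz'; exact: SS'.
have dIH : depends_on (i :: S') (ae_all nu s P).
  apply: IH => // j jS js; rewrite inE; have [//|ji] := eqVneq j i.
  by apply: SS' => //; rewrite inE negb_or ji.
move=> z z' zz'; apply: filterS => x; apply: dIH => j; rewrite inE /upd.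
by case: eqP => //= _; exact: zz'.
Qed.

Lemma ae_all_const nu s P z z' : depends_on s P -> ae_all nu s P z -> ae_all nu s P z'.
Proof.
move=> dP; apply: (ae_all_depends (S := s) (S' := [::]) dP) => // i is' /negP.
by case.
Qed.

Lemma ae_all_reindex nu s S (th : axis -> axis) P z :
  {in S &, injective th} -> {subset s <= S} -> depends_on S P ->
  (forall i, nu (th i) = nu i) ->
  ae_all nu (map th s) [set z | P (pull th z)] z <-> ae_all nu s P (pull th z).
Proof.
move=> thI + dP nuth; elim: s z => //= i s IH z sS.
have sS' : {subset s <= S} by move=> j js; apply: sS; rewrite inE js orbT.
have iS : i \in S by apply: sS; rewrite mem_head.
have dS : depends_on S (ae_all nu s P) by apply: ae_all_depends dP _ => j.
have E x : ae_all nu s P (pull th (upd z (th i) x)) <-> ae_all nu s P (upd (pull th z) i x).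
  apply: (depends_onP dS) => j jS; rewrite /pull /upd.
  by rewrite (inj_in_eq thI).
rewrite /ae_at /= nuth; split; apply: filterS => x h; first exact/E/IH.
by apply/IH => //; apply/E.
Qed.

(** By injectivity the image coordinates are distinct, and the remaining ones are dummies,
    quantified outermost. This is why omissions of rows and columns are well defined on classes. *)
Lemma ae_all_pullback (m : {sigma_finite_measure set (borel G) -> \bar R}) s s'
    (th : axis -> axis) P z z' :
  uniq s -> uniq s' -> {in s &, injective th} -> (forall i, i \in s -> th i \in s') ->
  measurable P -> depends_on s P ->
  ae_all (fun=> m) s P z -> ae_all (fun=> m) s' [set z | P (pull th z)] z'.
Proof.
move=> us us' thI ss' mP dP Pz.
have mP' : measurable ([set z | P (pull th z)] : set conf).
  apply: (measurable_preimage_conf (f := fun z : conf => pull th z)) => // i.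
  exact: borel_measurable_proj.
pose rest := [seq i <- s' | i \notin map th s].
have um : uniq (map th s) by rewrite map_inj_in_uniq.
rewrite (@ae_all_perm _ _ (rest ++ map th s))//; last first.
  apply: uniq_perm => //.
    rewrite cat_uniq filter_uniq// um andbT; apply/hasPn => i im /=.
    by rewrite mem_filter im.
  move=> i; rewrite mem_cat mem_filter; have [im|//] := boolP (i \in map th s).
    by move: im => /mapP[j js ->]; rewrite ss'.
  by rewrite orbF.
rewrite ae_all_cat ae_allT//; apply/seteqP; split=> // y _.
by apply/(ae_all_reindex (S := s)) => //; exact: ae_all_const Pz.
Qed.

End Quantifiers.
End Configurations.

(** * Homogeneous functions on cosets *)

Section GammaVertices.
Context (G : lcscGroupType) (G1 G2 : closed_subgroup G).
Local Notation Gam := (Gamma G1 G2).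

Lemma gamma_ext p q (X Y : Gam p q) : (forall i j, vedge X i j = vedge Y i j) ->
  (forall i j, hedge X i j = hedge Y i j) -> X = Y.
Proof.
move=> v h; apply: val_inj; case: X v h => -[X1 X2] hX; case: Y => -[Y1 Y2] hY v h.
by congr (_, _); apply/matrixP => i j; [exact: v|exact: h].
Qed.

Lemma vedgeE p q (X : Gam p q) i j :
  vedge X i j = ((vertex X (edge_src i) j)^-1 * vertex X (edge_dst i) j)%g.
Proof. by rewrite vertex_dst_l mulKg. Qed.

Lemma hedgeE p q (X : Gam p q) i j :
  hedge X i j = ((vertex X i (edge_src j))^-1 * vertex X i (edge_dst j))%g.
Proof. by rewrite vertex_dst_r mulKg. Qed.

Lemma vertex00 p q (X : Gam p q) : vertex X ord0 ord0 = 1%g.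
Proof. by rewrite /vertex !big_pred0 ?mulg1// => i; rewrite ltn0. Qed.

Lemma vertexE p q (X : Gam p q) (y : 'I_p.+1 -> 'I_q.+1 -> G) :
  (forall i j, vedge X i j = ((y (edge_src i) j)^-1 * y (edge_dst i) j)%g) ->
  (forall i j, hedge X i j = ((y i (edge_src j))^-1 * y i (edge_dst j))%g) ->
  forall i j, vertex X i j = ((y ord0 ord0)^-1 * y i j)%g.
Proof.
move=> v h.
have col i : vertex X i ord0 = ((y ord0 ord0)^-1 * y i ord0)%g.
  case: i => i; elim: i => [|i IH] lt_ip.
    by rewrite (_ : Ordinal _ = ord0) ?vertex00 ?mulVg//; exact: val_inj.
  have -> : Ordinal lt_ip = edge_dst (Ordinal (lt_ip : (i < p)%N)) by exact: val_inj.
  rewrite vertex_dst_l v (_ : edge_src _ = Ordinal (ltnW lt_ip)); last exact: val_inj.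
  by rewrite IH quot_chain.
move=> i; case=> j; elim: j => [|j IH] lt_jq.
  by rewrite (_ : Ordinal _ = ord0) ?col//; exact: val_inj.
have -> : Ordinal lt_jq = edge_dst (Ordinal (lt_jq : (j < q)%N)) by exact: val_inj.
rewrite vertex_dst_r h (_ : edge_src _ = Ordinal (ltnW lt_jq)); last exact: val_inj.
by rewrite IH quot_chain.
Qed.

End GammaVertices.

Lemma second_countable_mx (Y : topologicalType) m n :
  @second_countable Y -> @second_countable 'M[Y]_(m, n).
Proof.
move=> /countable_base[b ob bP].
pose box (k : {ffun 'I_m * 'I_n -> nat}) : set 'M[Y]_(m, n) :=
  [set M | forall i j, b (k (i, j)) (M i j)].
exists (range box); first by apply: (sub_countable (card_image_le box setT)); exact: countableP.
split=> [_ [k _ <-]|M U [P PM PU]].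
  rewrite openE => M Mk; exists (fun i j => b (k (i, j))) => // i j.
  by apply: open_nbhs_nbhs.
have kE (ij : 'I_m * 'I_n) : exists k, b k (M ij.1 ij.2) /\ b k `<=` P ij.1 ij.2.
  by have [k] := bP _ _ (PM ij.1 ij.2); exists k.
pose k := [ffun ij => sval (cid (kE ij))].
have kP i j : b (k (i, j)) (M i j) /\ b (k (i, j)) `<=` P i j.
  by rewrite ffunE; case: cid.
exists (box k) => [|N Nk]; first by split=> [|i j]; [exists k|exact: (kP i j).1].
by apply: PU => i j; apply: (kP i j).2.
Qed.

Lemma borel_measurable_if d (T : measurableType d) (Y : topologicalType) (D : set T)
    (f g : T -> Y) : measurable D -> borel_measurable f -> borel_measurable g ->
  borel_measurable (fun x => if `[< D x >] then f x else g x).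
Proof.
move=> mD bf bg U oU.
rewrite (_ : _ @^-1` U = (D `&` f @^-1` U) `|` (~` D `&` g @^-1` U)).
  by apply: measurableU; apply: measurableI; [|exact: bf|exact: measurableC|exact: bg].
apply/seteqP; split=> x /=.
  by case: asboolP => Dx Ux; [left|right].
by case: asboolP => Dx; case=> -[].
Qed.

(** * From cosets to points of $\Gamma_{pq}$ *)

Section Realization.
Context (G : lcscGroupType) (G1 G2 : closed_subgroup G).
Hypothesis G12 : (G1 : set G) `&` G2 = [set 1%g].
Local Notation Gam := (Gamma G1 G2).
Local Notation crossing := (crossing G1 G2).
Local Notation crossing_dom := (crossing_dom G1 G2).

Definition generic p q : set (conf G) :=
  [set z | forall i j, (i <= p)%N -> (j <= q)%N -> crossing_dom (z (inl j)) (z (inr i))].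

Definition coords p q : seq axis :=
  [seq inl j | j <- iota 0 q.+1] ++ [seq inr i | i <- iota 0 p.+1].

Lemma coords_uniq p q : uniq (coords p q).
Proof.
rewrite cat_uniq !map_inj_in_uniq ?iota_uniq// ?andbT.
- by apply/hasPn => _ /mapP[i _ ->]; apply/mapP => -[].
- by move=> ? ? _ _ [].
- by move=> ? ? _ _ [].
Qed.

Lemma mem_coords_l p q j : ((inl j : axis) \in coords p q) = (j <= q)%N.
Proof.
rewrite mem_cat (mem_map (fun x y => _)) ?mem_iota /=; last by move=> ? ? [].
rewrite add0n ltnS (_ : _ \in _ = false) ?orbF//.
by apply/negbTE/mapP => -[].
Qed.

Lemma mem_coords_r p q i : ((inr i : axis) \in coords p q) = (i <= p)%N.
Proof.
rewrite mem_cat [X in _ || X](mem_map (fun x y => _)) ?mem_iota /=; last by move=> ? ? [].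
rewrite add0n ltnS (_ : _ \in _ = false)//.
by apply/negbTE/mapP => -[].
Qed.

(** The value 1 off [generic] makes [realize] a total map, with trivial edges there. *)
Definition cell p q (z : axis -> G) i j : G :=
  if `[< generic p q z >] then crossing (z (inl j)) (z (inr i)) else 1%g.

Lemma cellE p q z i j : generic p q z -> cell p q z i j = crossing (z (inl j)) (z (inr i)).
Proof. by rewrite /cell; case: asboolP. Qed.

Lemma cell_row p q z (i : 'I_p.+1) (j k : 'I_q.+1) :
  csg_set G2 ((cell p q z i j)^-1 * cell p q z i k)%g.
Proof.
rewrite /cell; case: asboolP => [zg|_]; last by rewrite mulVg; exact: csg_one.
have [_ a] := crossingP (zg i j (ltn_ord i) (ltn_ord j)).
have [_ b] := crossingP (zg i k (ltn_ord i) (ltn_ord k)).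
have := csg_mul (csg_inv a) b; congr (csg_set G2 _).
by rewrite invgM invgK quot_chain.
Qed.

Lemma cell_col p q z (i k : 'I_p.+1) (j : 'I_q.+1) :
  csg_set G1 ((cell p q z i j)^-1 * cell p q z k j)%g.
Proof.
rewrite /cell; case: asboolP => [zg|_]; last by rewrite mulVg; exact: csg_one.
have [a _] := crossingP (zg i j (ltn_ord i) (ltn_ord j)).
have [b _] := crossingP (zg k j (ltn_ord k) (ltn_ord j)).
have := csg_mul (csg_inv a) b; congr (csg_set G1 _).
by rewrite invgM invgK quot_chain.
Qed.

Definition realize_fun p q (z : axis -> G) : 'M[G]_(p, q.+1) * 'M[G]_(p.+1, q) :=
  (\matrix_(i, j) ((cell p q z (edge_src i) j)^-1 * cell p q z (edge_dst i) j)%g,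
   \matrix_(i, j) ((cell p q z i (edge_src j))^-1 * cell p q z i (edge_dst j))%g).

Lemma realize_subproof p q z : realize_fun p q z \in @gamma_set G G1 G2 p q.
Proof.
rewrite inE; split=> /= i j; rewrite !mxE.
- exact: (cell_col z (edge_src i) (edge_dst i) j).
- exact: (cell_row z i (edge_src j) (edge_dst j)).
- by rewrite !quot_chain.
Qed.

Definition realize p q (z : axis -> G) : Gam p q :=
  exist _ (realize_fun p q z) (realize_subproof p q z).

Lemma vertex_realize p q z (i : 'I_p.+1) (j : 'I_q.+1) :
  vertex (realize p q z) i j = ((cell p q z 0 0)^-1 * cell p q z i j)%g.
Proof.
by apply: (vertexE (y := fun i j => cell p q z i j)) => k l; rewrite /vedge /hedge mxE.
Qed.

Lemma crossing_equivariant h x w x' w' :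
  csg_set G1 ((h * x)^-1 * x')%g -> csg_set G2 ((h * w)^-1 * w')%g ->
  crossing_dom x w -> crossing_dom x' w' /\ crossing x' w' = (h * crossing x w)%g.
Proof.
move=> hx hw /crossingP [a b]; apply: crossing_uniq => //.
  have := csg_mul (csg_inv hx) a; congr (csg_set G1 _).
  by rewrite invgM invgK !mulgA mulgK.
have := csg_mul (csg_inv hw) b; congr (csg_set G2 _).
by rewrite invgM invgK !mulgA mulgK.
Qed.

End Realization.

Section Hat.
Context (R : realType) (G : lcscGroupType) (G1 G2 : closed_subgroup G).
Variable A : polish_module R G.
Hypothesis G12 : (G1 : set G) `&` G2 = [set 1%g].
Local Notation Gam := (Gamma G1 G2).
Local Notation crossing := (crossing G1 G2).
Local Notation crossing_dom := (crossing_dom G1 G2).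
Local Notation generic := (generic G1 G2).
Local Notation cell := (cell G1 G2).
Local Notation realize := (realize G1 G2).

Lemma borel_measurable_crossing d (T : measurableType d) (x w : T -> G) :
  borel_measurable x -> borel_measurable w ->
  borel_measurable (fun t => crossing (x t) (w t)).
Proof.
move=> bx bw; apply: borel_measurable_mulg => // U oU.
have bd : borel_measurable (fun t => ((w t)^-1 * x t)%g).
  by apply: borel_measurable_mulg => //; exact: borel_measurable_invg.
exact: borel_measurable_preimage bd (borel_measurable_left_factor G12 oU).
Qed.

Lemma measurable_generic p q : measurable (generic p q).
Proof.
pose F (ij : 'I_p.+1 * 'I_q.+1) : set (conf G) :=
  [set z | ~ crossing_dom (z (inl (ij.2 : nat))) (z (inr (ij.1 : nat)))].
rewrite (_ : generic p q = ~` \bigcup_ij F ij); last first.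
  apply/seteqP; split=> [z zg [[i j] _]|z h i j ip jq].
    by apply; apply: zg; rewrite -ltnS ltn_ord.
  apply: contrapT => nz; apply: h; exists (inord i, inord j) => //.
  by rewrite /F /= !inordK.
apply: measurableC; apply: countable_bigcupT_measurable => [|[i j]]; first exact: countableP.
apply: measurableC; rewrite /= /crossing_dom.
apply: (borel_measurable_preimage (f := fun z : conf G =>
  ((z (inr (i : nat)))^-1 * z (inl (j : nat)))%g)); last exact: measurable_product_set.
apply: borel_measurable_mulg; last exact: borel_measurable_proj.
by apply: borel_measurable_invg; exact: borel_measurable_proj.
Qed.

Lemma borel_measurable_cell p q i j : borel_measurable (fun z : conf G => cell p q z i j).
Proof.
apply: borel_measurable_if; first exact: measurable_generic.
  by apply: borel_measurable_crossing; exact: borel_measurable_proj.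
exact: borel_measurable_cst.
Qed.

Lemma borel_measurable_realize p q : borel_measurable (fun z : conf G => realize p q z).
Proof.
move=> _ [B oB <-].
have mM : borel_measurable (fun z : conf G => @realize_fun G G1 G2 p q z).
  have sc m n := @second_countable_mx G m n (@lcsc_second_countable G).
  apply: (borel_measurable_pair (f := fun z : conf G => (realize_fun G1 G2 p q z).1)
    (g := fun z : conf G => (realize_fun G1 G2 p q z).2));
    [exact: sc|exact: sc| |]; apply: borel_measurable_mx => [|i j].
  - exact: lcsc_second_countable.
  - rewrite (_ : (fun z => _) = fun z => ((cell p q z (edge_src i) j)^-1 *
      cell p q z (edge_dst i) j)%g); last by apply/funext => z; rewrite mxE.
    by apply: borel_measurable_mulg; [apply: borel_measurable_invg|];
      exact: borel_measurable_cell.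
  - exact: lcsc_second_countable.
  - rewrite (_ : (fun z => _) = fun z => ((cell p q z i (edge_src j))^-1 *
      cell p q z i (edge_dst j))%g); last by apply/funext => z; rewrite mxE.
    by apply: borel_measurable_mulg; [apply: borel_measurable_invg|];
      exact: borel_measurable_cell.
exact: mM.
Qed.

(* The homogeneous form of F: invariant under x_j -> x_j G_1 and w_i -> w_i G_2 and
   equivariant under left translations. *)
Definition hat p q (F : borel_map A (Gam p q)) (z : axis -> G) : A :=
  if `[< generic p q z >] then pm_act (cell p q z 0 0) (F (realize p q z)) else 0.

Lemma hatE p q (F : borel_map A (Gam p q)) z : generic p q z ->
  hat F z = pm_act (cell p q z 0 0) (F (realize p q z)).
Proof. by rewrite /hat; case: asboolP. Qed.

Lemma borel_measurable_hat p q (F : borel_map A (Gam p q)) :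
  borel_measurable (fun z : conf G => hat F z).
Proof.
apply: borel_measurable_if; [exact: measurable_generic| |exact: borel_measurable_cst].
have bp : borel_measurable (fun z : conf G => (cell p q z 0 0, F (realize p q z))).
  apply: borel_measurable_pair; [exact: lcsc_second_countable|exact: (pm_polish A).1| |].
    exact: borel_measurable_cell.
  by apply: borel_measurable_comp (@borel_measurable_realize p q) _; exact: borel_mapP.
exact: (borel_measurable_continuous_comp bp (@pm_act_continuous _ _ A)).
Qed.

Lemma pm_act0 g : pm_act g (0 : A) = 0.
Proof. by apply: (addrI (pm_act g 0)); rewrite -pm_actD !addr0. Qed.

Lemma pm_actN g (a : A) : pm_act g (- a) = - pm_act g a.
Proof. by apply: (addrI (pm_act g a)); rewrite -pm_actD !subrr pm_act0. Qed.

Lemma pm_actB g (a b : A) : pm_act g (a - b) = pm_act g a - pm_act g b.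
Proof. by rewrite pm_actD pm_actN. Qed.

Lemma pm_act_inj g (a : A) : pm_act g a = 0 -> a = 0.
Proof. by move=> ga; rewrite -[a]pm_act1 -(mulVg g) pm_actM ga pm_act0. Qed.

Lemma hatB p q (F F' : borel_map A (Gam p q)) z : hat (F - F') z = hat F z - hat F' z.
Proof.
rewrite /hat; case: asboolP => _; last by rewrite subr0.
by rewrite -pm_actB.
Qed.

Lemma realize_equivariant p q h z z' :
  (forall j, (j <= q)%N -> csg_set G1 ((h * z (inl j))^-1 * z' (inl j))%g) ->
  (forall i, (i <= p)%N -> csg_set G2 ((h * z (inr i))^-1 * z' (inr i))%g) ->
  generic p q z ->
  [/\ generic p q z', realize p q z' = realize p q z &
      forall i j, (i <= p)%N -> (j <= q)%N -> cell p q z' i j = (h * cell p q z i j)%g].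
Proof.
move=> hx hw zg.
have zg' : generic p q z'.
  by move=> i j ip jq; have [] := crossing_equivariant G12 (hx j jq) (hw i ip) (zg i j ip jq).
have cE i j : (i <= p)%N -> (j <= q)%N -> cell p q z' i j = (h * cell p q z i j)%g.
  move=> ip jq; rewrite !cellE//.
  by have [] := crossing_equivariant G12 (hx j jq) (hw i ip) (zg i j ip jq).
split=> //; apply: gamma_ext => i j; rewrite /vedge /hedge !mxE !cE.
all: rewrite ?invgM ?mulgA ?mulgVK// -?mulgA ?mulKg//; try by rewrite -ltnS ltn_ord.
Qed.

Lemma hat_equivariant p q (F : borel_map A (Gam p q)) h z z' :
  (forall j, (j <= q)%N -> csg_set G1 ((h * z (inl j))^-1 * z' (inl j))%g) ->
  (forall i, (i <= p)%N -> csg_set G2 ((h * z (inr i))^-1 * z' (inr i))%g) ->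
  hat F z' = pm_act h (hat F z).
Proof.
move=> hx hw; have [zg|nzg] := pselect (generic p q z).
  have [zg' rE cE] := realize_equivariant hx hw zg.
  by rewrite !hatE// rE cE// pm_actM.
have nzg' : ~ generic p q z'.
  move=> zg'; apply: nzg.
  have [j jq|i ip|] := realize_equivariant (h := h^-1%g) (z' := z) _ _ zg'.
  - by have := csg_inv (hx j jq); rewrite !invgM !invgK mulgA.
  - by have := csg_inv (hw i ip); rewrite !invgM !invgK mulgA.
  - by [].
rewrite /hat; case: asboolP => // _; case: asboolP => // _.
by rewrite pm_act0.
Qed.

Lemma hat_depends p q (F : borel_map A (Gam p q)) z z' :
  (forall i, i \in coords p q -> z i = z' i) -> hat F z' = hat F z.
Proof.
move=> zz'; rewrite (@hat_equivariant _ _ F 1%g z) ?pm_act1// => k kle.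
  by rewrite mul1g zz' ?mem_coords_l// mulVg; exact: csg_one.
by rewrite mul1g zz' ?mem_coords_r// mulVg; exact: csg_one.
Qed.

(** A section of [realize]: the column coset $j$ is represented by $y_{0j}$ and the row coset $i$ by
    $y_{i0}$, with $y_{00}=1$. *)
Definition boundary p q (X : Gam p q) (a : axis) : G :=
  match a with
  | inl j => vertex X ord0 (inord j)
  | inr i => vertex X (inord i) ord0
  end.

Lemma boundary_cell p q (X : Gam p q) :
  generic p q (boundary X) /\
  forall (i : 'I_p.+1) (j : 'I_q.+1), cell p q (boundary X) i j = vertex X i j.
Proof.
have H (i : 'I_p.+1) (j : 'I_q.+1) :
    crossing_dom (boundary X (inl (j : nat))) (boundary X (inr (i : nat))) /\
    crossing (boundary X (inl (j : nat))) (boundary X (inr (i : nat))) = vertex X i j.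
  by apply: crossing_uniq => //=; rewrite inord_val; [exact: vertex_col|exact: vertex_row].
have g : generic p q (boundary X).
  move=> i j ip jq; have [] := H (inord i) (inord j).
  by rewrite !inordK.
by split=> // i j; rewrite cellE//; have [] := H i j.
Qed.

Lemma realize_boundary p q (X : Gam p q) : realize p q (boundary X) = X.
Proof.
have [g cE] := boundary_cell X; apply: gamma_ext => i j.
  by rewrite [RHS]vedgeE [LHS]mxE !cE.
by rewrite [RHS]hedgeE [LHS]mxE !cE.
Qed.

Lemma hat_boundary p q (F : borel_map A (Gam p q)) X : hat F (boundary X) = F X.
Proof.
have [g cE] := boundary_cell X; rewrite hatE// realize_boundary.
by rewrite (cE ord0 ord0) vertex00 pm_act1.
Qed.

(** Selecting rows and columns moves the corner normalized to 1, and acting by the new corner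
    $y_{r(0),c(0)}$ compensates for it. This one formula contains the factors $s_{01}$, $g_{10}$ and
    $g_{10}\cdots g_{i-1,0}$ of the operators and of $T$. *)
Definition face_map p q p' q' (r c : nat -> nat) (F : borel_map A (Gam p' q')) :
    borel_map A (Gam p q) :=
  borel_act (c := fun X : Gam p q => vertex X (inord (r 0%N)) (inord (c 0%N)))
    (@continuous_vertex G G1 G2 p q _ _)
    (borel_pull (@continuous_reindex G G1 G2 p q p' q'
      (fun i => inord (r i)) (fun j => inord (c j))) F).

Lemma face_mapE p q p' q' r c (F : borel_map A (Gam p' q')) X :
  face_map p q r c F X = pm_act (vertex X (inord (r 0%N)) (inord (c 0%N)))
    (F (Defs.reindex (fun i => inord (r i)) (fun j => inord (c j)) X)).
Proof. by []. Qed.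

Definition axis_map (r c : nat -> nat) (a : axis) : axis :=
  match a with inl j => inl (c j) | inr i => inr (r i) end.

(** In homogeneous form the action disappears: an index map merely selects variables, so faces
    compose as index maps do. *)
Lemma hat_face_map p q p' q' r c (F : borel_map A (Gam p' q')) z :
  (forall k, (k <= p')%N -> (r k <= p)%N) -> (forall k, (k <= q')%N -> (c k <= q)%N) ->
  generic p q z -> hat (face_map p q r c F) z = hat F (pull (axis_map r c) z).
Proof.
move=> rp cq zg; have zg' : generic p' q' (pull (axis_map r c) z).
  by move=> i j ip jq; apply: zg; [exact: rp|exact: cq].
have cE i j : (i <= p')%N -> (j <= q')%N ->
    cell p' q' (pull (axis_map r c) z) i j = cell p q z (r i) (c j).
  by move=> ip jq; rewrite !cellE.
have vE i j : (i <= p)%N -> (j <= q)%N ->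
    vertex (realize p q z) (inord i) (inord j) = ((cell p q z 0 0)^-1 * cell p q z i j)%g.
  by move=> ip jq; rewrite vertex_realize !inordK.
rewrite !hatE// face_mapE -pm_actM vE ?rp ?cq// mulVKg cE//.
congr (pm_act _ (F _)); apply: gamma_ext => i j; rewrite /vedge /hedge !mxE.
  have h1 := ltn_ord (edge_src i); have h2 := ltn_ord (edge_dst i).
  have h3 := ltn_ord j; rewrite !cE// !vE ?rp ?cq//.
  by rewrite invgM invgK quot_chain.
have h1 := ltn_ord (edge_src j); have h2 := ltn_ord (edge_dst j).
have h3 := ltn_ord i; rewrite !cE// !vE ?rp ?cq//.
by rewrite invgM invgK quot_chain.
Qed.

End Hat.

(** * Null sets *)

Section QuantifierInvariance.
Context (R : realType) (G : lcscGroupType) (G1 G2 : closed_subgroup G)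
  (mu mu1 mu2 : {sigma_finite_measure set (borel G) -> \bar R}).
Hypotheses (mu_haar : is_haar [set: G] mu) (mu1_haar : is_haar (csg_set G1) mu1)
  (mu2_haar : is_haar (csg_set G2) mu2) (G12 : is_matched_pair mu G1 G2).
Implicit Types (P : set (conf G)) (s : seq axis) (z : axis -> G).

Let muT : is_haar (csg_set (subgroupT G)) mu := mu_haar.

Definition side (a : axis) : closed_subgroup G := if a is inl _ then G1 else G2.

(** The indices are crossed on purpose: a column variable matters only modulo $G_1$, and $G/G_1$ is
    $G_2$ up to a null set. *)
Definition side_measure (a : axis) := if a is inl _ then mu2 else mu1.

Definition right_invariant (a : axis) P : Prop :=
  forall z g, csg_set (side a) g -> P (upd z a (z a * g)%g) <-> P z.

Lemma measurable_slice P z a : measurable P -> measurable [set x : borel G | P (upd z a x)].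
Proof.
move=> mP; apply: (measurable_preimage_conf (f := fun x : borel G => upd z a x)) => // j.
by apply: borel_measurable_upd => [k|]; [exact: borel_measurable_cst|exact: borel_measurable_id].
Qed.

Lemma ae_all_right_invariant nu s P a : a \notin s -> right_invariant a P ->
  right_invariant a (ae_all (R := R) nu s P).
Proof.
move=> + Pa; elim: s => //= i s IH; rewrite inE negb_or => /andP[ai /IH {}IH] z g gH.
have E x : upd (upd z a (z a * g)%g) i x = upd (upd z i x) a (upd z i x a * g)%g.
  apply/funext => k; rewrite /upd (negPf ai); have [->|//] := eqVneq k i.
  by rewrite eq_sym (negPf ai).
by split; apply: filterS => x; rewrite E => h; apply/(IH _ _ gH).
Qed.

Lemma ae_all_left_invariant s P h z : measurable P ->
  (forall z, P (fun i => h * z i)%g <-> P z) ->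
  ae_all (fun=> mu) s P (fun i => h * z i)%g <-> ae_all (fun=> mu) s P z.
Proof.
move=> mP Ph; elim: s z => //= i s IH z.
have mP' := ae_all_measurable (fun=> mu) s mP.
have E x : upd (fun k => h * z k)%g i (h * x)%g = (fun k => h * upd z i x k)%g.
  by apply/funext => k; rewrite /upd; case: eqP.
apply: iff_trans (iff_sym (ae_haar_mull muT (I : csg_set (subgroupT G) h)
  (measurable_slice (fun k => h * z k)%g i mP'))) _.
by split; apply: filterS => x; rewrite /= E => H; apply/IH.
Qed.

Lemma ae_at_side P a : measurable P -> right_invariant a P ->
  ae_at (fun=> mu) a P = ae_at side_measure a P.
Proof.
move=> mP Pa; apply/funext => z; apply/propext.
have H x y : csg_set (side a) y -> P (upd z a (x * y)%g) <-> P (upd z a x).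
  move=> ya; rewrite -(Pa (upd z a x) y ya) (_ : upd (upd _ _ _) _ _ = upd z a (x * y)%g)//.
  by apply/funext => k; rewrite /upd eqxx; case: eqP.
case: a Pa H => a Pa H; rewrite /ae_at /side_measure.
  exact: (ae_matched2 mu_haar mu1_haar mu2_haar G12 (measurable_slice z (inl a) mP)).
exact: (ae_matched1 mu_haar mu1_haar mu2_haar G12 (measurable_slice z (inr a) mP)).
Qed.

Lemma ae_all_side s P : uniq s -> measurable P -> (forall a, a \in s -> right_invariant a P) ->
  ae_all (fun=> mu) s P = ae_all side_measure s P.
Proof.
move=> + mP; elim: s => //= a s IH /andP[aNs us] Ps.
rewrite IH//; last by move=> b bs; apply: Ps; rewrite inE bs orbT.
apply: ae_at_side; first exact: ae_all_measurable.
by apply: ae_all_right_invariant => //; apply: Ps; exact: mem_head.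
Qed.

Lemma ae_crossing_dom x : {ae mu, forall w, crossing_dom G1 G2 x w}.
Proof.
have mD : measurable [set g : borel G | product_set G1 G2 (g^-1)%g].
  apply: borel_measurable_preimage (@measurable_product_set G G1 G2).
  by apply: borel_measurable_invg; exact: borel_measurable_id.
have := (ae_haar_mull muT (I : csg_set (subgroupT G) x^-1%g) mD).2.
rewrite /crossing_dom => h.
have {}h := h _; apply: filterS (h _) => [w|].
  by rewrite /= invgM invgK.
apply: filterS (ae_matched G12) => g [a [b [aG1 bG2 ->]]] /=.
by exists b^-1%g; [exact: csg_inv|exists a^-1%g; rewrite ?invgM//; exact: csg_inv].
Qed.

End QuantifierInvariance.

Section TupleQuantifier.
Context (R : realType) (G : lcscGroupType).
Implicit Types m : {sigma_finite_measure set (borel G) -> \bar R}.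

Fixpoint ae_tuple m n : set (n.-tuple (borel G)) -> Prop :=
  match n with
  | 0 => fun P => P [tuple]
  | n'.+1 => fun P => {ae m, forall x, ae_tuple m [set t : n'.-tuple (borel G) | P (tuple_cons (x, t))]}
  end.

Lemma ae_tuple_mono m n (P P' : set (n.-tuple (borel G))) : P `<=` P' ->
  ae_tuple m P -> ae_tuple m P'.
Proof.
elim: n P P' => [|n IH] P P' PP' /=; first exact: PP'.
by apply: filterS => x; apply: IH => t; exact: PP'.
Qed.

Lemma ae_tuple_mem (H : closed_subgroup G) m n : is_haar (csg_set H) m ->
  ae_tuple m [set t : n.-tuple (borel G) | forall i, csg_set H (tnth t i)].
Proof.
move=> haar; elim: n => [|n IH] /=; first by case.
apply: filterS (ae_haar_mem haar) => x Hx; apply: ae_tuple_mono IH => t tH i.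
rewrite (tnth_nth 1%g) /=; case: i => -[|i] //= lt_in.
by have := tH (Ordinal (lt_in : (i < n)%N)); rewrite (tnth_nth 1%g).
Qed.

Lemma ae_tupleP m n (P : set (n.-tuple (borel G))) : measurable P ->
  power_measure m n (~` P) = 0%E <-> ae_tuple m P.
Proof.
elim: n P => [|n IH] P mP.
  rewrite /= /dirac /= indicE; have [P0|nP0] := pselect (P [tuple]).
    by split=> // _; rewrite (_ : _ \in _ = false)//; apply/negbTE; rewrite notin_setE; apply.
  split=> // /eqP; rewrite (_ : _ \in _ = true) ?eqe ?oner_eq0//.
  exact: mem_set.
pose Q := @tuple_cons _ (borel G) n @^-1` P.
have mQ : measurable Q.
  by rewrite -[X in measurable X]setTI; exact: (@measurable_tuple_cons _ (borel G) n).
rewrite [X in X = _](_ : _ = (m \x power_measure m n)%E (~` Q))//.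
rewrite ae_product//.
have E x : {ae power_measure m n, forall t, Q (x, t)} <->
    ae_tuple m [set t | P (tuple_cons (x, t))].
  have mx : measurable [set t | Q (x, t)].
    rewrite (_ : [set t | _] = xsection Q x); first exact: measurable_xsection.
    by apply/seteqP; split=> t; rewrite /xsection /= in_setE.
  by apply: iff_trans (IH _ mx); apply: iff_sym; exact: iff_sym (negligibleP _ (measurableC mx)).
by split=> /= h; apply: (@filterS _ _ (ae_borel_filter m) _ _ _ h) => x h'; apply/E.
Qed.

End TupleQuantifier.

(** * From the edges of a path to its vertices *)

Section Paths.
Context (R : realType) (G : lcscGroupType) (H : closed_subgroup G)
  (m : {sigma_finite_measure set (borel G) -> \bar R})
  (nu : axis -> {sigma_finite_measure set (borel G) -> \bar R}).
Hypothesis haar : is_haar (csg_set H) m.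
Variable iota_axis : nat -> axis.
Hypothesis iota_inj : injective iota_axis.
Hypothesis nu_iota : forall k, nu (iota_axis k) = m.

Fixpoint set_path (k : nat) (c : G) (t : seq G) (z : axis -> G) : axis -> G :=
  if t is x :: t' then set_path k.+1 (c * x)%g t' (upd z (iota_axis k.+1) (c * x)%g) else z.

Lemma set_pathP y k t z :
  (forall l, (l < size t)%N -> y (k + l).+1 = (y (k + l)%N * nth 1%g t l)%g) ->
  (forall l, (k < l)%N -> (l <= k + size t)%N -> set_path k (y k) t z (iota_axis l) = y l) /\
  (forall a, (forall l, (k < l)%N -> (l <= k + size t)%N -> a <> iota_axis l) ->
     set_path k (y k) t z a = z a).
Proof.
elim: t k z => [|x t IH] k z yE /=; first by split=> // l; lia.
have y1 : (y k * x)%g = y k.+1 by have := yE 0 (ltn0Sn _); rewrite addn0.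
rewrite y1; have [|h1 h2] := IH k.+1 (upd z (iota_axis k.+1) (y k.+1)).
  by move=> l lt; have := yE l.+1 lt; rewrite !addSn addnS.
split=> [l kl lk|a ha].
  have [lk1E|lk1] := eqVneq l k.+1; last by apply: h1; [rewrite ltn_neqAle eq_sym lk1|rewrite addSnnS].
  rewrite lk1E.
  by rewrite h2 ?updE// => l' kl' _ /iota_inj ll'; rewrite -ll' ltnn in kl'.
rewrite h2 => [|l kl lk]; last by apply: ha; [exact: ltnW|rewrite -addSnnS].
by rewrite upd_neq//; apply/eqP; apply: ha => //; rewrite addnS ltnS leq_addr.
Qed.

Lemma measurable_set_path d (T : measurableType d) n k (c : T -> G)
    (t : T -> n.-tuple (borel G)) (z : T -> axis -> G) :
  borel_measurable c -> measurable_fun setT t -> (forall a, borel_measurable (fun x => z x a)) ->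
  forall a, borel_measurable (fun x => set_path k (c x) (t x) (z x) a).
Proof.
elim: n k c t z => [|n IH] k c t z mc mt mz a.
  rewrite (_ : (fun x => _) = fun x => z x a)//; apply/funext => x.
  by rewrite (tuple0 (t x)).
have mh : borel_measurable (fun x => thead (t x) : G).
  have mhd : measurable_fun setT (fun x => thead (t x) : borel G).
    exact: (measurableT_comp (@measurable_tnth _ (borel G) n.+1 ord0) mt).
  exact: borel_measurable_fun mhd (@borel_measurable_id G).
rewrite (_ : (fun x => _) = fun x => set_path k.+1 (c x * thead (t x))%g [tuple of behead (t x)]
    (upd (z x) (iota_axis k.+1) (c x * thead (t x))%g) a); last first.
  by apply/funext => x; case: (tupleP (t x)) => y t0; rewrite theadE.
have mch : borel_measurable (fun x => (c x * thead (t x))%g) by exact: borel_measurable_mulg.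
have mb : measurable_fun setT (fun x => [tuple of behead (t x)] : n.-tuple (borel G)).
  exact: (measurableT_comp (@measurable_behead _ (borel G) n) mt).
have mu_ b : borel_measurable (fun x => upd (z x) (iota_axis k.+1) (c x * thead (t x))%g b).
  exact: borel_measurable_upd.
exact: IH mch mb mu_ a.
Qed.

(** Each vertex is the edge leading to it, translated on the left by the previous vertex, an element
    of $H$. Left invariance is applied to one variable after the other. *)
Lemma ae_all_path n k c (P : set (conf G)) z : csg_set H c -> measurable P ->
  ae_all nu [seq iota_axis l | l <- iota k.+1 n] P z <->
  ae_tuple m [set t : n.-tuple (borel G) | P (set_path k c t z)].
Proof.
move=> + mP; elim: n k c z => [|n IH] k c z Hc //=.
have mP' := ae_all_measurable nu [seq iota_axis l | l <- iota k.+2 n] mP.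
have := ae_haar_mull haar Hc (measurable_slice z (iota_axis k.+1) mP').
rewrite /ae_at /= nu_iota => h; apply: iff_trans (iff_sym h) _.
split=> aeP; apply: filterS2 (ae_haar_mem haar) aeP => x Hx /=.
  by move=> /(IH _ (c * x)%g) hx; apply: hx; exact: csg_mul.
by move=> hx; apply/(IH _ (c * x)%g) => //; exact: csg_mul.
Qed.

End Paths.

Section NullSets.
Context (R : realType) (G : lcscGroupType) (G1 G2 : closed_subgroup G)
  (mu mu1 mu2 : {sigma_finite_measure set (borel G) -> \bar R}).
Hypotheses (mu_haar : is_haar [set: G] mu) (mu1_haar : is_haar (csg_set G1) mu1)
  (mu2_haar : is_haar (csg_set G2) mu2) (G12 : is_matched_pair mu G1 G2).
Variable A : polish_module R G.
Local Notation Gam := (Gamma G1 G2).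

Let G12_meet := mp_meet G12.

Lemma polish_closed1 (a : A) : closed [set a].
Proof.
have [_ [M [f [g [[fK gK cf cg] _]]]]] := pm_polish A.
have clM : closed [set f a].
  by apply: accessible_closed_set1; exact/hausdorff_accessible/metric_hausdorff.
rewrite (_ : [set a] = f @^-1` [set f a]); first by apply: closed_comp clM => x _; exact: cf.
by apply/seteqP; split=> [_ ->//|b /(can_inj fK)].
Qed.

Definition hat_zeros p q (F : borel_map A (Gam p q)) : set (conf G) := [set z | hat F z = 0].

Lemma measurable_hat_zeros p q (F : borel_map A (Gam p q)) : measurable (hat_zeros F).
Proof.
have c0 := @polish_closed1 0.
rewrite -[hat_zeros F]setCK; apply: measurableC.
by apply: (borel_measurable_hat G12_meet F (U := ~` [set 0])); rewrite openC.
Qed.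

Lemma hat_zeros_right p q (F : borel_map A (Gam p q)) a : right_invariant G1 G2 a (hat_zeros F).
Proof.
move=> z g gH; rewrite /hat_zeros /= (@hat_equivariant _ _ _ _ _ G12_meet _ _ F 1%g z) ?pm_act1//.
all: move=> j _; rewrite mul1g /upd; case: eqP => [ja|_]; last by rewrite mulVg; exact: csg_one.
all: by subst a; rewrite mulKg.
Qed.

Lemma hat_zeros_left p q (F : borel_map A (Gam p q)) h z :
  hat_zeros F (fun i => h * z i)%g <-> hat_zeros F z.
Proof.
rewrite /hat_zeros /= (@hat_equivariant _ _ _ _ _ G12_meet _ _ F h z); last 2 first.
  by move=> j _; rewrite mulVg; exact: csg_one.
  by move=> j _; rewrite mulVg; exact: csg_one.
by split=> [/pm_act_inj//|->]; exact: pm_act0.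
Qed.

Lemma hat_zeros_depends p q (F : borel_map A (Gam p q)) : depends_on (coords p q) (hat_zeros F).
Proof. by move=> z z' zz'; rewrite /hat_zeros /= (hat_depends G12_meet F zz'). Qed.

Let e : axis -> G := fun=> 1%g.

(* The two base coordinates may be set to 1: a common element of the cosets
   x G1 and w G2 is moved to 1 by left translation. *)
Lemma ae_all_base s P : measurable P -> (forall a, right_invariant G1 G2 a P) ->
  (forall h z, P (fun i => h * z i)%g <-> P z) ->
  uniq [:: inl 0%N, inr 0%N & s] -> depends_on [:: inl 0%N, inr 0%N & s] P ->
  ae_all (fun=> mu) [:: inl 0%N, inr 0%N & s] P e <-> ae_all (fun=> mu) s P e.
Proof.
move=> mP rP lP /=; rewrite !inE !negb_or => /and3P[l0s r0s us] dP.
set Q := ae_all _ s P.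
have mQ : measurable Q by exact: ae_all_measurable.
have rQ0 : right_invariant G1 G2 (inl 0%N) Q by apply: ae_all_right_invariant.
have rQ1 : right_invariant G1 G2 (inr 0%N) Q by apply: ae_all_right_invariant.
have lQ h z : Q (fun i => h * z i)%g <-> Q z.
  by apply: ae_all_left_invariant => // z'; exact: lP.
have dQ : depends_on [:: inl 0%N; inr 0%N] Q.
  apply: ae_all_depends dP _ => i; rewrite !inE => /or3P[->//|->|->//].
  by rewrite orbT.
have QE z : crossing_dom G1 G2 (z (inl 0%N)) (z (inr 0%N)) -> Q z <-> Q e.
  move=> /crossingP; set k := crossing _ _ _ _ => -[k1 k2].
  rewrite -(lQ k e) -(rQ0 _ _ k1) -(rQ1 _ _ k2).
  by apply: (depends_onP dQ) => i; rewrite !inE => /orP[] /eqP -> /=;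
    rewrite /upd /= /e mulg1 mulVKg.
have dom := ae_crossing_dom mu_haar G12.
split=> [/(ae_haar_ex (H := subgroupT G) mu_haar)[x _ Qx]|Qe].
  have [w _ []] := ae_haar_ex (H := subgroupT G) mu_haar (filterI (dom x) Qx).
  by move=> xw /QE; apply.
apply: filterE => x; apply: filterS (dom x) => w xw.
exact/QE.
Qed.

Definition path_conf p q (ts : p.-tuple (borel G) * q.-tuple (borel G)) : axis -> G :=
  set_path inl 0 1%g ts.2 (set_path inr 0 1%g ts.1 e).

Lemma path_confE p q (ts : p.-tuple (borel G) * q.-tuple (borel G)) (y1 y2 : nat -> G) :
  y1 0%N = 1%g -> y2 0%N = 1%g ->
  (forall l, (l < p)%N -> y1 l.+1 = (y1 l * nth 1%g ts.1 l)%g) ->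
  (forall l, (l < q)%N -> y2 l.+1 = (y2 l * nth 1%g ts.2 l)%g) ->
  (forall l, (l <= p)%N -> path_conf ts (inr l) = y1 l) /\
  (forall l, (l <= q)%N -> path_conf ts (inl l) = y2 l).
Proof.
move=> y10 y20 y1S y2S.
have inrI : injective (inr : nat -> axis) by move=> ? ? [].
have inlI : injective (inl : nat -> axis) by move=> ? ? [].
rewrite /path_conf -{1}y20 -{2}y20 -{1}y10 -{1}y10.
have [|a1 a2] := @set_pathP _ _ inrI y1 0%N ts.1 e; first by rewrite size_tuple.
have [|b1 b2] := @set_pathP _ _ inlI y2 0%N ts.2 (set_path inr 0 (y1 0%N) ts.1 e).
  by rewrite size_tuple.
rewrite !size_tuple in a1 a2 b1 b2.
split=> -[_|l lp].
- by rewrite b2 ?a2// => -[].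
- by rewrite b2 ?a1.
- by rewrite b2 ?a2 ?y20//; case.
- by rewrite b1.
Qed.

Lemma measurable_path_conf p q (P : set (conf G)) : measurable P ->
  measurable [set ts : p.-tuple (borel G) * q.-tuple (borel G) | P (path_conf ts)].
Proof.
move=> mP; apply: (measurable_preimage_conf (f := @path_conf p q)) => // i.
have mc g : borel_measurable (fun _ : p.-tuple (borel G) * q.-tuple (borel G) => g : G).
  exact: borel_measurable_cst.
apply: (measurable_set_path inl 0 (mc 1%g) measurable_snd) => j.
exact: (measurable_set_path inr 0 (mc 1%g) measurable_fst (fun=> mc 1%g)).
Qed.

Let coords0 p q := [seq inr i | i <- iota 1 p] ++ [seq inl j | j <- iota 1 q].

(** The base coordinates are set to 1, the invariance on each side replaces [mu] by [mu1] or [mu2],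
    and vertices are exchanged for edges; what is left is Fubini on the two power measures. *)
Lemma ae_gamma_path p q (P : set (conf G)) : measurable P ->
  (forall a, right_invariant G1 G2 a P) ->
  (forall h z, P (fun i => h * z i)%g <-> P z) -> depends_on (coords p q) P ->
  gamma_measure mu1 mu2 p q
    (~` [set ts : p.-tuple (borel G) * q.-tuple (borel G) | P (path_conf ts)]) = 0%E <->
  ae_all (fun=> mu) (coords p q) P e.
Proof.
move=> mP rP lP dP; have mD := @measurable_path_conf p q P mP.
have pc : perm_eq (coords p q) [:: inl 0%N, inr 0%N & coords0 p q].
  rewrite /coords /coords0 /= perm_cons -cat_rcons -cats1 -catA perm_catC /=.
  by rewrite perm_cons.
rewrite (ae_all_perm _ (coords_uniq p q) pc mP) ae_all_base//; last 2 first.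
- by rewrite -(perm_uniq pc) coords_uniq.
- by move=> z z' zz'; apply: dP => i; rewrite (perm_mem pc); exact: zz'.
have u0 : uniq (coords0 p q).
  by have := coords_uniq p q; rewrite (perm_uniq pc) => /and3P[].
rewrite (ae_all_side mu_haar mu1_haar mu2_haar G12)// ae_all_cat.
have mQ := ae_all_measurable (side_measure mu1 mu2) [seq inl j | j <- iota 1 q] mP.
rewrite (ae_all_path (nu := side_measure mu1 mu2) (iota_axis := inr) mu1_haar _ _ 0 _ (csg_one G1) mQ)//.
rewrite ae_product//.
have E t : {ae power_measure mu2 q, forall s, P (path_conf (p := p) (t, s))} <->
    ae_all (side_measure mu1 mu2) [seq inl j | j <- iota 1 q] P (set_path inr 0 1%g t e).
  rewrite (ae_all_path (nu := side_measure mu1 mu2) (iota_axis := inl) mu2_haar _ _ 0 _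
    (csg_one G2) mP)//.
  have mt : measurable [set s : q.-tuple (borel G) | P (path_conf (p := p) (t, s))].
    rewrite (_ : [set s | _] = xsection [set ts : p.-tuple (borel G) * q.-tuple (borel G) |
      P (path_conf ts)] t); first exact: measurable_xsection.
    by apply/seteqP; split=> s; rewrite /xsection /= in_setE.
  by apply: iff_trans (ae_tupleP _ mt); apply: negligibleP; exact: measurableC.
have mt : measurable [set t : p.-tuple (borel G) |
    {ae power_measure mu2 q, forall s, P (path_conf (p := p) (t, s))}].
  exact: measurable_ae mD.
apply: iff_trans (iff_trans (ae_tupleP mu1 mt) _).
  by apply: negligibleP; exact: measurableC.
by split; apply: ae_tuple_mono => t /E.
Qed.

Lemma is_null_hat p q (F : borel_map A (Gam p q)) z0 :
  is_null (gamma_null G1 G2 mu1 mu2 p q) [set X | F X <> 0] <->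
  ae_all (fun=> mu) (coords p q) (hat_zeros F) z0.
Proof.
have mP := measurable_hat_zeros F; have dP := @hat_zeros_depends p q F.
have <- : ae_all (fun=> mu) (coords p q) (hat_zeros F) e <->
    ae_all (fun=> mu) (coords p q) (hat_zeros F) z0.
  by split; exact: ae_all_const.
rewrite -ae_gamma_path//; [|exact: hat_zeros_right|exact: hat_zeros_left].
have mD := @measurable_path_conf p q _ mP.
set D := [set ts | _] in mD *.
(* The path with edges [cross X] agrees with [boundary X] on every coordinate that [hat F] reads. *)
have sub X : F X <> 0 -> ~ D (cross X).
  move=> FX; rewrite /D /hat_zeros /=.
  have [||l|l|E1 E2] := @path_confE p q (cross X) (fun l => vertex X (inord l) ord0)
      (fun l => vertex X ord0 (inord l)).
  - by rewrite (_ : inord 0 = ord0) ?vertex00//; apply: val_inj; rewrite /= inordK.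
  - by rewrite (_ : inord 0 = ord0) ?vertex00//; apply: val_inj; rewrite /= inordK.
  - move=> lp; rewrite (_ : inord l.+1 = edge_dst (Ordinal lp)); last first.
      by apply: val_inj; rewrite /= inordK.
    rewrite vertex_dst_l (nth_mktuple _ _ (Ordinal lp)); congr (vertex _ _ _ * _)%g.
    by apply: val_inj; rewrite /= inordK// ltnS ltnW.
  - move=> lp; rewrite (_ : inord l.+1 = edge_dst (Ordinal lp)); last first.
      by apply: val_inj; rewrite /= inordK.
    rewrite vertex_dst_r (nth_mktuple _ _ (Ordinal lp)); congr (vertex _ _ _ * _)%g.
    by apply: val_inj; rewrite /= inordK// ltnS ltnW.
  rewrite (@hat_depends _ _ _ _ _ G12_meet _ _ F (boundary X)) ?hat_boundary// => -[j|i].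
    by rewrite mem_coords_l => jq; rewrite E2.
  by rewrite mem_coords_r => ip; rewrite E1.
split=> [nF|/(negligibleP _ (measurableC mD)) nD]; last first.
  by apply: negligibleS nD => _ [X FX <-]; exact: sub.
apply/(negligibleP _ (measurableC mD)).
pose E (H : closed_subgroup G) n := [set t : n.-tuple (borel G) | forall i, csg_set H (tnth t i)].
have mE H n : measurable (E H n).
  rewrite (_ : E H n = \bigcap_(i in [set: 'I_n]) ((fun t => tnth t i) @^-1` csg_set H)).
    apply: fin_bigcap_measurable; first exact: finite_finset.
    move=> i _; rewrite -[X in measurable X]setTI; apply: (@measurable_tnth _ (borel G) n i) => //.
    rewrite -[csg_set H]setCK; apply: measurableC; apply: sub_gen_smallest.
    by rewrite /= openC; exact: csg_closed.
  by apply/seteqP; split=> t h i; [move=> _; exact: h|exact: h].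
have mEE : measurable (E G1 p `*` E G2 q) by exact: measurableX.
(* Tuples with an entry outside the subgroups are not in the image of [cross]; they form a null set
   because [mu1] and [mu2] are concentrated on $G_1$ and $G_2$. *)
have nE : (gamma_measure mu1 mu2 p q).-negligible (~` (E G1 p `*` E G2 q)).
  apply/(negligibleP _ (measurableC mEE)).
  have h1 := (ae_tupleP mu1 (mE G1 p)).2 (ae_tuple_mem p mu1_haar).
  have h2 := (ae_tupleP mu2 (mE G2 q)).2 (ae_tuple_mem q mu2_haar).
  apply/ae_product => //.
  have {}h1 := (negligibleP _ (measurableC (mE G1 p))).2 h1.
  have {}h2 := (negligibleP _ (measurableC (mE G2 q))).2 h2.
  apply: negligibleS h1 => t /= nt Et; apply: nt.
  by apply: negligibleS h2 => s /= ns Es; apply: ns.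
apply: negligibleS (negligibleU nF nE) => -[t s] Dts.
have [[/= Et Es]|nts] := pselect ((E G1 p `*` E G2 q) (t, s)); last by right.
left; pose y (u : seq (borel G)) l : G := (\prod_(k < l) nth 1%g u k)%g.
have yS u l : y u l.+1 = (y u l * nth 1%g u l)%g by rewrite /y big_ord_recr.
have [||l _|l _|E1 E2] := @path_confE p q (t, s) (y t) (y s); rewrite ?yS//.
  by rewrite /y big_ord0.
  by rewrite /y big_ord0.
set z := path_conf _ in E1 E2.
(* A non-zero value forces [z] to be generic, as [hat] is 0 elsewhere. With entries in the
   subgroups, the tuple is then the [cross] of the realization of [z]. *)
have zF : hat F z <> 0 by [].
have zg : generic G1 G2 p q z.
  by apply: contrapT => ng; apply: zF; rewrite /hat; case: asboolP.
have y1G l : (l <= p)%N -> csg_set G1 (y t l).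
  move=> lp; rewrite /y; elim/big_ind: _ => [|a b|k _]; [exact: csg_one|exact: csg_mul|].
  have kp : (k < p)%N := leq_trans (ltn_ord k) lp.
  by have := Et (Ordinal kp); rewrite (tnth_nth 1%g).
have y2G l : (l <= q)%N -> csg_set G2 (y s l).
  move=> lq; rewrite /y; elim/big_ind: _ => [|a b|k _]; [exact: csg_one|exact: csg_mul|].
  have kq : (k < q)%N := leq_trans (ltn_ord k) lq.
  by have := Es (Ordinal kq); rewrite (tnth_nth 1%g).
have y0 u : y u 0%N = 1%g by rewrite /y big_ord0.
have cell1 l : (l <= p)%N -> cell G1 G2 p q z l 0 = y t l.
  move=> lp; rewrite cellE// E1// E2// y0.
  have [|//|_ ->//] := @crossing_uniq _ _ _ G12_meet 1%g (y t l) (y t l).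
    by rewrite invg1 mul1g; exact: y1G.
  by rewrite mulVg; exact: csg_one.
have cell2 l : (l <= q)%N -> cell G1 G2 p q z 0 l = y s l.
  move=> lp; rewrite cellE// E1// E2// y0.
  have [|//|_ ->//] := @crossing_uniq _ _ _ G12_meet (y s l) 1%g (y s l).
    by rewrite mulVg; exact: csg_one.
  by rewrite invg1 mul1g; exact: y2G.
exists (realize G1 G2 p q z).
  by move=> F0; apply: zF; rewrite hatE// F0 pm_act0.
congr (_, _); apply: eq_from_tnth => k; rewrite tnth_mktuple /vedge /hedge mxE /=.
  have kp := ltn_ord k; rewrite !cell1 ?lift0//; last exact: ltnW.
  by rewrite yS mulKg (tnth_nth 1%g).
have kp := ltn_ord k; rewrite !cell2 ?lift0//; last exact: ltnW.
by rewrite yS mulKg (tnth_nth 1%g).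
Qed.

End NullSets.

Lemma borel_fun_conf (G : lcscGroupType) (X : topologicalType) (f : X -> axis -> G)
    (P : set (conf G)) : (forall i, borel_fun (fun x => f x i)) -> measurable P ->
  <<s @open X >> [set x | P (f x)].
Proof.
move=> mf; move: P.
apply: (@smallest_sub _ _ (@cylinders G) [set P | <<s @open X >> [set x | P (f x)]]) => //.
split.
- by rewrite /= (_ : [set x | _] = set0)//; exact: sigma_algebra0.
- move=> P mP /=; rewrite (_ : [set x | _] = ~` [set x | P (f x)]).
    by rewrite -setTD; exact: sigma_algebraCD.
  by apply/seteqP; split=> x; [case|].
- move=> F mF /=; rewrite (_ : [set x | _] = \bigcup_n [set x | F n (f x)]).
    exact: sigma_algebra_bigcup.
  by apply/seteqP; split=> x [n _ ?]; exists n.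
- move=> _ [i [B [mB ->]]] /=; exact: borel_fun_preimage (mf i) mB.
Qed.

Lemma mem_coords p q (a : axis) :
  (a \in coords p q) = match a with inl j => (j <= q)%N | inr i => (i <= p)%N end.
Proof. by case: a => k; [exact: mem_coords_l|exact: mem_coords_r]. Qed.

(** * Faces and specializations of classes *)

Section AlmostEveryConfiguration.
Context (R : realType) (G : lcscGroupType) (mu : {sigma_finite_measure set (borel G) -> \bar R}).
Hypothesis mu_haar : is_haar [set: G] mu.
Implicit Types (P : set (conf G)) (s : seq axis).

Let muT : is_haar (csg_set (subgroupT G)) mu := mu_haar.

Definition ae_conf p q P : Prop := forall z, ae_all (fun=> mu) (coords p q) P z.

Lemma ae_conf_mono p q P P' : ae_conf p q P -> P `<=` P' -> ae_conf p q P'.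
Proof. by move=> aeP PP' z; exact: ae_all_mono PP' _ (aeP z). Qed.

Lemma ae_confI p q P P' : ae_conf p q P -> ae_conf p q P' -> ae_conf p q (P `&` P').
Proof. by move=> aeP aeP' z; apply: ae_allI; split. Qed.

Lemma ae_conf_pull p q p' q' r c P : emb p' p r -> emb q' q c ->
  measurable P -> depends_on (coords p' q') P ->
  ae_conf p' q' P -> ae_conf p q [set z | P (pull (axis_map r c) z)].
Proof.
move=> [er1 er2] [ec1 ec2] mP dP aeP z.
apply: (ae_all_pullback _ (coords_uniq p' q') _ _ _ mP dP (aeP z)).
- exact: coords_uniq.
- move=> a b; rewrite !mem_coords.
  by move: a b => [j|i] [k|l] //= h1 h2 []; [move=> /ec2 ->|move=> /er2 ->].
- by move=> a; rewrite !mem_coords; case: a => /= j; [exact: ec1|exact: er1].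
Qed.

Lemma ae_all_fixed s a g P P' z : a \notin s -> (forall z, z a = g -> P z -> P' z) ->
  z a = g -> ae_all (fun=> mu) s P z -> ae_all (fun=> mu) s P' z.
Proof.
move=> + PP'; elim: s z => [|i s IH] z /=; first by move=> _; exact: PP'.
rewrite inE negb_or => /andP[ai /IH {}IH] za.
by apply: filterS => x; apply: IH; rewrite upd_neq.
Qed.

(* The value of the coordinate a is a left translate of g by an element that
   only depends on the other coordinates. *)
Lemma ae_all_insert s a (k : (axis -> G) -> G) P : uniq (a :: s) -> measurable P ->
  depends_on (a :: s) P -> borel_measurable (fun z : conf G => k z) ->
  (forall z z', (forall i, i \in s -> z i = z' i) -> k z = k z') ->
  (forall z, ae_all (fun=> mu) (a :: s) P z) ->
  {ae mu, forall g, forall z, ae_all (fun=> mu) s [set z | P (upd z a (k z * g)%g)] z}.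
Proof.
move=> us mP dP mk dk aeP; have /andP[aNs us'] := us.
have kE z x : k (upd z a x) = k z.
  by apply: dk => i is_; rewrite upd_neq//; apply: contraNneq aNs => <-.
have updK z x y : upd (upd z a x) a y = upd z a y.
  by apply/funext => i; rewrite /upd; case: eqP.
pose P' : set (conf G) := [set z | P (upd z a (k z * z a)%g)].
have mP' : measurable P'.
  apply: (measurable_preimage_conf (f := fun z : conf G => upd z a (k z * z a)%g)) => //.
  apply: borel_measurable_upd; first exact: borel_measurable_proj.
  by apply: borel_measurable_mulg => //; exact: borel_measurable_proj.
have aeP' z : ae_all (fun=> mu) (a :: s) P' z.
  rewrite /= ae_all_swap//; have := aeP z; rewrite /= ae_all_swap//.
  apply: ae_all_mono => {}z; rewrite /ae_at /= => h.
  have := (ae_haar_mull muT (I : csg_set (subgroupT G) (k z)) (measurable_slice z a mP)).2 h.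
  by apply: filterS => x; rewrite /P' /= kE updE updK.
pose e : axis -> G := fun=> 1%g.
apply: filterS (aeP' e) => g aeg z.
have dPg : depends_on s [set z | P (upd z a (k z * g)%g)].
  move=> z1 z2 zz; apply: dP => i; rewrite inE /upd; case: eqP => //= _ is_.
    by rewrite (dk _ _ zz).
  exact: zz.
apply: (ae_all_const (z := upd e a g) _ dPg).
apply: (ae_all_fixed (a := a) (g := g) (P := P')) => //; last by rewrite updE.
by move=> z' za; rewrite /P' /= za.
Qed.

End AlmostEveryConfiguration.

Section Operators.
Context (R : realType) (G : lcscGroupType) (G1 G2 : closed_subgroup G)
  (mu mu1 mu2 : {sigma_finite_measure set (borel G) -> \bar R}).
Hypotheses (mu_haar : is_haar [set: G] mu) (mu1_haar : is_haar (csg_set G1) mu1)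
  (mu2_haar : is_haar (csg_set G2) mu2) (G12 : is_matched_pair mu G1 G2).
Variable A : polish_module R G.
Local Notation Gam := (Gamma G1 G2).
Local Notation L := (Lgamma G1 G2 mu1 mu2 A).
Local Notation generic := (generic G1 G2).
Local Notation cell := (cell G1 G2).
Local Notation realize := (realize G1 G2).
Local Notation ae_conf := (ae_conf mu).

Let G12_meet := mp_meet G12.

(** Each of the finitely many crossing conditions is the pullback of the single one for $p=q=0$. *)
Lemma ae_conf_generic p q : ae_conf p q (generic p q).
Proof.
pose D : set (conf G) := [set z | crossing_dom G1 G2 (z (inl 0%N)) (z (inr 0%N))].
have mD : measurable D.
  apply: (borel_measurable_preimage (f := fun z : conf G => ((z (inr 0%N))^-1 * z (inl 0%N))%g)).
    apply: borel_measurable_mulg; last exact: borel_measurable_proj.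
    by apply: borel_measurable_invg; exact: borel_measurable_proj.
  exact: measurable_product_set.
have dD : depends_on (coords 0 0) D.
  by move=> z z' zz'; rewrite /D /= !zz'// mem_coords.
have aeD : ae_conf 0 0 D.
  by move=> z; apply: filterE => x; apply: filterS (ae_crossing_dom mu_haar G12 x) => w.
have aeij (s : seq ('I_p.+1 * 'I_q.+1)) : ae_conf p q [set z | forall ij, ij \in s ->
    crossing_dom G1 G2 (z (inl (ij.2 : nat))) (z (inr (ij.1 : nat)))].
  elim: s => [|[i j] s IH] z; first by rewrite ae_allT//; apply/seteqP.
  have er : emb 0 p (fun=> (i : nat)) by split=> [_ _|[|?] [|?]]//; rewrite -ltnS.
  have ec : emb 0 q (fun=> (j : nat)) by split=> [_ _|[|?] [|?]]//; rewrite -ltnS.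
  have := ae_confI (ae_conf_pull er ec mD dD aeD) IH.
  move=> /(_ z); apply: ae_all_mono => {}z [zij zs] kl; rewrite inE => /predU1P[->//|].
  exact: zs.
refine (ae_conf_mono (aeij (enum (predT : pred ('I_p.+1 * 'I_q.+1)))) _) => z zij i j ip jq.
by have := zij (inord i, inord j); rewrite mem_enum /= !inordK//; exact.
Qed.

Lemma hat_eqE p q (F F' : borel_map A (Gam p q)) :
  [set z | hat F z = hat F' z] = hat_zeros (F - F').
Proof.
apply/seteqP; split=> z; rewrite /hat_zeros /= (hatB F F'); first by move=> ->; rewrite subrr.
by move=> /eqP; rewrite subr_eq0 => /eqP.
Qed.

(** This turns identities between classes into identities between functions of independent variables
    in $G$, valid almost everywhere. *)
Lemma Lclass_eqP p q (F F' : borel_map A (Gam p q)) :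
  \pi_(L p q) F = \pi_(L p q) F' <-> ae_conf p q [set z | hat F z = hat F' z].
Proof.
rewrite hat_eqE; apply: iff_trans (_ : _ <-> (F - F') \in ae_zero (gamma_null G1 G2 mu1 mu2 p q)) _.
  by rewrite Quotient.idealrBE; split=> [->//|/eqP].
have nE := is_null_hat mu_haar mu1_haar mu2_haar G12 (F - F').
split=> [/asboolP h z|h]; first exact/nE.
by apply/asboolP/(nE (fun=> 1%g)).
Qed.

Lemma depends_on_generic p q : depends_on (coords p q) (generic p q).
Proof. by move=> z z' zz' zg i j ip jq; rewrite -!zz' ?mem_coords//; exact: zg. Qed.

Lemma Lclass_ind p q (P : L p q -> Prop) : (forall F, P (\pi_(L p q) F)) -> forall x, P x.
Proof. by move=> PF x; rewrite -[x]reprK. Qed.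

Lemma depends_on_hat_eq p q (F F' : borel_map A (Gam p q)) :
  depends_on (coords p q) [set z | hat F z = hat F' z].
Proof.
by move=> z z' zz' /=; rewrite (hat_depends G12_meet F zz') (hat_depends G12_meet F' zz').
Qed.

Lemma measurable_hat_eq p q (F F' : borel_map A (Gam p q)) :
  measurable [set z : conf G | hat F z = hat F' z].
Proof.
by rewrite hat_eqE; exact: (measurable_hat_zeros G12).
Qed.

Definition face p q p' q' (r c : nat -> nat) : L p' q' -> L p q := Lmap (face_map p q r c).

Lemma face_pi p q p' q' r c (F : borel_map A (Gam p' q')) : emb p' p r -> emb q' q c ->
  face p q r c (\pi_(L p' q') F) = \pi_(L p q) (face_map p q r c F).
Proof.
move=> er ec; apply/Lclass_eqP.
have /Lclass_eqP := reprK (\pi_(L p' q') F).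
move=> /(ae_conf_pull er ec (measurable_hat_eq _ _) (@depends_on_hat_eq _ _ _ _)) h.
refine (ae_conf_mono (ae_confI h (ae_conf_generic p q)) _) => z [hz zg] /=.
by rewrite !hat_face_map//; [exact: er.1|exact: ec.1|exact: er.1|exact: ec.1].
Qed.

Lemma face_ext p q p' q' r r' c c' (x : L p' q') :
  (forall k, (k <= p')%N -> r k = r' k) -> (forall k, (k <= q')%N -> c k = c' k) ->
  face p q r c x = face p q r' c' x.
Proof.
move=> rr cc; congr (\pi_(L p q) _); apply: val_inj; apply/funext => X.
rewrite [LHS]face_mapE [RHS]face_mapE (rr 0%N)// (cc 0%N)//.
have -> : (fun i : 'I_p'.+1 => inord (r i) : 'I_p.+1) = fun i => inord (r' i).
  by apply/funext => i; rewrite rr// -ltnS.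
suff -> : (fun j : 'I_q'.+1 => inord (c j) : 'I_q.+1) = fun j => inord (c' j) by [].
by apply/funext => j; rewrite cc// -ltnS.
Qed.

Lemma face_B p q p' q' r c : emb p' p r -> emb q' q c -> zmod_morphism (@face p q p' q' r c).
Proof.
move=> er ec x y; elim/Lclass_ind: x => F; elim/Lclass_ind: y => F'.
rewrite -raddfB !face_pi// -raddfB; congr (\pi_(L p q) _).
by apply: val_inj; apply/funext => X; exact: pm_actB.
Qed.

Lemma face_comp p q p' q' p'' q'' r c r' c' (x : L p'' q'') :
  emb p' p r -> emb q' q c -> emb p'' p' r' -> emb q'' q' c' ->
  face p q r c (face p' q' r' c' x) = face p q (r \o r') (c \o c') x.
Proof.
move=> er ec er' ec'; elim/Lclass_ind: x => F.
rewrite !face_pi//; [|exact: emb_comp er er'|exact: emb_comp ec ec'].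
apply/Lclass_eqP; refine (ae_conf_mono (ae_conf_generic p q) _) => z zg /=.
have [er1 _] := er; have [ec1 _] := ec; have [er1' _] := er'; have [ec1' _] := ec'.
have er2 k : (k <= p'')%N -> ((r \o r') k <= p)%N by move=> /er1'/er1.
have ec2 k : (k <= q'')%N -> ((c \o c') k <= q)%N by move=> /ec1'/ec1.
have zg' : generic p' q' (pull (axis_map r c) z).
  by move=> i j ip jq; apply: zg; [exact: er1|exact: ec1].
by rewrite !hat_face_map//; congr (hat F _); apply/funext; case.
Qed.

Lemma face_id p q (x : L p q) : face p q id id x = x.
Proof.
elim/Lclass_ind: x => F; rewrite face_pi; try exact: emb_id.
apply/Lclass_eqP; refine (ae_conf_mono (ae_conf_generic p q) _) => z zg /=.
by rewrite hat_face_map//; congr (hat F _); apply/funext; case.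
Qed.

Section Insertion.
Variables (p q p' q' : nat) (a : axis).
Hypothesis ext : perm_eq (coords p' q') (a :: coords p q).

Let mem_ext i : i \in coords p' q' -> i != a -> i \in coords p q.
Proof. by rewrite (perm_mem ext) inE => /orP[->|]. Qed.

Let notin_ext : a \notin coords p q.
Proof. by have := coords_uniq p' q'; rewrite (perm_uniq ext) => /andP[]. Qed.

Lemma insert_subproof (br bc : nat) (g : G) (F : borel_map A (Gam p' q')) :
  borel_fun (fun X : Gam p q => hat F (upd (boundary X) a (vertex X (inord br) (inord bc) * g)%g)).
Proof.
move=> U oU; apply: (borel_fun_conf (P := [set z | U (hat F z)])); last first.
  exact: borel_measurable_hat.
move=> i; apply: borel_fun_continuous; rewrite /upd; case: (i == a) => /=.
  apply: continuous_mulg; first exact: continuous_vertex.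
  exact: cst_continuous.
by case: i => k /=; exact: continuous_vertex.
Qed.

(* The coordinate a is set to y_{br,bc} g, in the matrix y representing X. *)
Definition insert_map br bc g F : borel_map A (Gam p q) := mk_borel_map (insert_subproof br bc g F).

Definition insert br bc g : L p' q' -> L p q := Lmap (insert_map br bc g).

(** [insert_map] works at the representative with $y_{00}=1$. Left translation by [h] leads back to
    [z] up to cosets, and turns $h^{-1}y_{br,bc}\,g$ into $y_{br,bc}\,g$. *)
Lemma hat_insert br bc g F z : (br <= p)%N -> (bc <= q)%N -> generic p q z ->
  hat (insert_map br bc g F) z = hat F (upd z a (cell p q z br bc * g)%g).
Proof.
move=> brp bcq zg; rewrite hatE//= vertex_realize !inordK//; apply/esym.
set h := cell p q z 0 0.
apply: hat_equivariant => //.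
all: move=> k kle; rewrite /upd; case: eqP => [_|/eqP ka].
- by rewrite -(mulgA h^-1%g) mulVKg mulVg; exact: csg_one.
- have kq : (k <= q)%N by have := mem_ext _ ka; rewrite !mem_coords; apply.
  rewrite /boundary vertex_realize mulVKg !inordK// cellE//.
  have [h1 _] := crossingP (zg 0 k (leq0n p) kq).
  by have := csg_inv h1; rewrite invgM invgK.
- by rewrite -(mulgA h^-1%g) mulVKg mulVg; exact: csg_one.
have kp : (k <= p)%N by have := mem_ext _ ka; rewrite !mem_coords; apply.
rewrite /boundary vertex_realize mulVKg !inordK// cellE//.
have [_ h1] := crossingP (zg k 0 kp (leq0n q)).
by have := csg_inv h1; rewrite invgM invgK.
Qed.

Lemma ae_conf_insert br bc P : (br <= p)%N -> (bc <= q)%N -> measurable P ->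
  depends_on (coords p' q') P -> ae_conf p' q' P ->
  {ae mu, forall g, ae_conf p q [set z | generic p q z /\ P (upd z a (cell p q z br bc * g)%g)]}.
Proof.
move=> brp bcq mP dP aeP.
have us : uniq (a :: coords p q) by rewrite -(perm_uniq ext) coords_uniq.
pose k (z : axis -> G) := crossing G1 G2 (z (inl bc)) (z (inr br)).
have mk : borel_measurable (fun z : conf G => k z).
  by apply: borel_measurable_crossing => //; exact: borel_measurable_proj.
have dk z z' : (forall i, i \in coords p q -> z i = z' i) -> k z = k z'.
  by move=> zz'; rewrite /k !zz' ?mem_coords.
have dP' : depends_on (a :: coords p q) P.
  by move=> z z' zz'; apply: dP => i; rewrite (perm_mem ext); exact: zz'.
have aeP' z : ae_all (fun=> mu) (a :: coords p q) P z.
  by rewrite -(ae_all_perm _ (coords_uniq p' q') ext mP).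
apply: filterS (ae_all_insert mu_haar us mP dP' mk dk aeP') => g aeg.
refine (ae_conf_mono (ae_confI (ae_conf_generic p q) aeg) _) => z [zg Pz] /=.
by rewrite cellE.
Qed.

(** The exceptional set of [g] depends on the chosen representative [F]. This is the reason why the
    specialization axioms quantify over almost every [g] after the classes are given. *)
Lemma insert_pi br bc (F : borel_map A (Gam p' q')) : (br <= p)%N -> (bc <= q)%N ->
  {ae mu, forall g, insert br bc g (\pi_(L p' q') F) = \pi_(L p q) (insert_map br bc g F)}.
Proof.
move=> brp bcq; have /Lclass_eqP := reprK (\pi_(L p' q') F).
move=> /(ae_conf_insert brp bcq (measurable_hat_eq _ _) (@depends_on_hat_eq _ _ _ _)).
apply: filterS => g h; apply/Lclass_eqP; refine (ae_conf_mono h _) => z [zg hz] /=.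
by rewrite !hat_insert.
Qed.

Lemma insert_B br bc (x y : L p' q') : (br <= p)%N -> (bc <= q)%N ->
  {ae mu, forall g, insert br bc g (x - y) = insert br bc g x - insert br bc g y}.
Proof.
move=> brp bcq; elim/Lclass_ind: x => F; elim/Lclass_ind: y => F'; rewrite -raddfB.
apply: filterS3 (insert_pi F brp bcq) (insert_pi F' brp bcq) (insert_pi (F - F') brp bcq).
move=> g -> -> ->; rewrite -raddfB; congr (\pi_(L p q) _).
by apply: val_inj; apply/funext => X /=; rewrite hatB.
Qed.

Lemma insert_skip p1 q1 r c br bc (x : L p1 q1) : emb p1 p r -> emb q1 q c ->
  emb p1 p' r -> emb q1 q' c -> (br <= p)%N -> (bc <= q)%N ->
  {ae mu, forall g, insert br bc g (face p' q' r c x) = face p q r c x}.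
Proof.
move=> er ec er' ec' brp bcq; elim/Lclass_ind: x => F; rewrite !face_pi//.
have h1 := insert_pi (face_map p' q' r c F) brp bcq.
have h2 := ae_conf_insert brp bcq
  (measurable_generic G1 G2 p' q') (@depends_on_generic p' q') (ae_conf_generic p' q').
apply: filterS2 h1 h2 => g -> h.
 apply/Lclass_eqP; refine (ae_conf_mono h _) => z [zg zg'] /=.
have [er1 _] := er; have [ec1 _] := ec; have [er1' _] := er'; have [ec1' _] := ec'.
rewrite hat_insert// !hat_face_map//; apply: hat_depends => // i iF.
rewrite /pull upd_neq//; apply: contraNneq notin_ext => <-; move: iF; rewrite !mem_coords.
by case: i => k /=; [exact: ec1|exact: er1].
Qed.

End Insertion.

Lemma insert_face p q p1 q1 a p' q' p1' q1' a' r c br bc br' bc' (x : L p1' q1')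
    (ext : perm_eq (coords p1 q1) (a :: coords p q))
    (ext' : perm_eq (coords p1' q1') (a' :: coords p' q')) :
  emb p1' p1 r -> emb q1' q1 c -> emb p' p r -> emb q' q c ->
  axis_map r c a' = a -> (br' <= p')%N -> (bc' <= q')%N -> r br' = br -> c bc' = bc ->
  {ae mu, forall g, insert p q a br bc g (face p1 q1 r c x) =
                    face p q r c (insert p' q' a' br' bc' g x)}.
Proof.
move=> er1 ec1 er ec aE brp' bcq' brE bcE; elim/Lclass_ind: x => F; rewrite face_pi//.
have [er1b er1i] := er1; have [ec1b ec1i] := ec1; have [erb _] := er; have [ecb _] := ec.
have brp : (br <= p)%N by rewrite -brE erb.
have bcq : (bc <= q)%N by rewrite -bcE ecb.
apply: filterS3 (insert_pi ext (face_map p1 q1 r c F) brp bcq) (insert_pi ext' F brp' bcq')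
  (ae_conf_insert ext brp bcq (measurable_generic G1 G2 p1 q1)
    (@depends_on_generic p1 q1) (ae_conf_generic p1 q1)).
move=> g -> -> h; rewrite face_pi//; apply/Lclass_eqP; refine (ae_conf_mono h _) => z [zg zg'] /=.
have zgp : generic p' q' (pull (axis_map r c) z).
  by move=> i j ip jq; apply: zg; [exact: erb|exact: ecb].
rewrite (hat_insert ext)// !hat_face_map// (hat_insert ext')//.
rewrite [in RHS]cellE// cellE// /pull /= brE bcE.
apply: hat_depends => // i iF; rewrite /upd -aE.
have aF : a' \in coords p1' q1' by rewrite (perm_mem ext') mem_head.
have [->|ia] := eqVneq i a'; first by rewrite eqxx.
suff -> : (axis_map r c i == axis_map r c a') = false by [].
apply: contraNF ia => /eqP; move: aF iF; rewrite !mem_coords.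
by case: i a' {ext' aE} => [j|i] [k|l] //= k1 k2 [] e; [rewrite (ec1i j k)|rewrite (er1i i l)].
Qed.

Lemma iota_rcons n : iota 0 n.+1 = rcons (iota 0 n) n.
Proof. by rewrite -[n.+1]addn1 iotaD add0n cats1. Qed.

Lemma coords_col p q : perm_eq (coords p q.+1) (inl q.+1 :: coords p q).
Proof. by rewrite /coords (iota_rcons q.+1) map_rcons cat_rcons -cat1s perm_catCA. Qed.

Lemma coords_row p q : perm_eq (coords p.+1 q) (inr p.+1 :: coords p q).
Proof. by rewrite /coords (iota_rcons p.+1) map_rcons -rcons_cat perm_rcons. Qed.

Theorem gamma_specialization :
  specialization_axioms (V := fun p q => L p q) (Om := borel G) (almost_everywhere mu)
    (fun p q p' q' r c x => face p q r c x)
    (fun p q q' br bc g x => insert p q (inl q') br bc g x)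
    (fun p q p' br bc g x => insert p q (inr p') br bc g x).
Proof.
have emb_restr m n c : emb m.+1 n.+1 c -> c m.+1 = n.+1 -> emb m n c.
  move=> [c1 c2] cm; split=> [k km|k l km lm]; last by apply: c2; exact: leqW.
  rewrite -ltnS ltn_neqAle c1 ?leqW// andbT -cm; apply/eqP => /c2 kE.
  by have := kE (leqW km) (leqnn _); move: km => /[swap] ->; rewrite ltnn.
have embS m n c : emb m n c -> emb m n.+1 c.
  by move=> [c1 c2]; split=> // k /c1; exact: leqW.
split.
- by move=> *; exact: face_ext.
- by move=> *; exact: face_B.
- by move=> *; exact: face_comp.
- by move=> *; exact: face_id.
- by move=> p q br bc x y; apply: insert_B (coords_col p q) _ _ _ _.
- move=> p q p' q' r c br bc br' bc' x er ec cq brp bcq brE bcE.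
  apply: (insert_face x (coords_col p q) (coords_col p' q')) => //.
    exact: emb_restr.
  by rewrite /= cq.
- move=> p q p' q' r c br bc x er ec; apply: (insert_skip (coords_col p q)) => //.
  exact: embS.
- by move=> p q br bc x y; apply: insert_B (coords_row p q) _ _ _ _.
- move=> p q p' q' r c br bc br' bc' x er ec rp brp bcq brE bcE.
  apply: (insert_face x (coords_row p q) (coords_row p' q')) => //.
    exact: emb_restr.
  by rewrite /= rp.
- move=> p q p' q' r c br bc x er ec; apply: (insert_skip (coords_row p q)) => //.
  exact: embS.
Qed.

End Operators.

(** * Cohomology *)

Lemma cohomology_map_bijective (C D : cochain_complex) (f : cochain_map C D) n :
  (forall z : C n, cdiff z = 0 -> is_coboundary (cmap f z) -> is_coboundary z) ->
  (forall x : D n, cdiff x = 0 -> exists2 z : C n, cdiff z = 0 & is_coboundary (x - cmap f z)) ->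
  bijective (@cohomology_map C D f n).
Proof.
move=> inj surj.
have Dclass (x y : cocycle D n) : \pi_(cohomology D n) x = \pi_(cohomology D n) y <->
    is_coboundary (cocycle_val x - cocycle_val y).
  split=> [/eqP|h]; first by rewrite -Quotient.idealrBE => /asboolP.
  by apply/eqP; rewrite -Quotient.idealrBE; apply/asboolP.
have surj' (y : cohomology D n) : exists x, cohomology_map f x = y.
  have /eqP cy := cocycleP (repr y).
  have [z cz yz] := surj _ cy; have cz' : z \in @cocycle_pred C n by apply/eqP.
  exists (\pi_(cohomology C n) (Cocycle cz')); rewrite cohomology_mapE.
  by rewrite -[y in RHS]reprK; apply/esym/Dclass.
have inj' : injective (@cohomology_map C D f n).
  move=> x y xy; apply/eqP; rewrite -subr_eq0.
  have : cohomology_map f (x - y) = 0 by rewrite raddfB /= xy subrr.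
  move: (x - y) => {xy}u; rewrite -[u]reprK cohomology_mapE -(raddf0 \pi_(cohomology D n)).
  move=> /Dclass; rewrite subr0 => /inj h.
  have {}h := h (eqP (cocycleP (repr u))).
  apply/eqP; rewrite -(raddf0 \pi_(cohomology C n)); apply/eqP.
  by rewrite -Quotient.idealrBE subr0; apply/asboolP.
exists (fun y => sval (cid (surj' y))) => [x|y]; last by case: cid.
by apply: inj'; case: cid.
Qed.

(** * Identification with the Kac and pentagonal complexes *)

Section Transport.
Context (R : realType) (G : lcscGroupType) (G1 G2 : closed_subgroup G)
  (mu mu1 mu2 : {sigma_finite_measure set (borel G) -> \bar R}).
Hypotheses (mu_haar : is_haar [set: G] mu) (mu1_haar : is_haar (csg_set G1) mu1)
  (mu2_haar : is_haar (csg_set G2) mu2) (G12 : is_matched_pair mu G1 G2).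
Variable A : polish_module R G.
Local Notation Gam := (Gamma G1 G2).
Local Notation L := (Lgamma G1 G2 mu1 mu2 A).
Local Notation FR := (@face R G G1 G2 mu1 mu2 A).

Let ax : specialization_axioms (V := fun p q => L p q) (Om := borel G) (almost_everywhere mu)
    FR (fun p q q' => @insert R G G1 G2 mu mu1 mu2 G12 A p q p q' (inl q'))
    (fun p q p' => @insert R G G1 G2 mu mu1 mu2 G12 A p q p' q (inr p')) :=
  gamma_specialization mu_haar mu1_haar mu2_haar G12 A.

Let properG : ProperFilter (almost_everywhere mu) :=
  haar_proper (mu_haar : is_haar (csg_set (subgroupT G)) mu).

Lemma inord0 n : inord 0 = ord0 :> 'I_n.+1.
Proof. by apply: val_inj; rewrite /= inordK. Qed.

Lemma inord_lift n (i : 'I_n.+1) (j : 'I_n) : inord (bump i j) = lift i j :> 'I_n.+1.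
Proof. by apply: val_inj; rewrite /= inordK//; exact: ltn_ord (lift i j). Qed.

Lemma inord1 n : inord 1 = edge_dst ord0 :> 'I_n.+2.
Proof. by apply: val_inj; rewrite /= inordK. Qed.

Lemma edge_src0 n : edge_src ord0 = ord0 :> 'I_n.+2.
Proof. exact: val_inj. Qed.

Lemma vertex01 p q (X : Gam p q.+1) : vertex X ord0 (inord 1) = hedge X ord0 ord0.
Proof. by rewrite inord1 vertex_dst_r edge_src0 vertex00 mul1g. Qed.

Lemma vertex10 p q (X : Gam p.+1 q) : vertex X (inord 1) ord0 = vedge X ord0 ord0.
Proof. by rewrite inord1 vertex_dst_l edge_src0 vertex00 mul1g. Qed.

Lemma dh_mapE p q (i : 'I_q.+2) (F : borel_map A (Gam p q)) :
  dh_map i F = face_map p q.+1 id (bump i) F.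
Proof.
apply: val_inj; apply/funext => X; rewrite [RHS]face_mapE inord0.
have -> : (fun k : 'I_p.+1 => inord (id k)) = id :> ('I_p.+1 -> 'I_p.+1).
  by apply/funext => k; rewrite inord_val.
have -> : (fun k : 'I_q.+1 => inord (bump i k)) = lift i.
  by apply/funext => k; rewrite inord_lift.
rewrite /dh_map; have [->|i0] := eqVneq i ord0.
  by rewrite /bump /= vertex01.
rewrite (_ : bump i 0 = 0)%N; last by rewrite /bump leqn0 (negPf (i0 : (i : nat) != 0%N)).
by rewrite inord0 vertex00 pm_act1.
Qed.

Lemma dv_mapE p q (i : 'I_p.+2) (F : borel_map A (Gam p q)) :
  dv_map i F = face_map p.+1 q (bump i) id F.
Proof.
apply: val_inj; apply/funext => X; rewrite [RHS]face_mapE inord0.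
have -> : (fun k : 'I_q.+1 => inord (id k)) = id :> ('I_q.+1 -> 'I_q.+1).
  by apply/funext => k; rewrite inord_val.
have -> : (fun k : 'I_p.+1 => inord (bump i k)) = lift i.
  by apply/funext => k; rewrite inord_lift.
rewrite /dv_map; have [->|i0] := eqVneq i ord0.
  by rewrite /bump /= vertex10.
rewrite (_ : bump i 0 = 0)%N; last by rewrite /bump leqn0 (negPf (i0 : (i : nat) != 0%N)).
by rewrite inord0 vertex00 pm_act1.
Qed.

Lemma dh_E p q (i : 'I_q.+2) (x : L p q) : dh_ i x = face p q.+1 id (bump i) x.
Proof. by congr (\pi_(L p q.+1) _); exact: dh_mapE. Qed.

Lemma dv_E p q (i : 'I_p.+2) (x : L p q) : dv_ i x = face p.+1 q (bump i) id x.
Proof. by congr (\pi_(L p.+1 q) _); exact: dv_mapE. Qed.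

Lemma dhE p q (x : L p q) : dh x = hsum FR q.+2 q.+1 x.
Proof. by apply: eq_bigr => i _; rewrite dh_E. Qed.

Lemma dvE p q (x : L p q) : dv x = vsum FR p.+2 p.+1 x.
Proof. by apply: eq_bigr => i _; rewrite dv_E. Qed.

(** The product of left edges in [corner_map] is the vertex $y_{i0}$, the upper left corner of the
    block, by which [face_map] acts. *)
Lemma corner_mapE m i (F : borel_map A (Gam (m - i).+1 i.+1)) : (i <= m)%N ->
  corner_map m.+1 F = face_map m.+1 m.+1 (addn i) (corner_col m i) F.
Proof.
move=> im; apply: val_inj; apply/funext => X; rewrite [RHS]face_mapE.
have -> : (fun k : 'I_(m - i).+2 => inord (i + k)) =
    (fun k => inord (m.+1 - (m - i).+1 + k)) :> ('I_(m - i).+2 -> 'I_m.+2).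
  by apply/funext => k; rewrite subSS subKn.
have -> : (fun k : 'I_i.+2 => inord (corner_col m i k)) = (fun k => inord k) :> ('I_i.+2 -> 'I_m.+2).
  by apply/funext => k; rewrite /corner_col ltn_ord.
rewrite /corner_col addn0 /= inord0 /vertex [X in (_ * X)%g]big_pred0 ?mulg1//.
by rewrite inordK ?ltnS ?leqW.
Qed.

Definition base_class (a : A) : L 0 0 := Lcst G1 G2 mu1 mu2 0 0 a.

Lemma base_classB : zmod_morphism base_class.
Proof.
by move=> a b; rewrite /base_class /Lcst -raddfB; congr (\pi_(L 0 0) _); exact: val_inj.
Qed.

(** The point $\Gamma_{00}$ is not null: a pair of variables with crossing cosets exists, and the
    value can be read off there. *)
Lemma base_class_inj a : base_class a = 0 -> a = 0.
Proof.
rewrite -(raddf0 \pi_(L 0 0)) => /(Lclass_eqP mu_haar mu1_haar mu2_haar G12) h.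
have := ae_confI h (ae_conf_generic mu_haar G12 0 0) (fun=> 1%g).
move=> /(ae_haar_ex (H := subgroupT G) mu_haar)[x _].
move=> /(ae_haar_ex (H := subgroupT G) mu_haar)[w _ [E zg]].
by move: E; rewrite /= !hatE// pm_act0 => /pm_act_inj.
Qed.

Lemma base_class_surj x : exists a, x = base_class a.
Proof.
elim/Lclass_ind: x => F; exists (F (realize G1 G2 0 0 (fun=> 1%g))).
congr (\pi_(L 0 0) _); apply: val_inj; apply/funext => X /=.
by congr (F _); apply: gamma_ext => [[]|i []].
Qed.

(** The elements $x$, $s$, $h$, $e$ are the vertices $y_{11}$, $y_{01}$, $y_{10}$, $y_{00}$, each
    obtained by omitting one of two rows and one of two columns. *)
Lemma kac_d0E a : kac_d0 G1 G2 mu1 mu2 a = hsum FR 2 1 (vsum FR 2 1 (base_class a)).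
Proof.
rewrite /hsum /vsum !asum_recl !asum0 !subr0 !(R_B ax); try by emb_tac.
rewrite !(R_comp ax) ?(face_pi mu_haar mu1_haar mu2_haar G12); try by emb_tac.
rewrite -!raddfB; congr (\pi_(L 1 1) _); apply: val_inj; apply/funext => X /=.
rewrite opprB addrA -[RHS]/(pm_act (vertex X (inord 1) (inord 1)) a -
  pm_act (vertex X (inord 0) (inord 1)) a + pm_act (vertex X (inord 0) (inord 0)) a -
  pm_act (vertex X (inord 1) (inord 0)) a).
have -> : vertex X (inord 1) (inord 1) = (hedge X ord0 ord0 * vedge X ord0 ord_max)%g.
  rewrite {1}inord1 vertex_dst_l edge_src0 vertex01; congr (_ * vedge X _ _)%g.
  by rewrite inord1; exact: val_inj.
rewrite !inord0 vertex01 vertex10 vertex00 pm_act1 addrAC.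
by [].
Qed.

(** Only degree 0 is changed, from $A$ to the classes on the point $\Gamma_{00}$. In positive
    degrees [0 + p.+1] converts to [p.+1], and the two kinds of cochains coincide. *)
Definition kac_base n : kac_obj G1 G2 mu1 mu2 A n -> kac_cochains (fun p q => L p q) 0 n :=
  match n with 0 => base_class | _ => id end.

Definition pent_base n : pent_obj G1 G2 mu1 mu2 A n -> pent_cochains (fun p q => L p q) 0 n :=
  match n with 0 => fun ab => (base_class ab.1, base_class ab.2) | _ => id end.

Lemma kac_dE n (x : kac_obj G1 G2 mu1 mu2 A n) :
  kac_diff FR (kac_base x) = kac_base (kac_d G1 G2 mu1 mu2 A n x).
Proof.
case: n x => [|k] x.
  apply: (@antidiagP _ 0 0) => -[|p] [|q] // e; rewrite !extend0E /=.
  by rewrite kac_d0E.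
apply: (@antidiagP _ 0 k.+1) => p q e; rewrite extend0E /=.
rewrite extend0E /= /kd; congr (_ + _).
  case: q e => //= q e; rewrite (extend0E _ (succn_inj (etrans (esym (addnS p q)) e))).
  by apply/esym; exact: dhE.
case: p e => //= p e; rewrite (extend0E _ (succn_inj e)).
by congr altsgn; apply/esym; exact: dvE.
Qed.

Lemma pent_dE n (x : pent_obj G1 G2 mu1 mu2 A n) :
  pent_diff FR (pent_base x) = pent_base (pent_d G1 G2 mu1 mu2 A n x).
Proof.
case: n x => [|k] x /=.
  rewrite kac_d0E; congr (_ + _); rewrite dh_E dv_E (R_comp ax); try by emb_tac.
apply: eq_bigr => -[i ik] _ /=; rewrite dh_E dv_E (R_comp ax); try by emb_tac.
rewrite !inordK; [|lia..].
by [].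
Qed.

Lemma T_mapE n (x : kac_obj G1 G2 mu1 mu2 A n) :
  comparison FR (kac_base x) = pent_base (T_map G1 G2 mu1 mu2 A n x).
Proof.
case: n x => [|k] x /=; first by congr (_, _); rewrite -(subrr (0 : A)) base_classB subrr.
apply: eq_bigr => i _; rewrite (extend0E _ (subnK (leq_ord i))).
rewrite /tcorner; congr (\pi_(L k.+1 k.+1) _).
by apply: esym; apply: corner_mapE; exact: leq_ord.
Qed.

Lemma kac_baseB n : zmod_morphism (@kac_base n).
Proof. by case: n => // x y; exact: base_classB. Qed.

Lemma pent_baseB n : zmod_morphism (@pent_base n).
Proof. by case: n => // x y; congr (_, _); exact: base_classB. Qed.

Lemma base_class_eq a b : base_class a = base_class b -> a = b.
Proof.
move=> ab; apply/eqP; rewrite -subr_eq0; apply/eqP/base_class_inj.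
by rewrite base_classB ab subrr.
Qed.

Lemma kac_base_inj n : injective (@kac_base n).
Proof. by case: n => [|n] x y //; exact: base_class_eq. Qed.

Lemma pent_base_inj n : injective (@pent_base n).
Proof. by case: n => [|n] // [a b] [a' b'] [/base_class_eq -> /base_class_eq ->]. Qed.

Lemma kac_base_surj n y : exists x, y = @kac_base n x.
Proof. by case: n y => [|n] y; [exact: base_class_surj|exists y]. Qed.

Lemma pent_base_surj n y : exists x, y = @pent_base n x.
Proof.
case: n y => [[a b]|n y]; last by exists y.
have [[a' ->] [b' ->]] := (base_class_surj a, base_class_surj b).
by exists (a', b').
Qed.

Lemma kac_base0 n : @kac_base n 0 = 0.
Proof. by rewrite -(subrr 0) kac_baseB subrr. Qed.

Lemma pent_base0 n : @pent_base n 0 = 0.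
Proof. by rewrite -(subrr 0) pent_baseB subrr. Qed.

Lemma kac_is_complex : is_complex (kac_d G1 G2 mu1 mu2 A).
Proof.
split=> [n x y|n x]; apply: kac_base_inj.
  by rewrite kac_baseB -!kac_dE kac_baseB (kac_diffB ax).
by rewrite -!kac_dE (kac_diff_diff ax) kac_base0.
Qed.

Lemma pent_is_complex : is_complex (pent_d G1 G2 mu1 mu2 A).
Proof.
split=> [n x y|n x]; apply: pent_base_inj.
  by rewrite pent_baseB -!pent_dE pent_baseB (pent_diffB ax).
by rewrite -!pent_dE (pent_diff_diff ax) pent_base0.
Qed.

Lemma T_is_cochain_map : is_cochain_map (C := CochainComplex kac_is_complex)
  (D := CochainComplex pent_is_complex) (T_map G1 G2 mu1 mu2 A).
Proof.
split=> [n x y|n x]; apply: pent_base_inj.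
  by rewrite pent_baseB -!T_mapE kac_baseB (comparisonB ax).
apply: etrans (esym (pent_dE (T_map G1 G2 mu1 mu2 A n x))) _.
apply: etrans (T_mapE (kac_d G1 G2 mu1 mu2 A n x)).
by rewrite -T_mapE -kac_dE (pent_diff_comparison ax).
Qed.

Lemma T_cohomology_bijective n :
  bijective (@cohomology_map _ _ (CochainMap T_is_cochain_map) n).
Proof.
apply: cohomology_map_bijective => [z /= dz|x /= dx].
  (* Degree 0 is separate: its only coboundary is 0 and $T(a)=(a,0)$ is visibly injective, whereas
     the cone argument covers the positive degrees. *)
  case: n z dz => [|n] z dz /=.
    move=> Tz; apply: (@kac_base_inj 0); rewrite kac_base0.
    apply: (comparison0_inj (R := FR)); rewrite T_mapE.
    exact: etrans (congr1 (@pent_base 0) Tz) (pent_base0 0).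
  move=> [y Ty].
  have dz' : kac_diff FR (kac_base z) = 0.
    by rewrite kac_dE; exact: etrans (congr1 (@kac_base n.+2) dz) (kac_base0 n.+2).
  have Tz : comparison FR (kac_base z) = pent_diff FR (pent_base y).
    by rewrite T_mapE pent_dE -[pent_d _ _ _ _ _ _ _]Ty.
  have [c zc] := comparison_inj (aeF := properG) ax dz' Tz.
  have [c' cE] := kac_base_surj c.
  by exists c'; apply: (@kac_base_inj n.+1); rewrite -kac_dE -cE.
have dx' : pent_diff FR (@pent_base n x) = 0.
  by rewrite pent_dE; exact: etrans (congr1 (@pent_base n.+1) dx) (pent_base0 n.+1).
case: n x dx dx' => [|n] x dx dx'.
  have [c dc xc] := comparison0_surj (aeF := properG) ax dx'; have [c' cE] := kac_base_surj c.
  exists c' => /=.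
    by apply: (@kac_base_inj 1); rewrite -kac_dE -cE dc kac_base0.
  apply: (@pent_base_inj 0); rewrite pent_baseB pent_base0 xc cE T_mapE subrr.
  by [].
have [c [y [dc xc]]] := comparison_surj (aeF := properG) ax dx'.
have [c' cE] := kac_base_surj c; have [y' yE] := pent_base_surj y.
exists c' => /=; first by apply: (@kac_base_inj n.+2); rewrite -kac_dE -cE dc kac_base0.
exists y'; apply: (@pent_base_inj n.+1).
by rewrite pent_baseB xc cE T_mapE addrAC subrr add0r yE pent_dE.
Qed.

End Transport.

Theorem proposition5p2 (R : realType) (G : lcscGroupType)
    (G1 G2 : closed_subgroup G)
    (mu mu1 mu2 : {sigma_finite_measure set (borel G) -> \bar R})
    (mu_haar : is_haar [set: G] mu)
    (mu1_haar : is_haar (csg_set G1) mu1)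
    (mu2_haar : is_haar (csg_set G2) mu2)
    (G12 : is_matched_pair mu G1 G2)
    (A : polish_module R G) :
  exists (kacP : is_complex (kac_d G1 G2 mu1 mu2 A))
         (pentP : is_complex (pent_d G1 G2 mu1 mu2 A))
         (TP : is_cochain_map (C := CochainComplex kacP)
                 (D := CochainComplex pentP) (T_map G1 G2 mu1 mu2 A)),
    forall n : nat, bijective (@cohomology_map _ _ (CochainMap TP) n).
Proof.
exists (kac_is_complex mu_haar mu1_haar mu2_haar G12 A).
exists (pent_is_complex mu_haar mu1_haar mu2_haar G12 A).
exists (T_is_cochain_map mu_haar mu1_haar mu2_haar G12 A).
exact: T_cohomology_bijective.
Qed.
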